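(* Let $(\mathfrak{A},\Phi,\varphi)$ be a C*-dynamical system with $\Phi$ a homomorphism and $\Omega_\varphi$ a cyclic vector for $\pi_\varphi(\mathfrak{A})'$. If $\Phi$ admits a $\varphi$-adjoint $\Phi^\sharp$, then the associated W*-dynamical system $(\pi_\varphi(\mathfrak{A})'',\Phi_\bullet,\varphi_\bullet)$ admits a minimal reversible dilation $(\widehat{\mathfrak{M}},\widehat\Phi,\widehat\varphi,i,\mathcal{E})$, where: (1) the von Neumann algebra $\widehat{\mathfrak{M}}$ is the double commutant $\mathfrak{B}''$ of the unital *-subalgebra $\mathfrak{B}$ of $\mathcal{B}(\mathcal{H}_\infty)$ generated by $\bigcup_{n\in\mathbb{N}}\{\mathbf{V}_\infty^n\pi_\infty(a)\mathbf{V}_\infty^{*n}:a\in\mathfrak{A}\}$; (2) the injective homomorphism $i:\pi_\varphi(\mathfrak{A})''\to\widehat{\mathfrak{M}}$ is determined by $i(A)\Omega_\infty=Z_0A\Omega_\varphi$ for all $A\in\pi_\varphi(\mathfrak{A})''$, and the automorphism $\widehat\Phi:\widehat{\mathfrak{M}}\to\widehat{\mathfrak{M}}$ is $\widehat\Phi(X)=\mathbf{V}_\infty^*X\mathbf{V}_\infty$ for all $X\in\widehat{\mathfrak{M}}$; (3) the map $\mathcal{E}:\widehat{\mathfrak{M}}\to\pi_\varphi(\mathfrak{A})''$ is determined by $\mathcal{E}(\mathbf{V}_\infty^k\pi_\infty(a)\mathbf{V}_\infty^{-k})=\pi_\varphi(\Phi^{\sharp k}(a))$ for all $a\in\mathfrak{A}$,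 $k\in\mathbb{N}$, and the faithful normal state $\widehat\varphi$ is $\widehat\varphi(X)=\langle\Omega_\infty,X\Omega_\infty\rangle$ for all $X\in\widehat{\mathfrak{M}}$.
   Context: A C*-dynamical system is a triple $(\mathfrak{A},\Phi,\varphi)$ with $\mathfrak{A}$ a unital C*-algebra, $\Phi:\mathfrak{A}\to\mathfrak{A}$ a unital completely positive map (ucp-map) and $\varphi$ a state with $\varphi\circ\Phi=\varphi$. A W*-dynamical system is such a triple $(\mathfrak{M},\Phi,\varphi)$ with $\mathfrak{M}$ a von Neumann algebra, $\Phi$ a normal ucp-map and $\varphi$ a normal faithful state. Homomorphisms and representations are unital and *-preserving; inner products are linear in the second variable; $\mathbb{N}=\{0,1,2,\dots\}$. $(\mathcal{H}_\varphi,\pi_\varphi,\Omega_\varphi)$ is the GNS representation of $\varphi$, and $\mathbf{U}_{\Phi,\varphi}$ is the unique contraction on $\mathcal{H}_\varphi$ with $\mathbf{U}_{\Phi,\varphi}\pi_\varphi(a)\Omega_\varphi=\pi_\varphi(\Phi(a))\Omega_\varphi$ for $a\in\mathfrak{A}$. If $\Omega_\varphi$ is cyclic for $\pi_\varphi(\mathfrak{A})'$, the associated W*-dynamical system is $(\pi_\varphi(\mathfrak{A})'',\Phi_\bullet,\varphi_\bullet)$, where $\Phi_\bullet$ is the normal ucp-map determined by $\Phi_\bullet(X)\Omega_\varphi=\mathbf{U}_{\Phi,\varphi}X\Omega_\varphi$ and $\varphi_\bullet(X)=\langle\Omega_\varphi,X\Omega_\varphi\rangle$ for $X\in\pi_\varphi(\mathfrak{A})''$.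 A $\varphi$-adjoint of $\Phi$ is a ucp-map $\Phi^\sharp:\mathfrak{A}\to\mathfrak{A}$ with $\varphi(a\Phi^\sharp(b))=\varphi(\Phi(a)b)$ for all $a,b\in\mathfrak{A}$; $\Phi^{\sharp k}$ is its $k$-th iterate. The covariant GNS (CGNS) representation of $(\mathfrak{A},\Phi,\varphi)$ is the quadruple $(\pi_\infty,\mathcal{H}_\infty,\Omega_\infty,\mathbf{V}_\infty)$, unique up to unitary equivalence, consisting of a representation $\pi_\infty$ of $\mathfrak{A}$ on a Hilbert space $\mathcal{H}_\infty$, a vector $\Omega_\infty\in\mathcal{H}_\infty$ and an isometry $\mathbf{V}_\infty$ on $\mathcal{H}_\infty$, together with a linear isometry $Z_0:\mathcal{H}_\varphi\to\mathcal{H}_\infty$, such that: $\pi_\infty(a)Z_0=Z_0\pi_\varphi(a)$ for $a\in\mathfrak{A}$; $\Omega_\infty=Z_0\Omega_\varphi$; $(\mathbf{U}_{\Phi,\varphi}^* )^n=Z_0^*\mathbf{V}_\infty^nZ_0$ for all $n\in\mathbb{N}$; $\mathbf{V}_\infty\Omega_\infty=\Omega_\infty$; $\Omega_\infty$ is cyclic for the *-algebra generated by all $\mathbf{V}_\infty^n\pi_\infty(a)\mathbf{V}_\infty^{*n}$ ($n\ge0$, $a\in\mathfrak{A}$); $\pi_\infty(\Phi(a))=\mathbf{V}_\infty^*\pi_\infty(a)\mathbf{V}_\infty$ and $\varphi(a)=\langle\Omega_\infty,\pi_\infty(a)\Omega_\infty\rangle$ for $a\in\mathfrak{A}$. When $\Phi$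 is a homomorphism, $\mathbf{V}_\infty$ is unitary. A reversible dilation of a W*-dynamical system $(\mathfrak{M},\Phi,\varphi)$ is a W*-dynamical system $(\widehat{\mathfrak{M}},\widehat\Phi,\widehat\varphi)$ with $\widehat\Phi$ an automorphism, together with a normal ucp-map $\mathcal{E}:\widehat{\mathfrak{M}}\to\mathfrak{M}$ and a normal injective homomorphism $i:\mathfrak{M}\to\widehat{\mathfrak{M}}$, such that for all $a\in\mathfrak{M}$, $X\in\widehat{\mathfrak{M}}$, $n\in\mathbb{N}$: $\mathcal{E}(i(a)X)=a\mathcal{E}(X)$, $\mathcal{E}(\widehat\Phi^n(i(a)))=\Phi^n(a)$ and $\widehat\varphi(X)=\varphi(\mathcal{E}(X))$. It is minimal if $\widehat{\mathfrak{M}}$ is the von Neumann algebra generated by $\bigcup_{k\in\mathbb{Z}}\{\widehat\Phi^k(i(a)):a\in\mathfrak{M}\}$. *)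

(* Defs.v *)
From HB Require Import structures.
From mathcomp Require Import all_boot all_order all_algebra complex.
From mathcomp Require Import all_classical all_reals all_analysis.
Set Implicit Arguments.
Unset Strict Implicit.
Unset Printing Implicit Defensive.
Import Order.TTheory GRing.Theory Num.Theory numFieldNormedType.Exports.
Local Open Scope classical_set_scope.
Local Open Scope ring_scope.
Local Open Scope complex_scope.

(* Only nonzero spaces: B(H) is then a nontrivial ring, as [algType] requires.
   A space carrying a unit vector is nonzero. *)
HB.mixin Record isHilbert (R : realType) H of CompleteNormedModule R[i] H := {
  inner : H -> H -> R[i];
  inner_linear : forall x c y z,
    inner x (c *: y + z) = c * inner x y + inner x z;
  inner_conj : forall x y, inner y x = (inner x y)^*;
  inner_norm : forall x, inner x x = `|x| ^+ 2;
  hilbert_nonzero : exists x : H, x != 0 }.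

#[short(type="hilbertType")]
HB.structure Definition Hilbert (R : realType) :=
  {H of isHilbert R H & CompleteNormedModule R[i] H}.

Section BoundedOperators.
Context {R : realType}.

Definition bounded_linear (H K : hilbertType R) : {pred H -> K} :=
  [pred f | `[< linear f /\
                exists c : R[i], forall x, `|f x| <= c * `|x| >]].

Record bop (H K : hilbertType R) :=
  BOp { bopf :> H -> K ; _ : bopf \in @bounded_linear H K }.

HB.instance Definition _ (H K : hilbertType R) := [isSub for @bopf H K].
HB.instance Definition _ (H K : hilbertType R) := [Choice of bop H K by <:].

Lemma bounded_linear_submod (H K : hilbertType R) :
  submod_closed (@bounded_linear H K).
Proof.
split=> [|c f g /asboolP[lf [M Mf]] /asboolP[lg [N Ng]]]; apply/asboolP; split.
- by move=> a x y; rewrite /= scaler0 addr0.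
- by exists 0 => x; rewrite normr0 mul0r.
- by move=> a x y /=; rewrite !fctE lf lg !scalerDr !scalerA mulrC addrACA.
- exists (`|c| * M + N) => x; rewrite fctE mulrDl -mulrA.
  by rewrite (le_trans (ler_normD _ _))// lerD// normrZ ler_wpM2l.
Qed.

HB.instance Definition _ (H K : hilbertType R) :=
  GRing.isSubmodClosed.Build R[i] (H -> K)
  (@bounded_linear H K) (bounded_linear_submod H K).
HB.instance Definition _ (H K : hilbertType R) :=
  [SubChoice_isSubLmodule of bop H K by <:].

Lemma bop_linear (H K : hilbertType R) (T : bop H K) : linear T.
Proof. by case: T => f /= /asboolP[]. Qed.

Lemma bop_bounded (H K : hilbertType R) (T : bop H K) :
  exists c : R[i], 0 <= c /\ forall x, `|T x| <= c * `|x|.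
Proof.
case: T => f /= /asboolP[_ [c fc]]; exists `|c|; split=> // x.
by rewrite (le_trans (fc x))// -{1}(ger0_norm (le_trans (normr_ge0 _) (fc x)))
  normrM normr_id.
Qed.

Lemma bopP (H K : hilbertType R) (S T : bop H K) : S =1 T -> S = T.
Proof. by move=> ST; apply/val_inj/funext. Qed.

Lemma comp_bounded (H K L : hilbertType R) (S : bop K L) (T : bop H K) :
  S \o T \in @bounded_linear H L.
Proof.
apply/asboolP; split=> [a x y|]; first by rewrite /= !bop_linear.
have [c [c0 Sc]] := bop_bounded S; have [d [_ Td]] := bop_bounded T.
by exists (c * d) => x; rewrite -mulrA (le_trans (Sc _))// ler_wpM2l.
Qed.

Definition bcomp (H K L : hilbertType R) (S : bop K L) (T : bop H K) :=
  BOp (comp_bounded S T).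

Lemma id_bounded (H : hilbertType R) : idfun \in @bounded_linear H H.
Proof. by apply/asboolP; split=> //; exists 1 => x; rewrite mul1r. Qed.

Section Endomorphisms.
Context (H : hilbertType R).
Implicit Types S T W : bop H H.

Let bcompA : associative (@bcomp H H H).
Proof. by move=> S T W; apply: bopP. Qed.
Let bcomp1T : left_id (BOp (id_bounded H)) (@bcomp H H H).
Proof. by move=> T; apply: bopP. Qed.
Let bcompT1 : right_id (BOp (id_bounded H)) (@bcomp H H H).
Proof. by move=> T; apply: bopP. Qed.
Let bcompDl : left_distributive (@bcomp H H H) +%R.
Proof. by move=> S T W; apply: bopP. Qed.
Let bcompDr : right_distributive (@bcomp H H H) +%R.
Proof.
move=> S T W; apply: bopP => x /=.
by have := bop_linear S 1 (T x) (W x); rewrite !scale1r.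
Qed.

Let bid_neq0 : BOp (id_bounded H) != 0.
Proof.
have [x x0] := @hilbert_nonzero R H.
by apply: contra_neq x0 => /(congr1 (fun T : bop H H => T x)).
Qed.

HB.instance Definition _ := GRing.Zmodule_isNzRing.Build (bop H H)
  bcompA bcomp1T bcompT1 bcompDl bcompDr bid_neq0.

Let bcompZl (c : R[i]) S T : c *: (S * T) = c *: S * T.
Proof. exact: bopP. Qed.
HB.instance Definition _ :=
  GRing.Lmodule_isLalgebra.Build R[i] (bop H H) bcompZl.

Let bcompZr (c : R[i]) S T : c *: (S * T) = S * (c *: T).
Proof.
apply: bopP => x /=; have S0 : S 0 = 0.
  by have := bop_linear S (-1) 0 0; rewrite scaler0 addr0 scaleN1r addNr.
by have := bop_linear S c (T x) 0; rewrite S0 !addr0.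
Qed.
HB.instance Definition _ :=
  GRing.Lalgebra_isAlgebra.Build R[i] (bop H H) bcompZr.

End Endomorphisms.

End BoundedOperators.

HB.mixin Record hasStar A := { star : A -> A }.

(* Carries the operation only; the laws are added in [isCstar]. *)
#[short(type="starAlgType")]
HB.structure Definition StarAlg (R : realType) :=
  {A of hasStar A & GRing.Algebra R[i] A}.

(* The norm is a field of its own, because the library has no normed modules
   that are at the same time rings. *)
HB.mixin Record isCstar (R : realType) A of StarAlg R A := {
  star_semilinear : forall c (a b : A),
    star (c *: a + b) = c^* *: star a + star b;
  starM : forall a b : A, star (a * b) = star b * star a;
  starK : forall a : A, star (star a) = a;
  cnorm : A -> R;
  cnorm_eq0 : forall a, cnorm a = 0 -> a = 0;
  cnormD : forall a b, cnorm (a + b) <= cnorm a + cnorm b;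
  cnormZ : forall c a, cnorm (c *: a) = Normc.normc c * cnorm a;
  cnormM : forall a b, cnorm (a * b) <= cnorm a * cnorm b;
  cnorm_star : forall a, cnorm (star a * a) = cnorm a ^+ 2;
  cnorm_complete : forall u : nat -> A,
    (forall e, 0 < e -> exists N, forall m n, (N <= m)%N -> (N <= n)%N ->
      cnorm (u m - u n) < e) ->
    exists l, forall e, 0 < e -> exists N, forall n, (N <= n)%N ->
      cnorm (u n - l) < e }.

#[short(type="cstarType")]
HB.structure Definition Cstar (R : realType) :=
  {A of isCstar R A & StarAlg R A}.

(* The adjoint; by the Riesz representation theorem the set below is a
   singleton, so the default value 0 is never used. *)
Definition adj (R : realType) (H K : hilbertType R) (T : bop H K) : bop K H :=
  xget 0 [set S : bop K H | forall x y, inner (S x) y = inner x (T y)].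

HB.instance Definition _ (R : realType) (H : hilbertType R) :=
  hasStar.Build (bop H H) (@adj R H H).

(* A map between subsets M and N of two *-algebras is a total function between
   the ambient algebras, of which only the values on M matter. *)
Section Maps.
Context {R : realType}.
Implicit Types A B : starAlgType R.

Definition linear_on A B (M : set A) (f : A -> B) :=
  forall c x y, M x -> M y -> f (c *: x + y) = c *: f x + f y.

Definition dagger A n (X : 'M[A]_n) : 'M[A]_n := (map_mx star X)^T.

Definition mx_over A (M : set A) n (X : 'M[A]_n) := forall i j, M (X i j).

(* Positivity in M_n(M); M is always a C*-algebra below. *)
Definition mx_pos A (M : set A) n (X : 'M[A]_n) :=
  exists2 Y : 'M[A]_n, mx_over M Y & X = dagger Y *m Y.

Definition ucp A B (M : set A) (N : set B) (f : A -> B) :=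
  [/\ forall x, M x -> N (f x), linear_on M f, f 1 = 1 &
      forall n (X : 'M[A]_n), mx_pos M X -> mx_pos N (map_mx f X)].

Definition star_hom A B (M : set A) (N : set B) (f : A -> B) :=
  [/\ forall x, M x -> N (f x), linear_on M f, f 1 = 1,
      forall x y, M x -> M y -> f (x * y) = f x * f y &
      forall x, M x -> f (star x) = star (f x)].

Definition star_automorphism A (M : set A) (f : A -> A) :=
  star_hom M M f /\ set_bij M M f.

Definition state_on A (M : set A) (w : A -> R[i]) :=
  [/\ forall c x y, M x -> M y -> w (c *: x + y) = c * w x + w y, w 1 = 1 &
      forall x, M x -> 0 <= w (star x * x)].

Definition faithful_on A (M : set A) (w : A -> R[i]) :=
  forall x, M x -> w (star x * x) = 0 -> x = 0.

Definition star_subalg A (M : set A) :=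
  [/\ M 1, forall c x y, M x -> M y -> M (c *: x + y),
      forall x y, M x -> M y -> M (x * y) & forall x, M x -> M (star x)].

Definition star_alg A (S : set A) : set A := smallest (@star_subalg A) S.

Definition commutant A (S : set A) : set A :=
  [set x | forall y, S y -> x * y = y * x].

Definition bicommutant A (S : set A) := commutant (commutant S).

End Maps.

Section VonNeumann.
Context {R : realType}.
Implicit Types H K : hilbertType R.

Definition von_neumann H (M : set (bop H H)) :=
  (forall T, M T -> M (star T)) /\ bicommutant M = M.

Definition vN H (S : set (bop H H)) := smallest (@von_neumann H) S.

Definition square_summable H (x : nat -> H) :=
  cvgn (series (fun n => `|x n| ^+ 2 : R[i]^o)).

Definition sigma_form H (x y : nat -> H) (T : bop H H) : R[i]^o :=
  limn (series (fun n => inner (x n) (T (y n)) : R[i]^o)).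

(* The sigma-weak topology of B(H) is the initial topology of the functionals
   [sigma_form x y] with x and y square summable. *)
Definition sigma_weak_cvg H (F : set_system (bop H H)) (T : bop H H) :=
  forall x y : nat -> H, square_summable x -> square_summable y ->
    sigma_form x y @ F --> sigma_form x y T.

Definition normal_map H K (M : set (bop H H)) (f : bop H H -> bop K K) :=
  forall (F : set_system (bop H H)) (T : bop H H), ProperFilter F -> F M -> M T ->
    sigma_weak_cvg F T -> sigma_weak_cvg (f @ F) (f T).

Definition normal_functional H (M : set (bop H H)) (w : bop H H -> R[i]) :=
  forall (F : set_system (bop H H)) (T : bop H H), ProperFilter F -> F M -> M T ->
    sigma_weak_cvg F T -> (w : _ -> R[i]^o) @ F --> (w T : R[i]^o).

Definition cyclic_vector H (S : set (bop H H)) (x : H) :=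
  dense [set T x | T in S].

Definition vector_state H (x : H) (T : bop H H) : R[i] := inner x (T x).

Definition isometry H K (T : bop H K) := forall x, `|T x| = `|x|.

Definition cstar_system (A : cstarType R) (Phi : A -> A) (phi : A -> R[i]) :=
  [/\ ucp setT setT Phi, state_on setT phi & forall a, phi (Phi a) = phi a].

Definition wstar_system H (M : set (bop H H)) (Phi : bop H H -> bop H H)
    (phi : bop H H -> R[i]) :=
  [/\ von_neumann M, ucp M M Phi /\ normal_map M Phi,
      [/\ state_on M phi, normal_functional M phi & faithful_on M phi] &
      forall T, M T -> phi (Phi T) = phi T].

Definition gns (A : cstarType R) (phi : A -> R[i])
    H (pi : A -> bop H H) (Om : H) :=
  [/\ star_hom setT setT pi, cyclic_vector (range pi) Om &
      forall a, phi a = inner Om (pi a Om)].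

Definition gns_contraction (A : cstarType R) (Phi : A -> A)
    H (pi : A -> bop H H) (Om : H) (U : bop H H) :=
  (forall x, `|U x| <= `|x|) /\ forall a, U (pi a Om) = pi (Phi a) Om.

Definition associated_map H (M : set (bop H H)) (Om : H) (U : bop H H)
    (Phib : bop H H -> bop H H) :=
  [/\ ucp M M Phib, normal_map M Phib &
      forall X, M X -> Phib X Om = U (X Om)].

Definition phi_adjoint (A : cstarType R) (Phi : A -> A) (phi : A -> R[i])
    (Phis : A -> A) :=
  ucp setT setT Phis /\ forall a b, phi (a * Phis b) = phi (Phi a * b).

Definition translates (A : cstarType R) H (pi : A -> bop H H) (V : bop H H) :=
  [set T | exists n a, T = V ^+ n * pi a * star V ^+ n].

Definition cgns (A : cstarType R) (Phi : A -> A) (phi : A -> R[i])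
    H (pi : A -> bop H H) (Om : H) (U : bop H H)
    K (pi_oo : A -> bop K K) (Om_oo : K) (V : bop K K) (Z0 : bop H K) :=
  [/\ [/\ star_hom setT setT pi_oo, isometry V & isometry Z0],
      [/\ forall a, bcomp (pi_oo a) Z0 = bcomp Z0 (pi a), Om_oo = Z0 Om &
          forall n, star U ^+ n = bcomp (adj Z0) (bcomp (V ^+ n) Z0)],
      V Om_oo = Om_oo,
      cyclic_vector (star_alg (translates pi_oo V)) Om_oo &
      (forall a, pi_oo (Phi a) = star V * pi_oo a * V) /\
      forall a, phi a = inner Om_oo (pi_oo a Om_oo)].

Record reversible_dilation H K
    (M : set (bop H H)) (Phi : bop H H -> bop H H) (phi : bop H H -> R[i])
    (Mh : set (bop K K)) (Phih : bop K K -> bop K K) (phih : bop K K -> R[i])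
    (i : bop H H -> bop K K) (E : bop K K -> bop H H) : Prop := {
  dilation_base : wstar_system M Phi phi;
  dilation_system : wstar_system Mh Phih phih;
  dilation_auto : star_automorphism Mh Phih;
  dilation_E : ucp Mh M E /\ normal_map Mh E;
  dilation_i : [/\ star_hom M Mh i, normal_map M i & set_inj M i];
  dilation_bimod : forall a X, M a -> Mh X -> E (i a * X) = a * E X;
  dilation_iter : forall n a, M a -> E (iter n Phih (i a)) = iter n Phi a;
  dilation_state : forall X, Mh X -> phih X = phi (E X) }.

(* The images of [S] under all powers, positive and negative, of the
   automorphism [f] of [M]. *)
Definition two_sided_orbit H (M : set (bop H H)) (f : bop H H -> bop H H)
    (S : set (bop H H)) :=
  [set X | M X /\ exists n, exists2 Y, S Y & X = iter n f Y \/ iter n f X = Y].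

Definition minimal_dilation H K (M : set (bop H H)) (Mh : set (bop K K))
    (Phih : bop K K -> bop K K) (i : bop H H -> bop K K) :=
  Mh = vN (two_sided_orbit Mh Phih (i @` M)).

End VonNeumann.

(* Main.v *)
Require Import Defs.
From HB Require Import structures.
From mathcomp Require Import all_boot all_order all_algebra complex.
From mathcomp Require Import all_classical all_reals all_analysis.
From mathcomp Require Import ring lra.
Set Implicit Arguments.
Unset Strict Implicit.
Unset Printing Implicit Defensive.
Import Order.TTheory GRing.Theory Num.Theory numFieldNormedType.Exports.
Local Open Scope classical_set_scope.
Local Open Scope ring_scope.

(** Since [Phi] is multiplicative, every [pi_oo a] leaves the range of [V] invariant;
    as [Om_oo] is fixed by [V] and cyclic for the algebra [B] generated by the
    translates, [V] is unitary ([V_Vstar]). Then [pi_oo a = V (pi_oo (Phi a)) V^*], so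
    the algebras [V^n pi_oo(A) V^*^n] increase with [n], their union is [B], and
    [X |-> V^* X V] is an automorphism of [Mh = B''].

    The adjoint [Phis] enters through the compression [E X = Z0^* X Z0]. It maps
    [V^k pi_oo(a) V^*^k] to [U^*^k pi(a) U^k]. The module property
    [Phis (a (Phi b)) = (Phis a) b], valid in the representation because [Om] separates
    [M = pi(A)''], identifies this operator as [pi (Phis^k a)]
    ([compress_U_pi_iter], [compress_translate]). Positivity of [Phis] then makes every
    operator of [pi(A)'] lift to [B'] ([commutant_lift]). Two things follow: [E] maps
    [Mh] to [M] ([compress_bicommutant]), and [Om_oo] is cyclic for [B']
    ([commutant_translates_dense]), hence separating for [Mh].

    The embedding is defined by [i(T) (S Om_oo) = S (Z0 (T Om))] for [S] in [B']. For
    fixed [S] the norm of the right-hand side is [|T z|], where [z] is the vector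
    [(Z0^* S^* S Z0)^(1/2) Om] of norm [|S Om_oo|] ([commutant_vector]); so [i(T)] is
    bounded. The same remark gives normality. A vector [y] of [l2 K] is an absolutely
    convergent sum of vectors for which the remark holds, whence
    [|i(T) y| <= 2 |T z|] for some [z] in [l2 H] ([amp_embedding_dominated]); Riesz'
    theorem represents [<x, i(T) y>] as [<x', T z>] ([embedding_normal]).

    The remaining properties are general. A compression is completely positive because
    a positive matrix over [M] has a square root over [M], which is taken as an operator
    on [l2 H] ([compress_mx_pos]). Normal maps that agree on [B] agree on [B''], since
    [B] is sigma-weakly dense there ([bicommutant_dense], [normal_maps_agree]); this
    determines [E]. The embedding is determined because [Om_oo] is separating.

    All of this rests on one form of Riesz' theorem ([riesz]), which yields adjoints,
    projections and extensions of densely defined operators, on square roots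
    ([bop_sqrt]), and on the Hilbert space [l2 H]. *)

Lemma normc_ge0 (R : realType) (z : R[i]) : 0 <= Normc.normc z.
Proof. by rewrite -lecR; exact: (normr_ge0 z). Qed.

Lemma normc_real (R : realType) (t : R) : Normc.normc (t%:C)%C = `|t|.
Proof. by rewrite /= expr0n addr0 sqrtr_sqr. Qed.

Lemma inv_succ_small (R : realType) (e : R) : 0 < e ->
  exists N, forall n, (N <= n)%N -> n.+1%:R^-1 < e.
Proof.
move=> e0; exists (Num.truncn e^-1) => n Nn.
rewrite -[e]invrK ltf_pV2 ?posrE ?invr_gt0//.
by apply: lt_le_trans (truncnS_gt _) _; rewrite ler_nat.
Qed.

(** * Semi-inner products *)

Section SemiInnerProduct.
Context {R : realType} {L : lmodType R[i]} (s : L -> L -> R[i]).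
Hypothesis s_linear : forall x c y z, s x (c *: y + z) = c * s x y + s x z.
Hypothesis s_conj : forall x y, s y x = conjc (s x y).
Hypothesis s_ge0 : forall x, 0 <= s x x.

Lemma sform0r x : s x 0 = 0.
Proof. by have := s_linear x (-1) 0 0; rewrite scaler0 addr0 mulN1r addNr. Qed.

Lemma sformZr c x y : s x (c *: y) = c * s x y.
Proof. by have := s_linear x c y 0; rewrite !addr0 sform0r addr0. Qed.

Lemma sformDr x y z : s x (y + z) = s x y + s x z.
Proof. by have := s_linear x 1 y z; rewrite scale1r mul1r. Qed.

Lemma sformZl c x y : s (c *: x) y = conjc c * s x y.
Proof. by rewrite s_conj sformZr rmorphM /= -s_conj. Qed.

Lemma sformDl x y z : s (x + y) z = s x z + s y z.
Proof. by rewrite s_conj sformDr rmorphD /= -!s_conj. Qed.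

Lemma sform_xx x : s x x = (complex.Re (s x x))%:C%C.
Proof. by rewrite RRe_real// ger0_real. Qed.

Lemma sform_Re_ge0 x : 0 <= complex.Re (s x x).
Proof. by rewrite -lecR -sform_xx. Qed.

(** Positivity of the form at [y - t (s x y) x], for all real [t]; this covers the
    degenerate case [s x x = 0]. *)
Lemma cauchy_schwarz x y :
  Normc.normc (s x y) ^+ 2 <= complex.Re (s x x) * complex.Re (s y y).
Proof.
have Nb : Normc.normc (s x y) ^+ 2 =
    complex.Re (s x y) ^+ 2 + complex.Im (s x y) ^+ 2.
  by case: (s x y) => a b /=; rewrite sqr_sqrtr ?addr_ge0 ?sqr_ge0.
have key t : 0 <= complex.Re (s y y) - 2 * t * Normc.normc (s x y) ^+ 2 +
    t ^+ 2 * Normc.normc (s x y) ^+ 2 * complex.Re (s x x).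
  have := sform_Re_ge0 (- ((t%:C)%C * s x y) *: x + y).
  rewrite sformDr sformZr !sformDl !sformZl (s_conj x y) (sform_xx x) (sform_xx y).
  rewrite Nb; case: (s x y) => a b /=.
  congr (_ <= _); ring.
have a0 := sform_Re_ge0 x; have d0 := sform_Re_ge0 y.
move: key; set a := complex.Re (s x x) in a0 *; set d := complex.Re _ in d0 *.
set m := _ ^+ 2 => key.
have m0 : 0 <= m by rewrite exprn_ge0// normc_ge0.
have [a_eq0|a_neq0] := eqVneq a 0.
  rewrite a_eq0 mul0r; have [//|m_gt0] := leP m 0.
  have := key ((d + 1) / (2 * m)); rewrite a_eq0 mulr0 addr0.
  rewrite (_ : 2 * _ * m = d + 1); last by field; rewrite gt_eqF.
  lra.
have a_gt0 : 0 < a by rewrite lt_neqAle eq_sym a_neq0.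
have := key a^-1; rewrite (_ : _ + _ = (a * d - m) / a); last by field; rewrite gt_eqF.
by rewrite pmulr_lge0 ?invr_gt0// subr_ge0.
Qed.

End SemiInnerProduct.

(** * Geometry of a Hilbert space *)

Section HilbertGeometry.
Context {R : realType}.
Implicit Types H K : hilbertType R.

(** Norms in a Hilbert space take values in [R[i]]; estimates are carried out
    in the real field instead. *)
Definition rnorm H (x : H) : R := complex.Re `|x|.

Lemma rnormE H (x : H) : `|x| = ((rnorm x)%:C)%C.
Proof. by rewrite /rnorm RRe_real// ger0_real. Qed.

Lemma rnorm_ge0 H (x : H) : 0 <= rnorm x.
Proof. by rewrite -ler0c -rnormE. Qed.

Lemma rnorm0 H : rnorm (0 : H) = 0.
Proof. by rewrite /rnorm normr0. Qed.

Lemma rnorm_eq0 H (x : H) : rnorm x = 0 -> x = 0.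
Proof. by move=> x0; apply/normr0_eq0; rewrite rnormE x0. Qed.

Lemma rnormD H (x y : H) : rnorm (x + y) <= rnorm x + rnorm y.
Proof. by rewrite -lecR rmorphD/= -!rnormE ler_normD. Qed.

Lemma rnormZ H c (x : H) : rnorm (c *: x) = Normc.normc c * rnorm x.
Proof. by apply: complexI; rewrite -rnormE normrZ rnormE rmorphM. Qed.

Lemma rnormN H (x : H) : rnorm (- x) = rnorm x.
Proof. by rewrite /rnorm normrN. Qed.

Lemma rnormBC H (x y : H) : rnorm (x - y) = rnorm (y - x).
Proof. by rewrite /rnorm distrC. Qed.

Lemma rnormB_tri H (z x y : H) : rnorm (x - y) <= rnorm (x - z) + rnorm (z - y).
Proof. by apply: le_trans (rnormD _ _); rewrite addrA subrK. Qed.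

Section Inner.
Context {H : hilbertType R}.
Implicit Types x y z : H.

Lemma inner_xx x : inner x x = ((rnorm x ^+ 2)%:C)%C.
Proof. by rewrite inner_norm rnormE -rmorphXn. Qed.

Lemma inner_ge0 x : 0 <= inner x x.
Proof. by rewrite inner_norm exprn_ge0. Qed.

Lemma inner0r x : inner x 0 = 0.
Proof. exact: (sform0r (@inner_linear R H)). Qed.
Lemma innerZr c x y : inner x (c *: y) = c * inner x y.
Proof. exact: (sformZr (@inner_linear R H)). Qed.
Lemma innerDr x y z : inner x (y + z) = inner x y + inner x z.
Proof. exact: (sformDr (@inner_linear R H)). Qed.
Lemma innerZl c x y : inner (c *: x) y = conjc c * inner x y.
Proof. exact: (sformZl (@inner_linear R H) (@inner_conj R H)). Qed.
Lemma innerDl x y z : inner (x + y) z = inner x z + inner y z.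
Proof. exact: (sformDl (@inner_linear R H) (@inner_conj R H)). Qed.
Lemma inner0l x : inner 0 x = 0.
Proof. by rewrite inner_conj inner0r conjc0. Qed.
Lemma innerNr x y : inner x (- y) = - inner x y.
Proof. by rewrite -scaleN1r innerZr mulN1r. Qed.
Lemma innerNl x y : inner (- x) y = - inner x y.
Proof. by rewrite inner_conj innerNr rmorphN /= -inner_conj. Qed.
Lemma innerBr x y z : inner x (y - z) = inner x y - inner x z.
Proof. by rewrite innerDr innerNr. Qed.
Lemma innerBl x y z : inner (x - y) z = inner x z - inner y z.
Proof. by rewrite innerDl innerNl. Qed.

Lemma rnorm_eq (K : hilbertType R) x (y : K) : inner x x = inner y y -> rnorm x = rnorm y.
Proof.
rewrite inner_xx inner_norm rnormE -rmorphXn => /complexI/eqP.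
by rewrite eqrXn2 ?rnorm_ge0// => /eqP.
Qed.

Lemma inner_le x y : Normc.normc (inner x y) <= rnorm x * rnorm y.
Proof.
rewrite -ler_sqr ?nnegrE ?mulr_ge0 ?rnorm_ge0 ?normc_ge0//.
have := cauchy_schwarz (@inner_linear R H) (@inner_conj R H) inner_ge0 x y.
by rewrite !inner_xx exprMn.
Qed.

Lemma inner_eq0 x : (forall z, inner z x = 0) -> x = 0.
Proof.
move=> /(_ x); rewrite inner_xx => /complexI /eqP.
by rewrite sqrf_eq0 => /eqP/rnorm_eq0.
Qed.

Lemma inner_inj x y : (forall z, inner z x = inner z y) -> x = y.
Proof.
move=> xy; apply/eqP; rewrite -subr_eq0; apply/eqP/inner_eq0 => z.
by rewrite innerBr xy subrr.
Qed.

Lemma rnorm_sqrD x y : rnorm (x + y) ^+ 2 =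
  rnorm x ^+ 2 + 2 * complex.Re (inner x y) + rnorm y ^+ 2.
Proof.
have -> : rnorm (x + y) ^+ 2 = complex.Re (inner (x + y) (x + y)).
  by rewrite inner_xx.
rewrite innerDr !innerDl (inner_conj x y) !inner_xx; case: (inner x y) => a b /=.
ring.
Qed.

Lemma parallelogram x y : rnorm (x + y) ^+ 2 + rnorm (x - y) ^+ 2 =
  2 * rnorm x ^+ 2 + 2 * rnorm y ^+ 2.
Proof.
rewrite !rnorm_sqrD innerNr rnormN.
by case: (inner x y) => a b /=; ring.
Qed.

Lemma hilbert_complete (u : nat -> H) :
  (forall e : R, 0 < e -> exists N, forall m n, (N <= m)%N -> (N <= n)%N ->
     rnorm (u m - u n) < e) ->
  exists l, forall e : R, 0 < e -> exists N, forall n, (N <= n)%N ->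
     rnorm (u n - l) < e.
Proof.
move=> uC; have : cvgn u.
  apply: cauchy_cvg; apply/cauchy_ballP => e e0.
  have eE : e = ((complex.Re e)%:C)%C by rewrite RRe_real// gtr0_real.
  have [|N uN] := uC (complex.Re e); first by rewrite -ltcR -eE.
  exists (u @` [set n | (N <= n)%N], u @` [set n | (N <= n)%N]); first split.
  - by exists N => // n Nn; exists n.
  - by exists N => // n Nn; exists n.
  move=> [_ _] /= [[m Nm <-] [n Nn <-]].
  by rewrite -ball_normE /ball_ /= rnormE eE ltcR uN.
move=> /cvg_ex[l ul]; exists l => e e0.
have /cvgrPdist_lt/(_ ((e%:C)%C)) := ul; rewrite ltcR => /(_ e0)[N _ uN].
by exists N => n Nn; rewrite rnormBC -ltcR -rnormE; exact: uN.
Qed.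

End Inner.

End HilbertGeometry.

Lemma linear_on0 (R : realType) (L L' : lmodType R[i]) (D : set L) (f : L -> L') :
  (D !=set0) -> (forall c x y, D x -> D y -> D (c *: x + y)) ->
  (forall c x y, D x -> D y -> f (c *: x + y) = c *: f x + f y) ->
  D 0 /\ f 0 = 0.
Proof.
move=> [x Dx] DL fl; have := DL (-1) _ _ Dx Dx; have := fl (-1) _ _ Dx Dx.
by rewrite !scaleN1r !addNr.
Qed.

(** * Riesz' representation theorem *)

Section Riesz.
Context {R : realType} {H : hilbertType R}.

(** The topological closure, with real radii. *)
Definition adherent (S : set H) (x : H) :=
  forall e : R, 0 < e -> exists2 y, S y & rnorm (y - x) < e.

Variables (L : lmodType R[i]) (D : set L) (al : L -> H) (f : L -> R[i]) (c : R).
Hypothesis D_nonempty : D !=set0.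
Hypothesis D_linear : forall a x y, D x -> D y -> D (a *: x + y).
Hypothesis al_linear : forall a x y, D x -> D y -> al (a *: x + y) = a *: al x + al y.
Hypothesis f_linear : forall a x y, D x -> D y -> f (a *: x + y) = a * f x + f y.
Hypothesis f_bound : forall x, D x -> Normc.normc (f x) <= c * rnorm (al x).

Let q (x : L) := rnorm (al x) ^+ 2 - 2 * complex.Re (f x).

Let q_lbound x : D x -> - c ^+ 2 <= q x.
Proof.
move=> Dx; rewrite /q.
have Ref : complex.Re (f x) <= c * rnorm (al x).
  apply: le_trans (f_bound Dx).
  rewrite -lecR; apply: le_trans (normc_ge_Re (f x)).
  by rewrite lecR ler_norm.
have := sqr_ge0 (rnorm (al x) - c); nra.
Qed.

Let q_scale x y (t : R) : D x -> D y -> q ((t%:C)%C *: x + y) =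
  q y + 2 * t * (complex.Re (inner (al y) (al x)) - complex.Re (f x)) +
  t ^+ 2 * rnorm (al x) ^+ 2.
Proof.
move=> Dx Dy; rewrite /q al_linear// f_linear// [_ *: al x + _]addrC rnorm_sqrD innerZr rnormZ.
rewrite normc_real exprMn real_normK ?num_real//.
case: (inner _ _) => a b; case: (f x) => a' b'; case: (f y) => a'' b'' /=; ring.
Qed.

(** The vector [x'] is the limit of [al x] along a sequence minimising
    [|al x|^2 - 2 Re (f x)], which is Cauchy by the parallelogram law. The functional
    lives on the index set [D]; that it factors through [al] is part of the conclusion. *)
Lemma riesz : exists2 x', adherent [set al x | x in D] x' &
  forall x, D x -> f x = inner x' (al x).
Proof.
pose S := [set q x | x in D].
have Sinf : has_inf S.
  split; first by have [x Dx] := D_nonempty; exists (q x), x.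
  by exists (- c ^+ 2) => _ [x Dx <-]; exact: q_lbound.
have Sle x : D x -> inf S <= q x.
  by move=> Dx; apply: ge_inf; [exact: Sinf.2 | exists x].
have /choice[j jP] : forall n : nat, exists x, D x /\ q x < inf S + n.+1%:R^-1.
  move=> n; have [|_ [x Dx <-] qx] := @inf_adherent _ S (n.+1%:R^-1) _ Sinf.
    by rewrite invr_gt0.
  by exists x.
(* The midpoint of [j m] and [j n] lies in [D] too. *)
have close m n : rnorm (al (j m) - al (j n)) ^+ 2 <= 2 * (m.+1%:R^-1 + n.+1%:R^-1).
  have [[Dm qm] [Dn qn]] := (jP m, jP n).
  have DL0 := linear_on0 D_nonempty D_linear al_linear.
  pose h : R[i] := ((2^-1)%:C)%C.
  have Dmid : D (h *: (1 *: j m + j n)).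
    by rewrite -[_ *: _]addr0; apply: D_linear; [exact: D_linear | exact: DL0.1].
  have := Sle _ Dmid; rewrite /q.
  have -> : h *: (1 *: j m + j n) = h *: j m + (h *: j n + 0).
    by rewrite addr0 scale1r scalerDr.
  have Dn' : D (h *: j n + 0) by apply: D_linear => //; exact: DL0.1.
  have [_ f0] := linear_on0 (f := (f : L -> R[i]^o)) D_nonempty D_linear f_linear.
  rewrite al_linear// f_linear// al_linear//; last exact: DL0.1.
  rewrite f_linear//; last exact: DL0.1.
  rewrite DL0.2 f0 !addr0 -scalerDr rnormZ.
  have -> : Normc.normc h = 2^-1.
    by rewrite normc_real ger0_norm// invr_ge0.
  have := parallelogram (al (j m)) (al (j n)).
  move: qm qn; rewrite /q.
  set A := rnorm (_ + _); set B := rnorm (_ - _).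
  case: (f (j m)) => a b; case: (f (j n)) => a' b' /=.
  set u := (m.+1%:R^-1 : R); set v := (n.+1%:R^-1 : R).
  rewrite exprMn; nra.
have [e e0|x' x'P] := @hilbert_complete _ H (al \o j).
  have [N NP] := inv_succ_small (divr_gt0 (exprn_gt0 2 e0) (ltr0n _ 4)).
  exists N => m n Nm Nn /=.
  rewrite -ltr_sqr ?nnegrE ?rnorm_ge0 ?(ltW e0)//.
  apply: le_lt_trans (close m n) _.
  have := NP _ Nm; have := NP _ Nn.
  by move: (m.+1%:R^-1 : R) (n.+1%:R^-1 : R) (e ^+ 2) => u v w; lra.
exists x' => [e e0|].
  have [N NP] := x'P e e0; exists (al (j N)); last exact: NP.
  by exists (j N) => //; exact: (jP N).1.
(* The variation of [al (j n)] in the direction [al x] cannot lower the infimum. *)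
have Re_eq x : D x -> complex.Re (f x) = complex.Re (inner x' (al x)).
  move=> Dx; apply/eqP; rewrite eq_sym -subr_eq0; set g := _ - _.
  set A := rnorm (al x) ^+ 2.
  have A0 : 0 <= A by exact: sqr_ge0.
  have main (t : R) : 0 <= 2 * t * g + t ^+ 2 * A.
    apply/ler_addgt0Pl => e e0.
    set r := rnorm (al x).
    have r0 : 0 <= r by exact: rnorm_ge0.
    have B0 : 0 < 4 * (`|t| * r + 1) by have := mulr_ge0 (normr_ge0 t) r0; lra.
    have [N1 N1P] := inv_succ_small (divr_gt0 e0 (ltr0n _ 2)).
    have [N2 N2P] := x'P (e / (4 * (`|t| * r + 1))) (divr_gt0 e0 B0).
    pose n := maxn N1 N2.
    have := N1P n (leq_maxl _ _); have /= := N2P n (leq_maxr _ _).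
    have [Dn qn] := jP n.
    have := Sle _ (D_linear ((t%:C)%C) Dx Dn); rewrite q_scale// => h1 h2 h3.
    have h4 : `|complex.Re (inner (al (j n) - x') (al x))| <= rnorm (al (j n) - x') * r.
      apply: le_trans (inner_le _ _).
      by rewrite -lecR; exact: normc_ge_Re.
    have h5 : `|t * complex.Re (inner (al (j n) - x') (al x))| <= e / 4.
      rewrite normrM; apply: le_trans (ler_wpM2l (normr_ge0 t) h4) _.
      have /ltW h6 := h2.
      rewrite mulrCA; apply: le_trans (ler_wpM2r (mulr_ge0 (normr_ge0 t) r0) h6) _.
      rewrite -subr_ge0.
      rewrite (_ : _ - _ = e / (4 * (`|t| * r + 1))); last first.
        by field; rewrite gt_eqF//; have := mulr_ge0 (normr_ge0 t) r0; lra.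
      by rewrite ltW// divr_gt0.
    have /ler_normlP[_ h7] := h5.
    move: h1 h7; rewrite /g innerBl.
    case: (inner _ _) => a b; case: (inner _ _) => a' b' /=; rewrite -/A.
    move: qn h3; move: (n.+1%:R^-1 : R) (q (j n)) (inf S) => u qn' I.
    clear -e0; move: (complex.Re _) => fx; nra.
  have := main (- g / (A + 1)).
  rewrite (_ : _ + _ = - (g ^+ 2 * (A + 2) / (A + 1) ^+ 2)); last first.
    by field; rewrite gt_eqF// ltr_wpDl.
  rewrite oppr_ge0 pmulr_lle0 ?invr_gt0 ?exprn_gt0 ?ltr_wpDl//.
  rewrite pmulr_lle0 ?ltr_wpDl// => g0.
  by rewrite -sqrf_eq0 eq_le g0 sqr_ge0.
(* The imaginary part comes from the real part at ['i *: x]. *)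
move=> x Dx.
have [D0 f0] := linear_on0 (f := (f : L -> R[i]^o)) D_nonempty D_linear f_linear.
have [_ al0] := linear_on0 D_nonempty D_linear al_linear.
have /= := Re_eq _ (D_linear ('i%C) Dx D0).
rewrite f_linear// al_linear// al0 addr0 innerZr f0 addr0.
have := Re_eq _ Dx.
case: (f x) => a b; case: (inner _ _) => a' b' /= -> h.
by congr (Complex _ _); lra.
Qed.

End Riesz.

(** * Closures and bounded operators *)

Section Adherence.
Context {R : realType}.
Implicit Types H K : hilbertType R.

Lemma adherent_orth H (S : set H) x z :
  adherent S z -> (forall y, S y -> inner x y = 0) -> inner x z = 0.
Proof.
move=> Sz xS; apply: Normc.eq0_normc; apply/eqP; rewrite eq_le normc_ge0 andbT.
apply/ler_addgt0Pl => e e0; rewrite addr0.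
have c0 : 0 < rnorm x + 1 by have := rnorm_ge0 x; lra.
have [y Sy yz] := Sz (e / (rnorm x + 1)) (divr_gt0 e0 c0).
have -> : inner x z = inner x (z - y) by rewrite innerBr (xS y)// subr0.
apply: le_trans (inner_le _ _) _; rewrite rnormBC.
have := rnorm_ge0 (y - z); have := rnorm_ge0 x; move: yz.
by rewrite ltr_pdivlMr//; nra.
Qed.

Lemma adherent_orth0 H (S : set H) x :
  adherent S x -> (forall y, S y -> inner x y = 0) -> x = 0.
Proof.
move=> Sx xS; apply: rnorm_eq0; have := adherent_orth Sx xS.
by rewrite inner_xx => /complexI/eqP; rewrite sqrf_eq0 => /eqP.
Qed.

Lemma adherent_self H (S : set H) x : S x -> adherent S x.
Proof. by move=> Sx e e0; exists x; rewrite // subrr rnorm0. Qed.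

Lemma adherentD H (S : set H) x y :
  (forall u v, S u -> S v -> S (u + v)) ->
  adherent S x -> adherent S y -> adherent S (x + y).
Proof.
move=> SD Sx Sy e e0; have e2 : 0 < e / 2 by rewrite divr_gt0.
have [u Su ux] := Sx _ e2; have [v Sv vy] := Sy _ e2.
exists (u + v); first exact: SD.
rewrite opprD addrACA; apply: le_lt_trans (rnormD _ _) _; lra.
Qed.

Lemma adherentN H (S : set H) x :
  (forall u, S u -> S (- u)) -> adherent S x -> adherent S (- x).
Proof.
move=> SN Sx e e0; have [u Su ux] := Sx _ e0.
by exists (- u); [exact: SN | rewrite -opprD rnormN].
Qed.

Lemma adherent_trans H (S S' : set H) x :
  (forall y, S y -> adherent S' y) -> adherent S x -> adherent S' x.
Proof.
move=> SS' Sx e e0; have e2 : 0 < e / 2 by rewrite divr_gt0.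
have [u Su ux] := Sx _ e2; have [v Sv vu] := SS' _ Su _ e2.
exists v => //; apply: le_lt_trans (rnormB_tri u _ _) _; lra.
Qed.

Lemma cyclic_adherent H (S : set (bop H H)) x :
  cyclic_vector S x -> forall y, adherent [set T x | T in S] y.
Proof.
move=> Sx y e e0; have [||z [/= yz [T ST TE]]] := Sx (ball y ((e%:C)%C)).
- by exists y; apply: ballxx; rewrite ltcR.
- exact: ball_open.
move: yz; rewrite -ball_normE /ball_ /= => h.
by exists (T x); [exists T | rewrite TE rnormBC -ltcR -rnormE].
Qed.

End Adherence.

Section Operators.
Context {R : realType}.
Implicit Types H K L : hilbertType R.

Lemma bopDE H K (S T : bop H K) x : (S + T) x = S x + T x.
Proof. by []. Qed.
Lemma bopZE H K c (T : bop H K) x : (c *: T) x = c *: T x.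
Proof. by []. Qed.
Lemma bopNE H K (T : bop H K) x : (- T) x = - T x.
Proof. by []. Qed.
Lemma bopME H (S T : bop H H) x : (S * T) x = S (T x).
Proof. by []. Qed.

Lemma bop0r H K (T : bop H K) : T 0 = 0.
Proof. by have := bop_linear T (-1) 0 0; rewrite scaler0 addr0 scaleN1r addNr. Qed.
Lemma bopZ H K (T : bop H K) c x : T (c *: x) = c *: T x.
Proof. by have := bop_linear T c x 0; rewrite bop0r !addr0. Qed.
Lemma bopD H K (T : bop H K) x y : T (x + y) = T x + T y.
Proof. by have := bop_linear T 1 x y; rewrite !scale1r. Qed.
Lemma bopN H K (T : bop H K) x : T (- x) = - T x.
Proof. by rewrite -scaleN1r bopZ scaleN1r. Qed.
Lemma bopB H K (T : bop H K) x y : T (x - y) = T x - T y.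
Proof. by rewrite bopD bopN. Qed.
Lemma bop_sum H K (T : bop H K) n (x : 'I_n -> H) : T (\sum_i x i) = \sum_i T (x i).
Proof. by elim/big_rec2: _ => [|i y z _ <-]; rewrite ?bop0r ?bopD. Qed.

Lemma bop_rbound H K (T : bop H K) :
  exists2 c : R, 0 <= c & forall x, rnorm (T x) <= c * rnorm x.
Proof.
have [c [c0 Tc]] := bop_bounded T; exists (complex.Re c) => [|x].
  by rewrite -ler0c RRe_real// ger0_real.
by rewrite -lecR rmorphM /= -!rnormE RRe_real// ger0_real.
Qed.

Lemma mk_bop H K (f : H -> K) (c : R) :
  linear f -> (forall x, rnorm (f x) <= c * rnorm x) ->
  exists2 T : bop H K, bopf T = f & forall x, rnorm (T x) <= c * rnorm x.
Proof.
move=> fl fc; have bf : f \in @bounded_linear R H K.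
  apply/asboolP; split=> //; exists ((c%:C)%C) => x.
  by rewrite !rnormE -rmorphM lecR.
by exists (BOp bf).
Qed.

Lemma adherent_bop H K (T : bop H K) (S : set H) x :
  adherent S x -> adherent [set T y | y in S] (T x).
Proof.
move=> Sx e e0; have [c c0 Tc] := bop_rbound T.
have c1 : 0 < c + 1 by lra.
have [y Sy yx] := Sx (e / (c + 1)) (divr_gt0 e0 c1).
exists (T y); first by exists y.
rewrite -bopB; apply: le_lt_trans (Tc _) _.
have := rnorm_ge0 (y - x); move: yx; rewrite ltr_pdivlMr//; nra.
Qed.

Lemma bop_eq_adherent H K (S T : bop H K) (D : set H) :
  (forall x, adherent D x) -> (forall x, D x -> S x = T x) -> S = T.
Proof.
move=> Dx ST; apply: bopP => x; apply/eqP; rewrite -subr_eq0.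
rewrite -[S x - T x]/((S - T) x); apply/eqP/rnorm_eq0.
have [c c0 Tc] := bop_rbound (S - T).
apply/eqP; rewrite eq_le rnorm_ge0 andbT; apply/ler_addgt0Pl => e e0; rewrite addr0.
have c1 : 0 < c + 1 by lra.
have [y Sy yx] := Dx x (e / (c + 1)) (divr_gt0 e0 c1).
have -> : (S - T) x = (S - T) (x - y).
  by rewrite bopB [(S - T) y](_ : _ = 0) ?subr0// -[LHS]/(S y - T y) ST// subrr.
apply: le_trans (Tc _) _.
have := rnorm_ge0 (y - x); move: yx; rewrite rnormBC ltr_pdivlMr//; nra.
Qed.

(** Riesz' theorem for the functionals [inner x (T _)] provides the adjoint. *)
Lemma adjE H K (T : bop H K) x y : inner (adj T x) y = inner x (T y).
Proof.
rewrite /adj; case: xgetP => [S _ /= ->//|noS]; exfalso.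
have [c c0 Tc] := bop_rbound T.
have ex x0 : exists z, forall v, inner x0 (T v) = inner z v.
  have [|||||z _ zP] := @riesz _ H H setT id (fun v => inner x0 (T v)) (rnorm x0 * c) => //.
  - by exists 0.
  - by move=> a u v _ _; rewrite bop_linear inner_linear.
  - move=> v _; rewrite -mulrA; apply: le_trans (inner_le _ _) _.
    by rewrite ler_wpM2l// rnorm_ge0.
  - by exists z => v; rewrite zP.
have {ex}[f fP] := choice ex.
have fl : linear f.
  move=> a u v; apply: inner_inj => z.
  rewrite innerDr innerZr !(inner_conj _ z) -!fP innerDl innerZl rmorphD rmorphM /=.
  by rewrite conjcK.
have [|S SE _] := @mk_bop K H f c fl.
  move=> u; have [f0|f0] := eqVneq (rnorm (f u)) 0.
    by rewrite f0 mulr_ge0// rnorm_ge0.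
  have {}f0 : 0 < rnorm (f u) by rewrite lt_neqAle eq_sym f0 rnorm_ge0.
  rewrite -(ler_pM2r f0) -expr2 -[_ ^+ 2]ger0_norm ?sqr_ge0// -normc_real -inner_xx -fP.
  apply: le_trans (inner_le _ _) _.
  by have := Tc (f u); have := rnorm_ge0 u; nra.
by apply: (noS S) => u v /=; rewrite SE fP.
Qed.

Lemma innerA H K (T : bop H K) x y : inner (T x) y = inner x (adj T y).
Proof. by rewrite inner_conj -adjE -inner_conj. Qed.

Lemma adj_unique H K (T : bop H K) (S : bop K H) :
  (forall x y, inner (S x) y = inner x (T y)) -> S = adj T.
Proof.
move=> ST; apply: bopP => x; apply: inner_inj => z.
by rewrite inner_conj ST -adjE -inner_conj.
Qed.

Lemma adjK H K (T : bop H K) : adj (adj T) = T.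
Proof. by apply/esym/adj_unique => x y; rewrite innerA. Qed.

Lemma adj_comp H K L (S : bop K L) (T : bop H K) :
  adj (bcomp S T) = bcomp (adj T) (adj S).
Proof. by apply/esym/adj_unique => x y /=; rewrite !adjE. Qed.

Lemma adjP_linear H K c (S T : bop H K) :
  adj (c *: S + T) = conjc c *: adj S + adj T.
Proof.
apply/esym/adj_unique => x y.
by rewrite !bopDE !bopZE innerDl innerZl conjcK !adjE innerDr innerZr.
Qed.

Lemma adj_bound H K (T : bop H K) (c : R) : 0 <= c ->
  (forall x, rnorm (T x) <= c * rnorm x) -> forall x, rnorm (adj T x) <= c * rnorm x.
Proof.
move=> c0 Tc x; have [f0|f0] := eqVneq (rnorm (adj T x)) 0.
  by rewrite f0 mulr_ge0// rnorm_ge0.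
have {}f0 : 0 < rnorm (adj T x) by rewrite lt_neqAle eq_sym f0 rnorm_ge0.
rewrite -(ler_pM2r f0) -expr2 -[_ ^+ 2]ger0_norm ?sqr_ge0// -normc_real -inner_xx adjE.
apply: le_trans (inner_le _ _) _.
by have := Tc (adj T x); have := rnorm_ge0 x; nra.
Qed.

Lemma isometry_rnorm H K (T : bop H K) : Defs.isometry T -> forall x, rnorm (T x) = rnorm x.
Proof. by move=> Ti x; rewrite /rnorm Ti. Qed.

Lemma adj_isometry H K (T : bop H K) : Defs.isometry T -> bcomp (adj T) T = 1.
Proof.
move=> Ti; have Tr := isometry_rnorm Ti.
have re x y : complex.Re (inner (T x) (T y)) = complex.Re (inner x y).
  by have := rnorm_sqrD (T x) (T y); rewrite -bopD !Tr rnorm_sqrD; lra.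
apply: bopP => x; apply: inner_inj => z /=.
rewrite -innerA; apply/eqP; rewrite eq_complex re eqxx /=.
have := re ('i%C *: z) x; rewrite bopZ !innerZl.
by case: (inner _ _) => a b; case: (inner _ _) => a' b' /= => h; apply/eqP; lra.
Qed.

Section Endo.
Context {H : hilbertType R}.
Implicit Types S T : bop H H.

Lemma star_bopM S T : star (S * T) = star T * star S.
Proof. exact: adj_comp. Qed.
Lemma star_bopK T : star (star T) = T.
Proof. exact: adjK. Qed.
Lemma star_bop_linear c S T : star (c *: S + T) = conjc c *: star S + star T.
Proof. exact: adjP_linear. Qed.
Lemma star_bop1 : star (1 : bop H H) = 1.
Proof. by apply/esym/adj_unique. Qed.
Lemma star_bopX T n : star (T ^+ n) = star T ^+ n.
Proof.
by elim: n => [|n IH]; rewrite ?expr0 ?star_bop1// exprS exprSr star_bopM IH.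
Qed.
Lemma star_bopD S T : star (S + T) = star S + star T.
Proof. by have := star_bop_linear 1 S T; rewrite conjc1 !scale1r. Qed.
Lemma star_bop0 : star (0 : bop H H) = 0.
Proof.
by have := star_bop_linear (-1) 0 (0 : bop H H); rewrite rmorphN rmorph1 !scaleN1r !addNr.
Qed.
Lemma star_bopN T : star (- T) = - star T.
Proof.
have := star_bop_linear (-1) T (0 : bop H H).
by rewrite rmorphN rmorph1 !scaleN1r star_bop0 !addr0.
Qed.
Lemma star_bopZ c T : star (c *: T) = conjc c *: star T.
Proof. by have := star_bop_linear c T 0; rewrite star_bop0 !addr0. Qed.
End Endo.

(** The adjoint of the extension is given by Riesz' theorem. *)
Lemma bop_extension H K (L : lmodType R[i]) (D : set L)
    (al : L -> H) (be : L -> K) (c : R) : 0 <= c ->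
  D !=set0 -> (forall a x y, D x -> D y -> D (a *: x + y)) ->
  (forall a x y, D x -> D y -> al (a *: x + y) = a *: al x + al y) ->
  (forall a x y, D x -> D y -> be (a *: x + y) = a *: be x + be y) ->
  (forall x, D x -> rnorm (be x) <= c * rnorm (al x)) ->
  (forall y, adherent [set al x | x in D] y) ->
  exists T : bop H K, forall x, D x -> T (al x) = be x.
Proof.
move=> c0 D0 DL all bel bec dens.
have ex k : exists z, forall x, D x -> inner k (be x) = inner z (al x).
  have [|||||z _ zP] := @riesz _ H L D al (fun v => inner k (be v)) (rnorm k * c) => //.
  - by move=> a u v Du Dv; rewrite bel// inner_linear.
  - move=> v Dv; rewrite -mulrA; apply: le_trans (inner_le _ _) _.
    by rewrite ler_wpM2l ?rnorm_ge0 ?bec.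
  - by exists z => v; exact: zP.
have {ex}[f fP] := choice ex.
have uniq z z' : (forall x, D x -> inner z (al x) = inner z' (al x)) -> z = z'.
  move=> zz; apply/eqP; rewrite -subr_eq0; apply/eqP/(adherent_orth0 (dens _)).
  by move=> _ [x Dx <-]; rewrite innerBl zz// subrr.
have fl : linear f.
  move=> a u v; apply: uniq => x Dx.
  by rewrite -fP// !innerDl !innerZl !fP.
have [|S SE _] := @mk_bop K H f c fl.
  move=> u; have [f0|f0] := eqVneq (rnorm (f u)) 0.
    by rewrite f0 mulr_ge0// rnorm_ge0.
  have {}f0 : 0 < rnorm (f u) by rewrite lt_neqAle eq_sym f0 rnorm_ge0.
  apply/ler_addgt0Pl => e e0.
  have s0 : 0 < rnorm (f u) / (rnorm (f u) + c * rnorm u) * e.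
    by rewrite !mulr_gt0// invr_gt0 ltr_wpDr// mulr_ge0// rnorm_ge0.
  have [_ [x Dx <-] xu] := dens (f u) _ s0.
  have h1 := inner_le (f u) (f u - al x).
  have h2 := inner_le u (be x).
  have h3 := bec x Dx.
  have h4 : rnorm (al x) <= rnorm (f u) + rnorm (f u - al x).
    rewrite rnormBC; apply: le_trans (rnormD _ _); by rewrite addrC subrK.
  have h5 : rnorm (f u) ^+ 2 <= rnorm u * rnorm (be x) + rnorm (f u) * rnorm (f u - al x).
    rewrite -[_ ^+ 2]ger0_norm ?sqr_ge0// -normc_real -inner_xx.
    rewrite -[X in inner _ X](subrK (al x)) innerDr -fP// [leRHS]addrC.
    apply: le_trans (le_normcD _ _) _; exact: lerD.
  move: xu; rewrite rnormBC -(ltr_pM2r (x := rnorm (f u) + c * rnorm u)); last first.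
    by rewrite ltr_wpDr// mulr_ge0// rnorm_ge0.
  rewrite mulrAC divfK; last by rewrite gt_eqF// ltr_wpDr// mulr_ge0// rnorm_ge0.
  have := rnorm_ge0 u; have := rnorm_ge0 (f u - al x); have := rnorm_ge0 (be x).
  move: h3 h4 h5 f0 e0 c0; move: (rnorm (f u - al x)) (rnorm (f u)) (rnorm u).
  move: (rnorm (be x)) (rnorm (al x)) => r3 r1 d nf nb h3 h4 h5 f0 e0 c0 r30 d0 nb0 h6.
  have h7 : nb * r3 <= nb * (c * (nf + d)).
    by rewrite ler_wpM2l//; apply: le_trans h3 _; rewrite ler_wpM2l.
  rewrite -(ler_pM2l f0); nra.
exists (adj S) => x Dx; apply: inner_inj => k.
by rewrite -innerA SE -fP.
Qed.

(** Riesz' theorem for the functional [inner y] on [D] gives the value at [y]. *)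
Lemma projection H (L : lmodType R[i]) (D : set L) (al : L -> H) :
  D !=set0 -> (forall a x y, D x -> D y -> D (a *: x + y)) ->
  (forall a x y, D x -> D y -> al (a *: x + y) = a *: al x + al y) ->
  exists P : bop H H, forall y,
    adherent [set al x | x in D] (P y) /\
    forall x, D x -> inner (y - P y) (al x) = 0.
Proof.
move=> D0 DL all.
have ex y : exists z, adherent [set al x | x in D] z /\
    forall x, D x -> inner (y - z) (al x) = 0.
  have [|||||z zD zP] := @riesz _ H L D al (fun v => inner y (al v)) (rnorm y) => //.
  - by move=> a u v Du Dv; rewrite all// inner_linear.
  - by move=> v Dv; exact: inner_le.
  - by exists z; split=> // x Dx; rewrite innerBl zP// subrr.
have {ex}[f fP] := choice ex.
have DD u v : [set al x | x in D] u -> [set al x | x in D] v ->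
    [set al x | x in D] (u + v).
  move=> [x Dx <-] [y Dy <-]; exists (1 *: x + y); first exact: DL.
  by rewrite all// scale1r.
have [Dz alz] := linear_on0 D0 DL all.
have DZ a u : [set al x | x in D] u -> [set al x | x in D] (a *: u).
  move=> [x Dx <-]; exists (a *: x + 0); first exact: DL.
  by rewrite all// alz addr0.
have DN u : [set al x | x in D] u -> [set al x | x in D] (- u).
  by move=> ?; rewrite -scaleN1r; exact: DZ.
have uniq y z z' : adherent [set al x | x in D] z -> adherent [set al x | x in D] z' ->
  (forall x, D x -> inner (y - z) (al x) = 0) ->
  (forall x, D x -> inner (y - z') (al x) = 0) -> z = z'.
  move=> Dz1 Dz2 zz zz'; apply/eqP; rewrite -subr_eq0; apply/eqP.
  apply: (@adherent_orth0 _ _ [set al x | x in D]).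
    by apply: adherentD => //; exact: adherentN.
  move=> _ [x Dx <-]; have -> : z - z' = (y - z') - (y - z).
    by rewrite opprB [RHS]addrC addrA subrK.
  by rewrite innerBl zz// zz'// subrr.
have adhZ a x : adherent [set al x | x in D] x -> adherent [set al x | x in D] (a *: x).
  move=> Dx e e0; have a1 : 0 < Normc.normc a + 1 by have := normc_ge0 a; lra.
  have [u Du ux] := Dx (e / (Normc.normc a + 1)) (divr_gt0 e0 a1).
  exists (a *: u); first exact: DZ.
  rewrite -scalerBr rnormZ; have := rnorm_ge0 (u - x); have := normc_ge0 a.
  by move: ux; rewrite ltr_pdivlMr//; nra.
have fl : linear f.
  move=> a u v; apply: (uniq (a *: u + v)).
  - exact: (fP _).1.
  - apply: adherentD => //; last exact: (fP _).1.
    exact/adhZ/(fP _).1.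
  - by move=> x Dx; exact: (fP _).2.
  - move=> x Dx; rewrite opprD addrACA -scalerBr innerDl innerZl.
    by rewrite !(fP _).2// mulr0 addr0.
have [|P PE _] := @mk_bop H H f 1 fl; last by exists P => y; rewrite PE.
move=> y; rewrite mul1r.
have orth : inner (y - f y) (f y) = 0.
  by apply: (adherent_orth (fP y).1) => _ [x Dx <-]; exact: (fP y).2.
have := rnorm_sqrD (y - f y) (f y); rewrite subrK orth /= mulr0 addr0.
rewrite -ler_sqr ?nnegrE ?rnorm_ge0// => ->.
by rewrite lerDr sqr_ge0.
Qed.

End Operators.

(** * Commutants *)

Section Commutants.
Context {R : realType} {H : hilbertType R}.
Implicit Types S T : set (bop H H).

Lemma commutant1 S : commutant S 1.
Proof. by move=> y _; rewrite mul1r mulr1. Qed.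

Lemma commutant_linear S c x y :
  commutant S x -> commutant S y -> commutant S (c *: x + y).
Proof.
move=> Sx Sy z Sz; rewrite mulrDl mulrDr -scalerAl -scalerAr.
by rewrite (Sx z)// (Sy z).
Qed.

Lemma commutantM S x y : commutant S x -> commutant S y -> commutant S (x * y).
Proof. by move=> Sx Sy z Sz; rewrite -mulrA (Sy z)// !mulrA (Sx z). Qed.

Lemma commutant_star S : (forall x, S x -> S (star x)) ->
  forall x, commutant S x -> commutant S (star x).
Proof.
move=> Sstar x Sx y Sy.
by rewrite -[y]star_bopK -!star_bopM Sx//; exact: Sstar.
Qed.

Lemma commutant_star_subalg S : (forall x, S x -> S (star x)) ->
  star_subalg (commutant S).
Proof.
move=> Sstar; split; [exact: commutant1 | exact: commutant_linear | |].
- exact: commutantM.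
- exact: commutant_star.
Qed.

Lemma commutant_sub S T : S `<=` T -> commutant T `<=` commutant S.
Proof. by move=> ST x Tx y Sy; apply/Tx/ST. Qed.

Lemma sub_bicommutant S : S `<=` bicommutant S.
Proof. by move=> x Sx y Sy; rewrite Sy. Qed.

Lemma commutant3 S : commutant (bicommutant S) = commutant S.
Proof.
apply/seteqP; split; first exact/commutant_sub/sub_bicommutant.
exact: sub_bicommutant.
Qed.

Lemma bicommutant_star_subalg S : (forall x, S x -> S (star x)) ->
  star_subalg (bicommutant S).
Proof. by move=> Sstar; apply/commutant_star_subalg/commutant_star. Qed.

Lemma bicommutant_von_neumann S : (forall x, S x -> S (star x)) ->
  von_neumann (bicommutant S).
Proof.
move=> /bicommutant_star_subalg[_ _ _ Sstar]; split=> //.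
by rewrite {1}/bicommutant commutant3.
Qed.

(** The von Neumann density argument: the projection onto the closure of [S y]
    commutes with [S], hence with [X]. *)
Lemma bicommutant_adherent S (y : H) X : star_subalg S -> bicommutant S X ->
  adherent [set b y | b in S] (X y).
Proof.
move=> [S1 SL SM Sstar] SX.
have S0 : S !=set0 by exists 1.
have [P PP] := @projection R H _ S (fun b => b y) S0 SL (fun _ _ _ _ _ => erefl).
have orth0 z : adherent [set b y | b in S] z ->
    (forall b, S b -> inner z (b y) = 0) -> z = 0.
  by move=> Sz zS; apply: (adherent_orth0 Sz) => _ [b Sb <-]; exact: zS.
have SD u v : [set b y | b in S] u -> [set b y | b in S] v ->
    [set b y | b in S] (u + v).
  move=> [a Sa <-] [b Sb <-]; exists (1 *: a + b); first exact: SL.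
  by rewrite scale1r.
have Sz : S 0 by have := SL (-1) 1 1 S1 S1; rewrite scaleN1r addNr.
have SN u : [set b y | b in S] u -> [set b y | b in S] (- u).
  move=> [a Sa <-]; exists ((-1) *: a + 0); first exact: SL.
  by rewrite addr0 scaleN1r.
have PS : commutant S P.
  move=> b Sb; apply: bopP => x; rewrite !bopME; apply/eqP; rewrite -subr_eq0.
  apply/eqP/orth0.
    apply: adherentD => //; first exact: (PP _).1.
    apply: adherentN => //.
    apply: adherent_trans (adherent_bop b (PP x).1) => _ [_ [a Sa <-] <-].
    by apply: adherent_self; exists (b * a) => //; exact: SM.
  move=> a Sa.
  have -> : P (b x) - b (P x) = b (x - P x) - (b x - P (b x)).
    by rewrite bopB opprB [RHS]addrC addrA subrK.
  rewrite innerBl (PP _).2// subr0 innerA -bopME.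
  by rewrite (PP _).2//; apply: SM => //; exact: Sstar.
have Py : P y = y.
  apply/eqP; rewrite eq_sym -subr_eq0; apply/eqP/orth0; last exact: (PP y).2.
  apply: adherentD => //; first by apply: adherent_self; exists 1.
  by apply: adherentN => //; exact: (PP _).1.
by rewrite -{2}Py -bopME SX// bopME; exact: (PP _).1.
Qed.

End Commutants.

(** * Limits of vectors and operators *)

Section Limits.
Context {R : realType}.
Implicit Types H K : hilbertType R.

Definition hcvg H (u : nat -> H) (l : H) :=
  forall e : R, 0 < e -> exists N, forall n, (N <= n)%N -> rnorm (u n - l) < e.

Lemma rnorm_small_eq0 H (x : H) : (forall e : R, 0 < e -> rnorm x <= e) -> x = 0.
Proof.
move=> xe; apply: rnorm_eq0; apply/eqP; rewrite eq_le rnorm_ge0 andbT.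
by apply/ler_addgt0Pl => e e0; rewrite addr0 xe.
Qed.

Lemma hcvg_uniq H (u : nat -> H) l l' : hcvg u l -> hcvg u l' -> l = l'.
Proof.
move=> ul ul'; apply/eqP; rewrite -subr_eq0; apply/eqP/rnorm_small_eq0 => e e0.
have e2 : 0 < e / 2 by rewrite divr_gt0.
have [N NP] := ul _ e2; have [N' NP'] := ul' _ e2.
have := NP _ (leq_maxl N N'); have := NP' _ (leq_maxr N N').
have := rnormB_tri (u (maxn N N')) l l'; rewrite (rnormBC l (u _)); lra.
Qed.

Lemma hcvg_cst H (l : H) : hcvg (fun=> l) l.
Proof. by move=> e e0; exists 0%N => n _; rewrite subrr rnorm0. Qed.

Lemma hcvgD H (u v : nat -> H) l m :
  hcvg u l -> hcvg v m -> hcvg (fun n => u n + v n) (l + m).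
Proof.
move=> ul vm e e0; have e2 : 0 < e / 2 by rewrite divr_gt0.
have [N NP] := ul _ e2; have [N' NP'] := vm _ e2.
exists (maxn N N') => n; rewrite geq_max => /andP[Nn N'n].
rewrite opprD addrACA; apply: le_lt_trans (rnormD _ _) _.
have := NP _ Nn; have := NP' _ N'n; lra.
Qed.

Lemma hcvg_bop H K (T : bop H K) (u : nat -> H) l :
  hcvg u l -> hcvg (T \o u) (T l).
Proof.
move=> ul e e0; have [c c0 Tc] := bop_rbound T.
have c1 : 0 < c + 1 by lra.
have [N NP] := ul _ (divr_gt0 e0 c1); exists N => n /NP h.
rewrite /= -bopB; apply: le_lt_trans (Tc _) _.
by have := rnorm_ge0 (u n - l); move: h; rewrite ltr_pdivlMr//; nra.
Qed.

Lemma hcvgZ H c (u : nat -> H) l : hcvg u l -> hcvg (fun n => c *: u n) (c *: l).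
Proof. exact: (hcvg_bop (c *: (1 : bop H H))). Qed.

Lemma hcvg_le H (u : nat -> H) l (c : R) :
  hcvg u l -> (forall n, rnorm (u n) <= c) -> rnorm l <= c.
Proof.
move=> ul uc; apply/ler_addgt0Pl => e e0; have [N /(_ N (leqnn _)) h] := ul _ e0.
have := uc N; have := rnormD (u N) (l - u N).
by rewrite addrC subrK rnormBC; lra.
Qed.

Lemma hcvg_inner H K (u : nat -> H) (v : nat -> K) l m x y :
  hcvg u l -> hcvg v m -> (forall n, inner (u n) x = inner y (v n)) ->
  inner l x = inner y m.
Proof.
move=> ul vm uv; apply/eqP; rewrite -subr_eq0; apply/eqP/Normc.eq0_normc.
apply/eqP; rewrite eq_le normc_ge0 andbT; apply/ler_addgt0Pl => e e0; rewrite addr0.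
have cx : 0 < 2 * (rnorm x + 1) by have := rnorm_ge0 x; lra.
have cy : 0 < 2 * (rnorm y + 1) by have := rnorm_ge0 y; lra.
have [N NP] := ul _ (divr_gt0 e0 cx); have [N' NP'] := vm _ (divr_gt0 e0 cy).
have := NP _ (leq_maxl N N'); have := NP' _ (leq_maxr N N').
set n := maxn N N'.
have -> : inner l x - inner y m = inner (l - u n) x + inner y (v n - m).
  by rewrite innerBl innerBr uv addrA subrK.
rewrite rnormBC (rnormBC (u n)) => h h'.
apply: le_trans (le_normcD _ _) _.
have h1 := inner_le (l - u n) x; have h2 := inner_le y (v n - m).
move: h h' h1 h2; rewrite rnormBC !ltr_pdivlMr//.
have := rnorm_ge0 x; have := rnorm_ge0 y.
have := rnorm_ge0 (v n - m); have := rnorm_ge0 (l - u n).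
move: (rnorm _) (rnorm (v n - m)) (rnorm x) (rnorm y) (Normc.normc _) (Normc.normc _).
move=> a b c d f g *; nra.
Qed.

Lemma bop_limit H K (p : nat -> bop H K) (c : R) :
  (forall n x, rnorm (p n x) <= c * rnorm x) ->
  (forall x (e : R), 0 < e -> exists N, forall m n, (N <= m)%N -> (N <= n)%N ->
     rnorm (p m x - p n x) < e) ->
  exists T : bop H K, forall x, hcvg (fun n => p n x) (T x).
Proof.
move=> pc pC; have /choice[f fP] : forall x, exists l, hcvg (fun n => p n x) l.
  by move=> x; exact: hilbert_complete (pC x).
have fl : linear f.
  move=> a x y; apply: (hcvg_uniq (fP _)).
  under eq_fun do rewrite bop_linear.
  by apply: hcvgD; [exact: hcvgZ|].
have [|T TE _] := @mk_bop R H K f c fl.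
  by move=> x; exact: hcvg_le (fP x) _.
by exists T => x; rewrite TE.
Qed.

End Limits.

(** * Square roots of positive operators *)

Section SquareRoot.
Context {R : realType} {H : hilbertType R}.

(** The iteration of [bop_sqrt] for the scalar [B = 1]; it dominates the iteration for
    every contraction [B]. *)
Let s := fix s k : R := if k is k'.+1 then (1 + s k' ^+ 2) / 2 else 0.

Let sS k : s k.+1 = (1 + s k ^+ 2) / 2. Proof. by []. Qed.

Let s_bound k : 0 <= s k <= 1.
Proof. by elim: k => [|k /= /andP[h0 h1]]; rewrite ?lexx ?ler01//; apply/andP; split; nra. Qed.

Let s_le k : s k <= s k.+1.
Proof. by rewrite /= -subr_ge0; have := sqr_ge0 (s k - 1); nra. Qed.

Let s_mono k m : (k <= m)%N -> s k <= s m.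
Proof.
move=> /subnK <-; elim: (m - k)%N => [//|n IH]; rewrite addSn.
exact: le_trans IH (s_le _).
Qed.

Let s_cauchy (e : R) : 0 < e ->
  exists N, forall m n, (N <= m)%N -> (N <= n)%N -> `|s m - s n| < e.
Proof.
move=> e0; have Ssup : has_sup (range s).
  by split; [exists (s 0%N), 0%N | exists 1 => _ [k _ <-]; case/andP: (s_bound k)].
have [_ [N _ <-] NP] := sup_adherent e0 Ssup.
exists N => m n Nm Nn.
have ub k : s k <= sup (range s) by apply: ub_le_sup; [exact: Ssup.2 | exists k].
rewrite ltr_norml; have := ub m; have := ub n; have := s_mono Nm; have := s_mono Nn.
by move: NP; move: (s m) (s n) (s N) (sup _) => *; apply/andP; split; lra.
Qed.

Section Contraction.
Variable B : bop H H.
Hypothesis B_contraction : forall x, rnorm (B x) <= rnorm x.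

Let h : R[i] := ((2^-1)%:C)%C.
Let p := fix p k : bop H H := if k is k'.+1 then h *: (B + p k' * p k') else 0.

Let pS k : p k.+1 = h *: (B + p k * p k). Proof. by []. Qed.
Let p0 x : p 0 x = 0. Proof. by []. Qed.

Let rnorm_h (x : H) : rnorm (h *: x) = rnorm x / 2.
Proof. by rewrite rnormZ normc_real ger0_norm ?invr_ge0// mulrC. Qed.

Let p_bound k x : rnorm (p k x) <= s k * rnorm x.
Proof.
elim: k x => [|k IH] x; first by rewrite p0 rnorm0 mul0r.
rewrite sS pS bopZE rnorm_h bopDE bopME.
have := rnormD (B x) (p k (p k x)); have := B_contraction x.
have := IH (p k x); have := IH x; case/andP: (s_bound k) => s0 _.
have := rnorm_ge0 x; have := rnorm_ge0 (p k x).
move: (rnorm (B x + _)) (rnorm (B x)) (rnorm (p k (p k x))) (rnorm (p k x)) (rnorm x).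
by move=> a b c d f *; nra.
Qed.

(** From [p_(k+1)^2 - p_k^2 = p_(k+1) (p_(k+1) - p_k) + (p_(k+1) - p_k) p_k]. *)
Let p_step k x : rnorm (p k.+1 x - p k x) <= (s k.+1 - s k) * rnorm x.
Proof.
elim: k x => [|k IH] x; first by rewrite p0 !subr0; exact: p_bound.
have -> : p k.+2 x - p k.+1 x =
    h *: (p k.+1 (p k.+1 x - p k x) + (p k.+1 (p k x) - p k (p k x))).
  rewrite bopB addrA subrK (pS k.+1) [in X in _ - X = _](pS k) !bopZE -scalerBr.
  by rewrite !bopDE !bopME opprD addrACA subrr add0r.
rewrite rnorm_h.
have h1 := rnormD (p k.+1 (p k.+1 x - p k x)) (p k.+1 (p k x) - p k (p k x)).
have h2 := p_bound k.+1 (p k.+1 x - p k x).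
have h3 := IH (p k x); have h4 := IH x; have h5 := p_bound k x.
have /andP[s0 _] := s_bound k; have /andP[s1 _] := s_bound k.+1.
have s01 := s_le k; have x0 := rnorm_ge0 x.
have -> : s k.+2 - s k.+1 = (s k.+1 ^+ 2 - s k ^+ 2) / 2.
  have := sS k.+1; have := sS k; move: (s k.+2) (s k.+1) (s k) => a b c; lra.
have h6 : rnorm (p k.+1 (p k.+1 x - p k x)) <= s k.+1 * ((s k.+1 - s k) * rnorm x).
  by apply: le_trans h2 _; rewrite ler_wpM2l.
have h7 : rnorm (p k.+1 (p k x) - p k (p k x)) <= (s k.+1 - s k) * (s k * rnorm x).
  by apply: le_trans h3 _; rewrite ler_wpM2l// subr_ge0.
move: h1 h6 h7; move: (rnorm (_ + _)) (rnorm (p k.+1 _)) (rnorm (_ - _)) => a b c.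
by move: (s k.+1) (s k) (rnorm x) => u v w h1 h6 h7; nra.
Qed.

Let p_dist k m x : (k <= m)%N -> rnorm (p m x - p k x) <= (s m - s k) * rnorm x.
Proof.
move=> /subnK <-; elim: (m - k)%N => [|n IH].
  by rewrite add0n !subrr rnorm0 mul0r.
rewrite addSn; apply: le_trans (rnormB_tri (p (n + k) x) _ _) _.
have := p_step (n + k) x; move: IH; rewrite !mulrBl; lra.
Qed.

(** By [p_dist] the iterates are pointwise Cauchy, because the scalar ones increase and
    are bounded by 1. *)
Lemma contraction_limit : exists W : bop H H,
  [/\ W * W = 2 *: W - B, (star B = B -> star W = W) &
      forall X, X * B = B * X -> X * W = W * X].
Proof.
have pC x (e : R) : 0 < e -> exists N, forall m n, (N <= m)%N -> (N <= n)%N ->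
    rnorm (p m x - p n x) < e.
  move=> e0; have x1 : 0 < rnorm x + 1 by have := rnorm_ge0 x; lra.
  have [N NP] := s_cauchy (divr_gt0 e0 x1); exists N => m n Nm Nn.
  have : rnorm (p m x - p n x) <= `|s m - s n| * rnorm x.
    case/orP: (leq_total m n) => mn.
      by rewrite rnormBC distrC ger0_norm ?subr_ge0 ?s_mono// p_dist.
    by rewrite ger0_norm ?subr_ge0 ?s_mono// p_dist.
  have := NP _ _ Nm Nn; rewrite ltr_pdivlMr// => h1 h2; apply: le_lt_trans h2 _.
  by have := normr_ge0 (s m - s n); have := rnorm_ge0 x; nra.
have p1 n x : rnorm (p n x) <= 1 * rnorm x.
  apply: le_trans (p_bound n x) _; rewrite ler_wpM2r ?rnorm_ge0//.
  by case/andP: (s_bound n).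
have [W WP] := bop_limit p1 pC.
exists W; split.
- apply: bopP => x.
  apply: (@hcvg_uniq _ _ (fun n => p n (p n x))).
    rewrite bopME => e e0.
    have e2 : 0 < e / 2 by rewrite divr_gt0.
    have [N NP] := WP x _ e2; have [N' NP'] := WP (W x) _ e2.
    exists (maxn N N') => n; rewrite geq_max => /andP[/NP h1 /NP' h2].
    apply: le_lt_trans (rnormB_tri (p n (W x)) _ _) _.
    have := p1 n (p n x - W x); rewrite bopB; lra.
  have -> : (fun n => p n (p n x)) = (fun n => 2 *: p n.+1 x + - B x).
    apply/funext => n; rewrite pS bopZE scalerA.
    have -> : 2 * h = 1 :> R[i].
      by rewrite /h -(rmorph_nat (@real_complex R)) -rmorphM divff ?rmorph1.
    by rewrite scale1r bopDE [B x + _]addrC addrK.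
  apply: hcvgD; last exact: hcvg_cst.
  apply: hcvgZ => e e0; have [N NP] := WP x e e0.
  by exists N => n Nn; apply: NP; exact: leq_trans Nn (leqnSn _).
- move=> Bstar; have pstar n : star (p n) = p n.
    elim: n => [|n IH]; first exact: star_bop0.
    rewrite pS star_bopZ star_bopD star_bopM IH Bstar; congr (_ *: _).
    by rewrite /h conjc_real.
  apply/esym/adj_unique => x y.
  apply: (hcvg_inner (WP x) (WP y)) => n.
  by rewrite innerA; congr (inner x (bopf _ y)); exact: pstar.
- move=> X XB; have Xp n : X * p n = p n * X.
    elim: n => [|n IH]; first by rewrite mulr0 mul0r.
    by rewrite pS -scalerAr -scalerAl mulrDr mulrDl XB mulrA IH -mulrA IH mulrA.
  apply: bopP => x; rewrite !bopME.
  apply: (hcvg_uniq (hcvg_bop X (WP x))).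
  have -> : X \o (fun n => p n x) = (fun n => p n (X x)).
    by apply/funext => n; rewrite -[LHS]/((X * p n) x) Xp.
  exact: WP.
Qed.

End Contraction.

(** After scaling, [B := 1 - C^* C] is a contraction, and a fixed point of
    [W |-> (B + W^2) / 2] gives the root [1 - W]. *)
Lemma bop_sqrt (K : hilbertType R) (C : bop H K) : exists W : bop H H,
  [/\ star W = W, W * W = bcomp (adj C) C &
      forall X, X * bcomp (adj C) C = bcomp (adj C) C * X -> X * W = W * X].
Proof.
have [c0 c00 Cc0] := bop_rbound C; pose c := c0 + 1.
have c_gt0 : 0 < c by rewrite /c; lra.
have Cc x : rnorm (C x) <= c * rnorm x.
  apply: le_trans (Cc0 x) _; rewrite ler_wpM2r ?rnorm_ge0// /c; lra.
pose T := bcomp (adj C) C; pose k : R[i] := ((c^-1 ^+ 2)%:C)%C.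
have starT : star T = T by rewrite /star /= /T adj_comp adjK.
pose B : bop H H := 1 - k *: T.
have TB x : rnorm (B x) <= rnorm x.
  rewrite -ler_sqr ?nnegrE ?rnorm_ge0// /B bopDE bopNE bopZE rnorm_sqrD rnormN innerNr.
  rewrite innerZr rnormZ normc_real ger0_norm ?sqr_ge0//.
  have -> : inner ((1 : bop H H) x) (T x) = ((rnorm (C x) ^+ 2)%:C)%C.
    by rewrite -inner_xx /T /= -innerA.
  have := adj_bound (ltW c_gt0) Cc (C x); rewrite -[adj C (C x)]/(T x) /=.
  have := rnorm_ge0 (T x); have := rnorm_ge0 (C x).
  move: (rnorm (T x)) (rnorm (C x)) => t r r0 t0 tr.
  have tr2 : t ^+ 2 <= c ^+ 2 * r ^+ 2.
    by rewrite -exprMn ler_sqr ?nnegrE ?mulr_ge0// ltW.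
  have : (c^-1 ^+ 2 * t) ^+ 2 <= c^-1 ^+ 2 * r ^+ 2.
    rewrite exprMn -exprM (_ : (2 * 2)%N = (2 + 2)%N)// exprD -mulrA ler_wpM2l ?sqr_ge0//.
    apply: le_trans (ler_wpM2l (sqr_ge0 _) tr2) _.
    by rewrite mulrA -exprMn mulVf ?gt_eqF// expr1n mul1r.
  rewrite -[rnorm ((1 : bop H H) x)]/(rnorm x); set q := c^-1 ^+ 2.
  have : 0 <= q * r ^+ 2 by rewrite mulr_ge0// sqr_ge0.
  lra.
have [W [W2 Wstar Wcomm]] := contraction_limit TB.
have starB : star B = B.
  by rewrite /B star_bopD star_bopN star_bopZ star_bop1 starT conjc_real.
exists ((c%:C)%C *: (1 - W)); split.
- by rewrite star_bopZ star_bopD star_bopN star_bop1 Wstar// conjc_real.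
- rewrite -scalerAl -scalerAr scalerA mulrBr mulr1 mulrBl mul1r W2 /B.
  have -> : 1 - W - (W - (2 *: W - (1 - k *: T))) = k *: T.
    have -> : 2 *: W = W + W by rewrite -[2]/(1 + 1) scalerDl scale1r.
    have -> : W - (W + W - (1 - k *: T)) = (1 - k *: T) - W.
      by rewrite opprB addrCA opprD [W + _]addrA subrr sub0r.
    by rewrite opprB addrA subrK opprB addrCA subrr addr0.
  rewrite scalerA -!rmorphM (_ : c * c * _ = 1) ?rmorph1 ?scale1r//.
  by rewrite -expr2 -exprMn divff ?expr1n// gt_eqF.
- move=> X XT; rewrite -scalerAl -scalerAr mulrBl mulrBr mul1r mulr1 Wcomm// /B.
  by rewrite mulrBl mulrBr mul1r mulr1 -scalerAl -scalerAr XT.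
Qed.

End SquareRoot.

(** * Limits in [R[i]] *)

Section ComplexLimits.
Context {R : realType}.
Implicit Types (z : nat -> R[i]) (l : R[i]).

Definition ccvg z l :=
  forall e : R, 0 < e -> exists N, forall n, (N <= n)%N -> Normc.normc (z n - l) < e.

Lemma normcBC (a b : R[i]) : Normc.normc (a - b) = Normc.normc (b - a).
Proof. by apply: complexI; exact: (distrC a b). Qed.

Lemma ccvgP z l : ccvg z l <-> (z : nat -> R[i]^o) @ \oo --> (l : R[i]^o).
Proof.
split=> [zl|/cvgrPdist_lt zl e e0].
  apply/cvgrPdist_lt => e e0.
  have eE : e = ((complex.Re e)%:C)%C by rewrite RRe_real// gtr0_real.
  have [|N NP] := zl (complex.Re e); first by rewrite -ltcR -eE.
  exists N => // n /= Nn; rewrite -[`|_|]/((Normc.normc (l - z n))%:C)%C eE ltcR.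
  by rewrite normcBC; exact: NP.
have [|N _ NP] := zl ((e%:C)%C); first by rewrite ltcR.
exists N => n Nn; rewrite normcBC -ltcR; exact: NP.
Qed.

Lemma ccvg_lim z l : ccvg z l -> limn (z : nat -> R[i]^o) = l.
Proof. by move=> /ccvgP zl; apply: cvg_lim. Qed.

Lemma ccvg_uniq z l l' : ccvg z l -> ccvg z l' -> l = l'.
Proof. by move=> /ccvg_lim <- /ccvg_lim <-. Qed.

Lemma ccvgD z z' l l' : ccvg z l -> ccvg z' l' -> ccvg (fun n => z n + z' n) (l + l').
Proof.
move=> zl zl' e e0; have e2 : 0 < e / 2 by rewrite divr_gt0.
have [N NP] := zl _ e2; have [N' NP'] := zl' _ e2.
exists (maxn N N') => n; rewrite geq_max => /andP[/NP h /NP' h'].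
rewrite opprD addrACA; apply: le_lt_trans (le_normcD _ _) _; lra.
Qed.

Lemma ccvgZ c z l : ccvg z l -> ccvg (fun n => c * z n) (c * l).
Proof.
move=> zl e e0; have c1 : 0 < Normc.normc c + 1 by have := normc_ge0 c; lra.
have [N NP] := zl _ (divr_gt0 e0 c1); exists N => n /NP.
rewrite -mulrBr Normc.normcM ltr_pdivlMr// => h.
by have := normc_ge0 c; have := normc_ge0 (z n - l); nra.
Qed.

Lemma ccvgJ z l : ccvg z l -> ccvg (fun n => conjc (z n)) (conjc l).
Proof.
move=> zl e /zl[N NP]; exists N => n /NP; rewrite -rmorphB.
by case: (z n - l) => a b /=; rewrite sqrrN.
Qed.

Lemma ccvg_Re_le z l (c : R) :
  ccvg z l -> (forall n, complex.Re (z n) <= c) -> complex.Re l <= c.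
Proof.
move=> zl zc; apply/ler_addgt0Pl => e /zl[N /(_ N (leqnn _)) h].
have := zc N; have := normc_ge_Re (l - z N); rewrite -[`|l - _|]/((Normc.normc _)%:C)%C lecR.
move: h; rewrite normcBC raddfB /=.
by move=> h1 /ler_normlP[_ h2]; lra.
Qed.

Lemma ccvg_Re_ge z l (c : R) (M : nat) :
  ccvg z l -> (forall n, (M <= n)%N -> c <= complex.Re (z n)) -> c <= complex.Re l.
Proof.
move=> zl zc; apply/ler_addgt0Pl => e /zl[N /(_ (maxn N M) (leq_maxl _ _)) h].
have := zc _ (leq_maxr N M); have := normc_ge_Re (z (maxn N M) - l).
rewrite -[`|_ - l|]/((Normc.normc _)%:C)%C lecR.
move: h; rewrite raddfB /=.
by move=> h1 /ler_normlP[_ h2]; lra.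
Qed.

Lemma mono_bounded_cauchy (a : nat -> R) (C : R) :
  (forall n, a n <= a n.+1) -> (forall n, a n <= C) -> forall e : R, 0 < e ->
  exists N, forall n, (N <= n)%N -> a N <= a n < a N + e.
Proof.
move=> amono aC e e0; have S : has_sup (range a).
  by split; [exists (a 0%N), 0%N | exists C => _ [k _ <-]].
have [_ [N _ <-] NP] := sup_adherent e0 S.
exists N => n Nn; apply/andP; split.
  move: Nn => /subnK <-; elim: (n - N)%N => [//|k IH]; rewrite addSn.
  exact: le_trans IH (amono _).
have : a n <= sup (range a) by apply: ub_le_sup; [exact: S.2 | exists n].
by move: NP; lra.
Qed.

End ComplexLimits.

(** * The Hilbert space of square summable sequences *)

Section SquareSummable.
Context {R : realType} {H : hilbertType R}.
Implicit Types x y : nat -> H.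

Definition sqsum x N : R := \sum_(0 <= k < N) rnorm (x k) ^+ 2.

Lemma sqsumS x N : sqsum x N.+1 = sqsum x N + rnorm (x N) ^+ 2.
Proof. by rewrite /sqsum big_nat_recr. Qed.

Lemma sqsum_mono x N : sqsum x N <= sqsum x N.+1.
Proof. by rewrite sqsumS lerDl sqr_ge0. Qed.

Lemma sqsum_le x M N : (M <= N)%N -> sqsum x M <= sqsum x N.
Proof.
move=> /subnK <-; elim: (N - M)%N => [//|k IH]; rewrite addSn.
exact: le_trans IH (sqsum_mono _ _).
Qed.

Lemma sqsum_coord x k : rnorm (x k) ^+ 2 <= sqsum x k.+1.
Proof. by rewrite sqsumS lerDr; apply: sumr_ge0 => i _; exact: sqr_ge0. Qed.

Lemma series_sqsum x N :
  series (fun n => `|x n| ^+ 2 : R[i]^o) N = ((sqsum x N)%:C)%C.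
Proof.
rewrite /series /= /sqsum rmorph_sum; apply: eq_bigr => k _.
by rewrite rnormE -rmorphXn.
Qed.

(** One-dimensional completeness of [R[i]], obtained inside a line of [H]. *)
Lemma complex_complete (z : nat -> R[i]) :
  (forall e : R, 0 < e -> exists N, forall m n, (N <= m)%N -> (N <= n)%N ->
     Normc.normc (z m - z n) < e) -> exists l, ccvg z l.
Proof.
move=> zC; have [v v0] := @hilbert_nonzero R H.
have nv : 0 < rnorm v.
  by rewrite lt_neqAle rnorm_ge0 andbT eq_sym; apply: contra_neq v0 => /rnorm_eq0.
have [e e0|l lP] := @hilbert_complete R H (fun n => z n *: v).
  have [N NP] := zC _ (divr_gt0 e0 nv); exists N => m n Nm Nn.
  by rewrite -scalerBl rnormZ -ltr_pdivlMr//; exact: NP.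
exists (((rnorm v ^+ 2)^-1%:C)%C * inner v l) => e e0.
have [N NP] := lP _ (mulr_gt0 e0 nv); exists N => n Nn.
have -> : z n - ((rnorm v ^+ 2)^-1%:C)%C * inner v l =
    ((rnorm v ^+ 2)^-1%:C)%C * inner v (z n *: v - l).
  rewrite innerBr mulrBr innerZr inner_xx mulrCA -rmorphM mulVf ?rmorph1 ?mulr1//.
  by rewrite sqrf_eq0 gt_eqF.
rewrite Normc.normcM normc_real ger0_norm ?invr_ge0 ?sqr_ge0//.
rewrite mulrC ltr_pdivrMr ?exprn_gt0//; apply: le_lt_trans (inner_le _ _) _.
by rewrite expr2 mulrA [ltRHS]mulrC ltr_pM2l//; exact: NP.
Qed.

Lemma square_summableP x :
  square_summable x <-> exists C : R, forall N, sqsum x N <= C.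
Proof.
split.
  move=> /cvg_ex[l /ccvgP xl].
  have [N NP] := xl 1 ltr01; exists (sqsum x N + Normc.normc l + 1 + sqsum x N) => n.
  have s0 : 0 <= sqsum x N by apply: sumr_ge0 => i _; exact: sqr_ge0.
  have l0 := normc_ge0 l.
  have [nN|/ltnW Nn] := leqP n N; first by have := sqsum_le x nN; lra.
  have := NP _ Nn; rewrite series_sqsum => h.
  have : Normc.normc ((sqsum x n)%:C)%C <= Normc.normc (((sqsum x n)%:C)%C - l) + Normc.normc l.
    by apply: le_trans (le_normcD _ _); rewrite subrK.
  by rewrite normc_real => /(le_trans (ler_norm _)); lra.
move=> [C xC]; have [|l lP] := @complex_complete (fun n => ((sqsum x n)%:C)%C).
  move=> e e0; have e2 : 0 < e / 2 by rewrite divr_gt0.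
  have [N NP] := mono_bounded_cauchy (sqsum_mono x) xC e2.
  exists N => m n /NP/andP[h1 h2] /NP/andP[h3 h4]; rewrite -rmorphB normc_real ltr_norml.
  by apply/andP; split; lra.
apply/cvg_ex; exists l; apply/ccvgP.
by rewrite (_ : series _ = (fun n => ((sqsum x n)%:C)%C))//; apply/funext/series_sqsum.
Qed.

Lemma sqsumD x y N : sqsum (x + y) N <= 2 * sqsum x N + 2 * sqsum y N.
Proof.
rewrite /sqsum !mulr_sumr -big_split /=; apply: ler_sum => k _.
have := parallelogram (x k) (y k); have := sqr_ge0 (rnorm (x k - y k)).
by rewrite -[(x + y) k]/(x k + y k); lra.
Qed.

Lemma sqsumZ c x N : sqsum (c *: x) N = Normc.normc c ^+ 2 * sqsum x N.
Proof.
by rewrite /sqsum mulr_sumr; apply: eq_bigr => k _; rewrite -exprMn -rnormZ.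
Qed.

Definition l2_pred : {pred nat -> H} := [pred x | `[< square_summable x >]].

Lemma l2_submod : submod_closed l2_pred.
Proof.
split=> [|c x y /asboolP/square_summableP[C xC] /asboolP/square_summableP[D yD]];
  apply/asboolP/square_summableP.
  by exists 0 => N; rewrite /sqsum big1// => k _; rewrite rnorm0 expr0n.
exists (2 * (Normc.normc c ^+ 2 * C) + 2 * D) => N.
apply: le_trans (sqsumD _ _ _) _; rewrite sqsumZ.
have := ler_wpM2l (sqr_ge0 (Normc.normc c)) (xC N); have := yD N; lra.
Qed.

(** The partial sums vary less than those of [|x n|^2 + |y n|^2]. *)
Lemma series_inner_cvg x y (C D : R) :
  (forall N, sqsum x N <= C) -> (forall N, sqsum y N <= D) ->
  exists l, ccvg (series (fun n => inner (x n) (y n) : R[i]^o)) l.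
Proof.
move=> xC yD; apply: complex_complete => e e0.
have [|||N NP] := @mono_bounded_cauchy _ (fun n => sqsum x n + sqsum y n) (C + D) _ _ (e / 2).
- by move=> n; have := sqsum_mono x n; have := sqsum_mono y n; lra.
- by move=> n; have := xC n; have := yD n; lra.
- by rewrite divr_gt0.
have key n : (N <= n)%N -> Normc.normc (series (fun n => inner (x n) (y n) : R[i]^o) n -
    series (fun n => inner (x n) (y n) : R[i]^o) N) <=
    sqsum x n + sqsum y n - (sqsum x N + sqsum y N).
  move=> /subnK <-; elim: (n - N)%N => [|k IH].
    by rewrite add0n !subrr Normc.normc0.
  rewrite addSn !sqsumS /series /= big_nat_recr//= addrAC.
  apply: le_trans (le_normcD _ _) _.
  have := inner_le (x (k + N)%N) (y (k + N)%N).
  have := sqr_ge0 (rnorm (x (k + N)%N) - rnorm (y (k + N)%N)).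
  have := sqr_ge0 (rnorm (x (k + N)%N) + rnorm (y (k + N)%N)).
  by move: IH; rewrite /series /=; nra.
exists N => m n Nm Nn.
have := key m Nm; have := key n Nn; have /andP[_ h1] := NP m Nm; have /andP[_ h2] := NP n Nn.
set zm := series _ m; set zn := series _ n; set zN := series _ N.
have : Normc.normc (zm - zn) <= Normc.normc (zm - zN) + Normc.normc (zn - zN).
  rewrite (normcBC zn); apply: le_trans (le_normcD _ _).
  by rewrite addrA subrK.
lra.
Qed.

End SquareSummable.

Lemma sform_sqrt_add (R : realType) (L : lmodType R[i]) (s : L -> L -> R[i]) :
  (forall x c y z, s x (c *: y + z) = c * s x y + s x z) ->
  (forall x y, s y x = conjc (s x y)) -> (forall x, 0 <= s x x) ->
  forall x y, Num.sqrt (complex.Re (s (x + y) (x + y))) <=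
    Num.sqrt (complex.Re (s x x)) + Num.sqrt (complex.Re (s y y)).
Proof.
move=> sl sc s0 x y.
have cs := cauchy_schwarz sl sc s0 x y.
have xx := sform_Re_ge0 s0 x; have yy := sform_Re_ge0 s0 y.
rewrite -[leRHS]ger0_norm ?addr_ge0 ?sqrtr_ge0// -sqrtr_sqr; apply: ler_wsqrtr.
rewrite sqrrD !sqr_sqrtr// (sformDr sl) !(sformDl sl sc) (sc x y).
have : complex.Re (s x y) <= Num.sqrt (complex.Re (s x x)) * Num.sqrt (complex.Re (s y y)).
  apply: le_trans (ler_norm _) _; rewrite -sqrtrM// -sqrtr_sqr; apply: ler_wsqrtr.
  apply: le_trans cs.
  case: (s x y) => a b /=; rewrite sqr_sqrtr ?addr_ge0 ?sqr_ge0//.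
  by rewrite lerDl sqr_ge0.
by case: (s x y) => a b; rewrite !raddfD /= mulr2n; lra.
Qed.

(** In this space a pair of square summable sequences is a pair of vectors, and
    [sigma_form x y] becomes a vector functional. *)
Record l2 (R : realType) (H : hilbertType R) :=
  L2 { l2f :> nat -> H ; _ : l2f \in @l2_pred R H }.

HB.instance Definition _ (R : realType) (H : hilbertType R) := [isSub for @l2f R H].
HB.instance Definition _ (R : realType) (H : hilbertType R) :=
  [Choice of l2 H by <:].
HB.instance Definition _ (R : realType) (H : hilbertType R) :=
  GRing.isSubmodClosed.Build R[i] (nat -> H) (@l2_pred R H) (@l2_submod R H).
HB.instance Definition _ (R : realType) (H : hilbertType R) :=
  [SubChoice_isSubLmodule of l2 H by <:].

Section L2.
Context {R : realType} {H : hilbertType R}.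
Implicit Types x y : l2 H.

Lemma l2_bounded x : exists C : R, forall N, sqsum x N <= C.
Proof. by case: x => f /= /asboolP/square_summableP. Qed.

Lemma l2_ext x y : x =1 y -> x = y.
Proof. by move=> xy; apply/val_inj/funext. Qed.

Lemma l2DE x y n : (x + y) n = x n + y n. Proof. by []. Qed.
Lemma l2ZE c x n : (c *: x) n = c *: x n. Proof. by []. Qed.
Lemma l2NE x n : (- x) n = - x n. Proof. by []. Qed.

Definition l2_inner x y : R[i] := limn (series (fun n => inner (x n) (y n) : R[i]^o)).

Lemma l2_inner_cvg x y :
  ccvg (series (fun n => inner (x n) (y n) : R[i]^o)) (l2_inner x y).
Proof.
have [C xC] := l2_bounded x.
have [D yD] := l2_bounded y.
have [l lP] := series_inner_cvg xC yD.
by rewrite /l2_inner (ccvg_lim lP).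
Qed.

Lemma l2_inner_linear x c y z : l2_inner x (c *: y + z) = c * l2_inner x y + l2_inner x z.
Proof.
apply: ccvg_uniq (l2_inner_cvg _ _) _.
have := ccvgD (ccvgZ c (l2_inner_cvg x y)) (l2_inner_cvg x z).
rewrite (_ : (fun n => _) = series (fun n => inner (x n) ((c *: y + z) n) : R[i]^o))//.
apply/funext => n; rewrite /series /= mulr_sumr -big_split /=.
by apply: eq_bigr => k _; rewrite inner_linear.
Qed.

Lemma l2_inner_conj x y : l2_inner y x = conjc (l2_inner x y).
Proof.
apply: ccvg_uniq (l2_inner_cvg _ _) _.
have := ccvgJ (l2_inner_cvg x y).
rewrite (_ : (fun n => _) = series (fun n => inner (y n) (x n) : R[i]^o))//.
apply/funext => n; rewrite /series /= rmorph_sum.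
by apply: eq_bigr => k _; rewrite [RHS]inner_conj.
Qed.

Lemma l2_inner_xx x : ccvg (fun n => ((sqsum x n)%:C)%C) (l2_inner x x).
Proof.
have := l2_inner_cvg x x.
rewrite (_ : series _ = (fun n => ((sqsum x n)%:C)%C))//.
apply/funext => n; rewrite /series /= /sqsum rmorph_sum.
by apply: eq_bigr => k _; rewrite inner_xx.
Qed.

Lemma sqsum_ge0 x n : 0 <= sqsum x n.
Proof. by apply: sumr_ge0 => i _; exact: sqr_ge0. Qed.

Lemma sqsum_le_inner x n : sqsum x n <= complex.Re (l2_inner x x).
Proof.
by apply: ccvg_Re_ge (l2_inner_xx x) _ => m; exact: sqsum_le.
Qed.

Lemma l2_inner_ge0 x : 0 <= l2_inner x x.
Proof.
rewrite lecE /= (le_trans _ (sqsum_le_inner x 0)) ?sqsum_ge0// andbT.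
have := l2_inner_conj x x; case: (l2_inner x x) => a b /= [] h.
by apply/eqP; lra.
Qed.

Definition l2_norm x : R[i] := ((Num.sqrt (complex.Re (l2_inner x x)))%:C)%C.

Lemma l2_normD x y : l2_norm (x + y) <= l2_norm x + l2_norm y.
Proof.
rewrite /l2_norm -rmorphD lecR.
exact: (sform_sqrt_add l2_inner_linear l2_inner_conj l2_inner_ge0).
Qed.

Lemma l2_normZ c x : l2_norm (c *: x) = `|c| * l2_norm x.
Proof.
rewrite /l2_norm -[`|c|]/((Normc.normc c)%:C)%C -rmorphM; congr (_%:C)%C.
rewrite (sformZr l2_inner_linear) (sformZl l2_inner_linear l2_inner_conj).
rewrite (sform_xx l2_inner_ge0) -[Normc.normc c]ger0_norm ?normc_ge0//.
rewrite -sqrtr_sqr -sqrtrM ?sqr_ge0//; congr Num.sqrt.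
move: (complex.Re (l2_inner x x)) => r; case: c => a b /=; rewrite sqr_sqrtr ?addr_ge0 ?sqr_ge0//.
by ring.
Qed.

Lemma l2_norm_eq0 x : l2_norm x = 0 -> x = 0.
Proof.
move=> /complexI/eqP; rewrite sqrtr_eq0 => x0; apply: l2_ext => n.
apply: rnorm_eq0; apply/eqP; rewrite -sqrf_eq0 eq_le sqr_ge0 andbT.
exact: le_trans (sqsum_coord x n) (le_trans (sqsum_le_inner x _) x0).
Qed.

End L2.

HB.instance Definition _ (R : realType) (H : hilbertType R) :=
  Lmodule_isNormed.Build R[i] (l2 H) (@l2_normD R H) (@l2_normZ R H) (@l2_norm_eq0 R H).

Section L2Complete.
Context {R : realType} {H : hilbertType R}.

(** A Cauchy filter contains balls of radius [1 / (n + 1)], whose centres form a Cauchy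
    sequence. *)
Lemma filter_complete (V : normedModType R[i]) :
  (forall u : nat -> V, (forall e : R, 0 < e -> exists N, forall m n, (N <= m)%N ->
     (N <= n)%N -> complex.Re `|u m - u n| < e) ->
   exists l, forall e : R, 0 < e -> exists N, forall n, (N <= n)%N ->
     complex.Re `|u n - l| < e) ->
  forall F : set_system V, ProperFilter F -> cauchy F -> cvg F.
Proof.
move=> seqC F FF /cauchyP FC.
have re (v : V) : `|v| = ((complex.Re `|v|)%:C)%C by rewrite RRe_real// ger0_real.
have ballE (v w : V) (r : R) : ball v ((r%:C)%C) w -> complex.Re `|v - w| < r.
  by rewrite -ball_normE /ball_ /= re ltcR.
pose d n : R := n.+1%:R^-1.
have d0 n : 0 < d n by rewrite invr_gt0.
have /choice[u uP] n : exists x, F (ball x ((d n)%:C)%C).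
  by apply: FC; rewrite ltcR.
have dist (v w z : V) : complex.Re `|v - w| <= complex.Re `|v - z| + complex.Re `|z - w|.
  by rewrite -lecR rmorphD /= -!re; have := ler_normD (v - z) (z - w); rewrite addrA subrK.
have small (e : R) : 0 < e -> exists N, forall n, (N <= n)%N -> d n < e.
  exact: inv_succ_small.
have [e e0|l lP] := seqC u.
  have e2 : 0 < e / 2 by rewrite divr_gt0.
  have [N NP] := small _ e2; exists N => m n /NP dm /NP dn.
  have [z [/ballE h1 /ballE]] := filter_ex (filterI (uP m) (uP n)).
  rewrite distrC => h2; apply: le_lt_trans (dist _ _ z) _; lra.
apply/cvg_ex; exists l; apply/cvgrPdist_lt => e e0.
have eE : e = ((complex.Re e)%:C)%C by rewrite RRe_real// gtr0_real.
have e2 : 0 < complex.Re e / 2 by rewrite divr_gt0// -ltcR -eE.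
have [N NP] := small _ e2; have [N' NP'] := lP _ e2.
have h1 := NP _ (leq_maxl N N'); have h2 := NP' _ (leq_maxr N N').
apply: filterS (uP (maxn N N')) => x /ballE h3.
rewrite re eE ltcR; apply: le_lt_trans (dist _ _ (u (maxn N N'))) _.
rewrite distrC in h2; lra.
Qed.

Lemma l2_normE (x : l2 H) : complex.Re `|x| = Num.sqrt (complex.Re (l2_inner x x)).
Proof. by []. Qed.

Lemma sqsum_le_norm (x : l2 H) N : sqsum x N <= (complex.Re `|x|) ^+ 2.
Proof.
rewrite l2_normE sqr_sqrtr ?sqsum_le_inner//.
exact: (sform_Re_ge0 l2_inner_ge0).
Qed.

Lemma l2_norm_le (x : l2 H) (C : R) :
  0 <= C -> (forall N, sqsum x N <= C ^+ 2) -> complex.Re `|x| <= C.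
Proof.
move=> C0 xC; rewrite l2_normE -[C]ger0_norm// -sqrtr_sqr; apply: ler_wsqrtr.
exact: ccvg_Re_le (l2_inner_xx x) _.
Qed.

Lemma l2_coord_norm (x : l2 H) n : rnorm (x n) <= complex.Re `|x|.
Proof.
rewrite -ler_sqr ?nnegrE ?rnorm_ge0//; last by rewrite l2_normE sqrtr_ge0.
exact: le_trans (sqsum_coord x n) (sqsum_le_norm x _).
Qed.

(** The limit is taken coordinatewise; finite partial sums carry the Cauchy estimate
    over to it. *)
Lemma l2_complete (F : set_system (l2 H)) : ProperFilter F -> cauchy F -> cvg F.
Proof.
apply: (@filter_complete (l2 H)) => u uC.
have /choice[l lP] n : exists l, hcvg (fun k => u k n) l.
  apply: hilbert_complete => e /uC[N NP]; exists N => i j Ni Nj.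
  by apply: le_lt_trans (NP i j Ni Nj); exact: (l2_coord_norm (u i - u j) n).
have tail M (e : R) : 0 < e -> exists J, forall j, (J <= j)%N ->
    sqsum (fun n => u j n - l n) M < e.
  elim: M e => [|M IH] e e0.
    by exists 0%N => j _; rewrite /sqsum big_nil.
  have e2 : 0 < e / 2 by rewrite divr_gt0.
  have [J JP] := IH _ e2; have [|J' JP'] := lP M (Num.sqrt (e / 2)).
    by rewrite sqrtr_gt0.
  exists (maxn J J') => j; rewrite geq_max => /andP[/JP h1 /JP' h2].
  rewrite sqsumS.
  have : rnorm (u j M - l M) ^+ 2 < e / 2.
    rewrite -[e / 2]sqr_sqrtr ?(ltW e2)// ltr_sqr// ?nnegrE ?rnorm_ge0 ?sqrtr_ge0//.
  lra.
have close (e : R) : 0 < e -> exists N, forall k, (N <= k)%N ->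
    forall M, sqsum (fun n => u k n - l n) M <= e ^+ 2.
  move=> e0; have [|N NP] := uC (e / 2); first by rewrite divr_gt0.
  exists N => k Nk M; apply/ler_addgt0Pl => d d0.
  have d2 : 0 < d / 2 by rewrite divr_gt0.
  have [J JP] := tail M (d / 2) d2.
  have h1 := JP _ (leq_maxr N J).
  have h2 := NP _ _ Nk (leq_maxl N J).
  have := sqsumD (u k - u (maxn N J) : l2 H) (fun n => u (maxn N J) n - l n) M.
  rewrite (_ : _ + _ = (fun n => u k n - l n)); last first.
    by apply/funext => n; rewrite -[LHS]/((u k n - u (maxn N J) n) + (u (maxn N J) n - l n))
      addrA subrK.
  have h3 := sqsum_le_norm (u k - u (maxn N J)) M.
  have h4 : 0 <= complex.Re `|u k - u (maxn N J)| by rewrite l2_normE sqrtr_ge0.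
  move=> h5; nra.
have [N1 N1P] := close 1 ltr01.
have lS : l \in @l2_pred R H.
  apply/asboolP/square_summableP.
  have [C CP] := l2_bounded (u N1).
  exists (2 * C + 2) => N.
  have := sqsumD (u N1) (fun n => l n - u N1 n) N.
  rewrite (_ : _ + _ = l); last first.
    by apply/funext => n; rewrite -[LHS]/(u N1 n + (l n - u N1 n)) addrC subrK.
  have := CP N; have := N1P _ (leqnn _) N; rewrite expr1n.
  rewrite (_ : sqsum (fun n => u N1 n - l n) N = sqsum (fun n => l n - u N1 n) N).
    lra.
  by apply: eq_bigr => k _; rewrite rnormBC.
exists (L2 lS) => e e0; have e2 : 0 < e / 2 by rewrite divr_gt0.
have [N NP] := close _ e2; exists N => k /NP h.
apply: le_lt_trans (_ : e / 2 < e); last lra.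
by apply: l2_norm_le; [exact: ltW | exact: h].
Qed.

End L2Complete.

HB.instance Definition _ (R : realType) (H : hilbertType R) :=
  Uniform_isComplete.Build (l2 H) (@l2_complete R H).

Section L2Hilbert.
Context {R : realType} {H : hilbertType R}.

Lemma l2_single_subproof n (h : H) : (fun k => if k == n then h else 0) \in @l2_pred R H.
Proof.
apply/asboolP/square_summableP; exists (rnorm h ^+ 2) => N.
rewrite /sqsum; have [nN|Nn] := ltnP n N.
  rewrite (bigD1_seq n) ?mem_index_iota ?iota_uniq//= eqxx big1 ?addr0// => i /negPf ->.
  by rewrite rnorm0 expr0n.
rewrite big_nat_cond big1 ?sqr_ge0// => i /andP[/andP[_ iN] _].
by rewrite (ltn_eqF (leq_trans iN Nn)) rnorm0 expr0n.
Qed.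

Definition l2_single n (h : H) : l2 H := L2 (l2_single_subproof n h).

Lemma l2_inner_norm (x : l2 H) : l2_inner x x = `|x| ^+ 2.
Proof.
rewrite -[`|x|]/((Num.sqrt (complex.Re (l2_inner x x)))%:C)%C -rmorphXn sqr_sqrtr.
  exact: (sform_xx l2_inner_ge0).
exact: (sform_Re_ge0 l2_inner_ge0).
Qed.

Lemma l2_nonzero : exists x : l2 H, x != 0.
Proof.
have [v v0] := @hilbert_nonzero R H; exists (l2_single 0 v).
by apply: contra_neq v0 => /(congr1 (fun x : l2 H => x 0%N)).
Qed.

End L2Hilbert.

HB.instance Definition _ (R : realType) (H : hilbertType R) :=
  isHilbert.Build R (l2 H) (@l2_inner_linear R H) (@l2_inner_conj R H)
    (@l2_inner_norm R H) (@l2_nonzero R H).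

(** * Amplification to l2 *)

Section Amplification.
Context {R : realType}.
Implicit Types H K L : hilbertType R.

Lemma l2_finite_support H (x : nat -> H) M :
  (forall n, (M <= n)%N -> x n = 0) -> x \in @l2_pred R H.
Proof.
move=> xM; apply/asboolP/square_summableP; exists (sqsum x M) => N.
have [NM|/ltnW MN] := leqP N M; first exact: sqsum_le.
rewrite -(subnK MN); elim: (N - M)%N => [//|k IH].
by rewrite addSn sqsumS xM ?leq_addl// rnorm0 expr0n addr0.
Qed.

Lemma l2_innerE H (x y : l2 H) : inner x y = l2_inner x y.
Proof. by []. Qed.

Lemma l2_rnorm_le H (x : l2 H) (C : R) :
  0 <= C -> (forall N, sqsum x N <= C ^+ 2) -> rnorm x <= C.
Proof. exact: l2_norm_le. Qed.

Lemma sqsum_rnorm H (x : l2 H) N : sqsum x N <= rnorm x ^+ 2.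
Proof. exact: sqsum_le_norm. Qed.

Lemma rnorm_coord H (x : l2 H) n : rnorm (x n) <= rnorm x.
Proof. exact: l2_coord_norm. Qed.

Lemma inner_single H n (h : H) (x : l2 H) : inner (l2_single n h) x = inner h (x n).
Proof.
rewrite l2_innerE; apply: ccvg_uniq (l2_inner_cvg _ _) _ => e e0.
exists n.+1 => N nN; rewrite /series /= (bigD1_seq n) ?mem_index_iota ?iota_uniq//= eqxx.
rewrite big1 ?addr0 ?subrr ?Normc.normc0// => i /negPf ->.
by rewrite inner0l.
Qed.

Lemma l2_single_same H n (h : H) : l2_single n h n = h.
Proof. by rewrite /= eqxx. Qed.

Lemma rnorm_single H n (h : H) : rnorm (l2_single n h) = rnorm h.
Proof. by apply: rnorm_eq; rewrite inner_single l2_single_same.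
Qed.

Lemma emb_ex H n : exists J : bop H (l2 H), forall h, J h = l2_single n h.
Proof.
have [|h|J JE _] := @mk_bop R H (l2 H) (l2_single n) 1.
- move=> a x y; apply: l2_ext => k; rewrite l2DE l2ZE /=.
  by case: eqP; rewrite ?scaler0 ?addr0.
- by rewrite mul1r rnorm_single.
- by exists J => h; rewrite JE.
Qed.

(** The isometry of [H] onto the [n]-th summand; its adjoint is the [n]-th coordinate. *)
Definition emb H n : bop H (l2 H) := sval (cid (emb_ex H n)).

Lemma embE H n (h : H) : emb H n h = l2_single n h.
Proof. exact: svalP (cid (emb_ex H n)) h. Qed.

Lemma inner_emb H n (h : H) (x : l2 H) : inner (emb H n h) x = inner h (x n).
Proof. by rewrite embE inner_single. Qed.

Lemma adj_emb H n (x : l2 H) : adj (emb H n) x = x n.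
Proof. by apply: inner_inj => h; rewrite -innerA inner_emb. Qed.

Lemma emb_coord H n m (h : H) : emb H n h m = if m == n then h else 0.
Proof. by rewrite embE. Qed.

(** The coordinates of [adj S x] are determined by the vectors [S (emb H n h)]. *)
Lemma l2_bop_ext H K (S T : bop (l2 H) K) :
  (forall n h, S (emb H n h) = T (emb H n h)) -> S = T.
Proof.
move=> ST; rewrite -[S]adjK -[T]adjK; congr adj.
apply: bopP => y; apply: l2_ext => n; apply: inner_inj => h.
by rewrite -!inner_emb -!innerA ST.
Qed.

Lemma amp_ex H K (T : bop H K) : exists A : bop (l2 H) (l2 K),
  forall x n, A x n = T (x n).
Proof.
have [c c0 Tc] := bop_rbound T.
have sq (x : l2 H) N : sqsum (T \o x) N <= (c * rnorm x) ^+ 2.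
  rewrite exprMn; apply: le_trans (ler_wpM2l (sqr_ge0 c) (sqsum_rnorm x N)).
  rewrite /sqsum mulr_sumr; apply: ler_sum => k _.
  by rewrite -exprMn ler_sqr ?nnegrE ?mulr_ge0 ?rnorm_ge0//; exact: Tc.
have Tl2 (x : l2 H) : T \o x \in @l2_pred R K.
  by apply/asboolP/square_summableP; exists ((c * rnorm x) ^+ 2); exact: sq.
have [||A AE _] := @mk_bop R (l2 H) (l2 K) (fun x => L2 (Tl2 x)) c.
- by move=> a x y; apply: l2_ext => n /=; rewrite bop_linear.
- move=> x; apply: l2_rnorm_le; first by rewrite mulr_ge0// rnorm_ge0.
  exact: sq.
- by exists A => x n; rewrite AE.
Qed.

(** [T] acting on each coordinate, that is, [T] tensored with the identity of l2. *)
Definition amp H K (T : bop H K) : bop (l2 H) (l2 K) := sval (cid (amp_ex T)).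

Lemma ampE H K (T : bop H K) (x : l2 H) n : amp T x n = T (x n).
Proof. exact: svalP (cid (amp_ex T)) x n. Qed.

Lemma amp_emb H K (T : bop H K) n h : amp T (emb H n h) = emb K n (T h).
Proof.
by apply: l2_ext => m; rewrite ampE !emb_coord; case: eqP; rewrite ?bop0r.
Qed.

Lemma amp_comp H K L (S : bop K L) (T : bop H K) :
  amp (bcomp S T) = bcomp (amp S) (amp T).
Proof. by apply: bopP => x; apply: l2_ext => n /=; rewrite !ampE. Qed.

Lemma amp_linear H K c (S T : bop H K) : amp (c *: S + T) = c *: amp S + amp T.
Proof.
apply: bopP => x; apply: l2_ext => n; rewrite ampE bopDE bopZE.
by rewrite [in RHS]bopDE [in RHS]bopZE l2DE l2ZE !ampE.
Qed.

Lemma amp_adj H K (T : bop H K) : amp (adj T) = adj (amp T).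
Proof.
apply: adj_unique => x y; rewrite !l2_innerE /l2_inner.
by under eq_fun do rewrite ampE adjE -ampE.
Qed.

Lemma amp1 H : amp (1 : bop H H) = 1.
Proof. by apply: bopP => x; apply: l2_ext => n; rewrite ampE. Qed.

Lemma ampM H (S T : bop H H) : amp (S * T) = amp S * amp T.
Proof. exact: amp_comp. Qed.

Lemma ampB H K (S T : bop H K) x : amp (S - T) x = amp S x - amp T x.
Proof. by apply: l2_ext => n; rewrite ampE l2DE l2NE !ampE. Qed.

Lemma amp_star_subalg H (S : set (bop H H)) :
  star_subalg S -> star_subalg [set amp b | b in S].
Proof.
move=> [S1 SL SM Sstar]; split.
- by exists 1 => //; rewrite amp1.
- move=> c _ _ [a Sa <-] [b Sb <-]; exists (c *: a + b); first exact: SL.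
  by rewrite amp_linear.
- move=> _ _ [a Sa <-] [b Sb <-]; exists (a * b); first exact: SM.
  by rewrite ampM.
- by move=> _ [a Sa <-]; exists (star a); [exact: Sstar | rewrite /star /= amp_adj].
Qed.

(** An operator commutes with the amplification of [S] when its matrix entries commute
    with [S]. *)
Lemma amp_bicommutant H (S : set (bop H H)) X :
  bicommutant S X -> bicommutant [set amp b | b in S] (amp X).
Proof.
move=> SX Y SY; pose Ymn m n := bcomp (adj (emb H m)) (bcomp Y (emb H n)).
have YS m n : commutant S (Ymn m n).
  move=> b Sb; apply: bopP => h; rewrite !bopME /= !adj_emb.
  have Yb : Y * amp b = amp b * Y by apply: SY; exists b.
  have := congr1 (fun T : bop (l2 H) (l2 H) => T (emb H n h) m) Yb.
  by rewrite !bopME amp_emb ampE.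
apply: l2_bop_ext => n h; apply: l2_ext => m.
rewrite !bopME ampE amp_emb.
have := congr1 (fun T : bop H H => T h) (SX _ (YS m n)).
by rewrite !bopME /= !adj_emb.
Qed.

End Amplification.

(** * The sigma-weak topology *)

Section SigmaWeak.
Context {R : realType}.
Implicit Types H K : hilbertType R.

Lemma l2_of H (x : nat -> H) : square_summable x -> exists y : l2 H, l2f y = x.
Proof. by move=> /asboolP xs; exists (L2 xs). Qed.

Lemma sigma_formE H (x y : l2 H) T : sigma_form x y T = inner x (amp T y).
Proof.
rewrite l2_innerE /l2_inner /sigma_form.
by under [in RHS]eq_fun do rewrite ampE.
Qed.

Lemma l2_square_summable H (x : l2 H) : square_summable x.
Proof. by case: x => f /= /asboolP. Qed.

Lemma cvg_functional_eq H (F : set_system (bop H H)) (w w' : bop H H -> R[i]) l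
    (M : set (bop H H)) : ProperFilter F -> F M -> (forall T, M T -> w T = w' T) ->
  (w' : _ -> R[i]^o) @ F --> (l : R[i]^o) -> (w : _ -> R[i]^o) @ F --> (l : R[i]^o).
Proof.
move=> FF FM ww wl A /wl; rewrite /= => FA; rewrite /nbhs /=.
have FMA : F (M `&` w' @^-1` A) by exact: filterI.
by apply: filterS FMA => T [MT]; rewrite /= ww.
Qed.

Lemma sigma_form_normal H (M : set (bop H H)) (w : bop H H -> R[i]) (x y : l2 H) :
  (forall T, M T -> w T = inner x (amp T y)) -> normal_functional M w.
Proof.
move=> wE F T FF FM MT FT.
rewrite [w T]wE// -sigma_formE.
apply: (@cvg_functional_eq H F w (sigma_form x y) _ M) => //.
  by move=> S MS; rewrite wE// sigma_formE.
apply: FT; exact: l2_square_summable.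
Qed.

Lemma normal_map_functional H K (M : set (bop H H)) (f : bop H H -> bop K K) :
  (forall x y : l2 K, normal_functional M (fun T => inner x (amp (f T) y))) ->
  normal_map M f.
Proof.
move=> fn F T FF FM MT FT x y /l2_of[x' <-] /l2_of[y' <-].
have := fn x' y' F T FF FM MT FT.
rewrite (_ : (fun T => inner x' (amp (f T) y')) = sigma_form x' y' \o f); last first.
  by apply/funext => S; rewrite /= sigma_formE.
by rewrite -sigma_formE.
Qed.

Lemma vector_state_normal H (M : set (bop H H)) (x : H) :
  normal_functional M (vector_state x).
Proof.
apply: (@sigma_form_normal _ _ _ (emb H 0 x) (emb H 0 x)) => T _.
by rewrite amp_emb inner_emb emb_coord.
Qed.

(** [X] compressed to [H] along [Z]; for an isometry [Z] this is the corner of [X] on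
    the range of [Z]. *)
Definition compress H K (Z : bop H K) (X : bop K K) : bop H H :=
  bcomp (adj Z) (bcomp X Z).

Lemma normal_map_compress H K (M : set (bop H H)) (f : bop H H -> bop K K)
    (Z : bop K H) :
  (forall T, M T -> f T = compress Z T) -> normal_map M f.
Proof.
move=> fE; apply: normal_map_functional => x y.
apply: (@sigma_form_normal _ _ _ (amp Z x) (amp Z y)) => T MT.
by rewrite fE// /compress amp_comp amp_comp amp_adj /= -innerA.
Qed.

(** Finitely many square summable sequences form one vector of [l2 (l2 H)], to which the
    density argument for one vector applies. *)
Lemma bicommutant_dense H (S : set (bop H H)) X : star_subalg S -> bicommutant S X ->
  exists F : set_system (bop H H), [/\ ProperFilter F, F S & sigma_weak_cvg F X].
Proof.
move=> SS SX.
pose N (p : seq (l2 H) * R) := [set b | S b /\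
  forall i, (i < size p.1)%N -> rnorm (amp (b - X) (nth 0 p.1 i)) < p.2].
pose F := filter_from [set p : seq (l2 H) * R | 0 < p.2] N.
have FF : Filter F.
  apply: filter_from_filter; first by exists ([::], 1) => /=.
  move=> [ys e] [zs d] /= e0 d0; exists (ys ++ zs, Num.min e d).
    by rewrite /= lt_min e0.
  move=> b [Sb bP]; split; split=> // i ilt.
    have := bP i; rewrite /= size_cat ltn_addr// nth_cat ilt => /(_ isT).
    by rewrite lt_min => /andP[].
  have := bP (size ys + i)%N; rewrite /= size_cat ltn_add2l ilt nth_cat.
  rewrite ltnNge leq_addr /= addKn => /(_ isT).
  by rewrite lt_min => /andP[].
have FP : ProperFilter F.
  apply: filter_from_proper => // -[ys e] /= e0.
  have yl2 : nth 0 ys \in @l2_pred R (l2 H).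
    by apply: (@l2_finite_support _ _ _ (size ys)) => n; exact: nth_default.
  have [|_ [_ [_ [b Sb <-] <-] <-] be] := bicommutant_adherent (L2 yl2)
      (amp_star_subalg (amp_star_subalg SS)) (amp_bicommutant (amp_bicommutant SX)) (e := e).
    exact: e0.
  exists b; split=> // i _; apply: le_lt_trans be.
  rewrite -ampB; apply: le_trans (rnorm_coord _ i).
  by rewrite ampE bopDE bopNE -ampB.
exists F; split; [exact: FP | |].
  by exists ([::], 1); [exact: ltr01 | move=> b []].
move=> x y /l2_of[x' <-] /l2_of[y' <-]; apply/cvgrPdist_lt => e e0.
have eE : e = ((complex.Re e)%:C)%C by rewrite RRe_real// gtr0_real.
have re0 : 0 < complex.Re e by rewrite -ltcR -eE.
have x1 : 0 < rnorm x' + 1 by have := rnorm_ge0 x'; lra.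
exists ([:: y'], complex.Re e / (rnorm x' + 1)); first by rewrite /= divr_gt0.
move=> b [_ /(_ 0%N isT)] /=; rewrite ltr_pdivlMr// => h.
rewrite !sigma_formE eE -[`|_|]/((Normc.normc _)%:C)%C ltcR -innerBr -ampB.
apply: le_lt_trans (inner_le _ _) _.
have -> : rnorm (amp (X - b) y') = rnorm (amp (b - X) y').
  by rewrite !ampB rnormBC.
have := rnorm_ge0 x'; have := rnorm_ge0 (amp (b - X) y'); nra.
Qed.

Lemma normal_maps_agree H K (S : set (bop H H)) (f g : bop H H -> bop K K) :
  star_subalg S -> normal_map (bicommutant S) f -> normal_map (bicommutant S) g ->
  (forall T, S T -> f T = g T) -> forall T, bicommutant S T -> f T = g T.
Proof.
move=> SS fn gn fg T ST; have [F [FF FS FT]] := bicommutant_dense SS ST.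
have FM : F (bicommutant S) by apply: filterS FS; exact: sub_bicommutant.
apply: bopP => k; apply: inner_inj => h.
have sE (f' : bop H H -> bop K K) A :
    sigma_form (emb K 0 h) (emb K 0 k) (f' A) = inner h (f' A k).
  by rewrite sigma_formE amp_emb inner_emb emb_coord.
have sum v := @l2_square_summable K (emb K 0 v).
have cf := fn F T FF FM ST FT _ _ (sum h) (sum k).
have cg := gn F T FF FM ST FT _ _ (sum h) (sum k).
rewrite -!sE; apply: (@cvg_unique R[i]^o _ (sigma_form (emb K 0 h) (emb K 0 k) @ (f @ F))).
- exact: norm_hausdorff.
- exact: cf.
- apply: (@cvg_functional_eq H F (sigma_form (emb K 0 h) (emb K 0 k) \o f)
    (sigma_form (emb K 0 h) (emb K 0 k) \o g) _ S) => //.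
  by move=> A SA /=; rewrite fg.
Qed.

End SigmaWeak.

(** * Complete positivity *)

Section Positivity.
Context {R : realType}.
Implicit Types H K : hilbertType R.

Lemma star_subalg0 (A : starAlgType R) (M : set A) : star_subalg M -> M 0.
Proof. by move=> [M1 ML _ _]; have := ML (-1) 1 1 M1 M1; rewrite scaleN1r addNr. Qed.

Lemma star_subalgD (A : starAlgType R) (M : set A) x y :
  star_subalg M -> M x -> M y -> M (x + y).
Proof. by move=> [_ ML _ _] Mx My; rewrite -[x]scale1r; exact: ML. Qed.

Lemma star_subalg_sum (A : starAlgType R) (M : set A) n (F : 'I_n -> A) :
  star_subalg M -> (forall i, M (F i)) -> M (\sum_i F i).
Proof.
move=> SM MF; elim/big_ind: _ => //; first exact: star_subalg0.
by move=> x y; exact: star_subalgD.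
Qed.

Lemma linear_on_sum (A B : starAlgType R) (M : set A) (f : A -> B) n (F : 'I_n -> A) :
  star_subalg M -> linear_on M f -> (forall i, M (F i)) ->
  f (\sum_i F i) = \sum_i f (F i).
Proof.
move=> SM fl MF.
have f0 : f 0 = 0.
  have := fl (-1) 0 0 (star_subalg0 SM) (star_subalg0 SM).
  by rewrite scaler0 addr0 scaleN1r addNr.
suff [] : M (\sum_i F i) /\ f (\sum_i F i) = \sum_i f (F i) by [].
elim/big_rec2: _ => [|i y z _ [Mz fz]]; first by split=> //; exact: star_subalg0.
split; first exact: star_subalgD.
by have := fl 1 _ _ (MF i) Mz; rewrite !scale1r fz.
Qed.

Lemma star_hom_ucp (A B : starAlgType R) (M : set A) (N : set B) (f : A -> B) :
  star_subalg M -> star_hom M N f -> ucp M N f.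
Proof.
move=> SM [fN fl f1 fM fstar]; split=> // n X [Y YM XE].
have [_ _ MM Mstar] := SM.
exists (map_mx f Y); first by move=> i j; rewrite mxE; exact: fN.
rewrite XE; apply/matrixP => i j; rewrite !mxE (linear_on_sum SM fl); last first.
  by move=> k; rewrite !mxE; apply: MM => //; exact: Mstar.
by apply: eq_bigr => k _; rewrite !mxE fM ?fstar//; exact: Mstar.
Qed.

Lemma bop_sumE H K n (F : 'I_n -> bop H K) x : (\sum_i F i) x = \sum_i F i x.
Proof. by elim/big_rec2: _ => [//|i y z _ <-]; rewrite bopDE. Qed.

Lemma inner_sumr H n (x : H) (y : 'I_n -> H) : inner x (\sum_i y i) = \sum_i inner x (y i).
Proof. by elim/big_rec2: _ => [|i u v _ <-]; rewrite ?inner0r ?innerDr. Qed.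

Lemma inner_suml H n (x : 'I_n -> H) (y : H) : inner (\sum_i x i) y = \sum_i inner (x i) y.
Proof. by elim/big_rec2: _ => [|i u v _ <-]; rewrite ?inner0l ?innerDl. Qed.

Lemma l2_sumE H n (x : 'I_n -> l2 H) m : (\sum_i x i) m = \sum_i x i m.
Proof. by elim/big_rec2: _ => [//|i u v _ <-]; rewrite l2DE. Qed.

Lemma sum_emb_coord H n (x : 'I_n -> H) (i : 'I_n) : (\sum_(k < n) emb H k (x k)) i = x i.
Proof.
rewrite l2_sumE (bigD1 i)//= emb_coord eqxx big1 ?addr0// => k ki.
by rewrite emb_coord eq_sym (inj_eq val_inj) (negPf ki).
Qed.

(** A matrix [X = Y^* Y] compresses to the matrix of an operator [C^* C] on [l2 H]. Its
    square root commutes with whatever commutes with the entries, and with the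
    projection onto the first [n] summands; so the entries of the root factorise the
    compressed matrix. *)
Lemma compress_mx_pos H K (Z : bop H K) (N : set (bop H H)) (Mh : set (bop K K)) n
    (X : 'M[bop K K]_n) :
  star_subalg Mh -> (forall T, Mh T -> commutant N (compress Z T)) ->
  mx_pos Mh X -> mx_pos (commutant N) (map_mx (compress Z) X).
Proof.
move=> SM MhN [Y YM XE].
pose C : bop (l2 H) (l2 K) := \sum_(k < n) \sum_(j < n)
  bcomp (emb K k) (bcomp (bcomp (Y k j) Z) (adj (emb H j))).
have CE (j : nat) h : C (emb H j h) = if insub j is Some j' then
    \sum_(k < n) emb K k (Y k j' (Z h)) else 0.
  rewrite bop_sumE; case: insubP => [j' _ j'E|jn].
    apply: eq_bigr => k _; rewrite bop_sumE (bigD1 j')//= big1 ?addr0 => [|l lj].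
      by rewrite adj_emb emb_coord j'E eqxx.
    rewrite adj_emb emb_coord -j'E (inj_eq val_inj) (negPf lj).
    by rewrite !bop0r.
  rewrite big1// => k _; rewrite bop_sumE big1// => l _ /=.
  rewrite adj_emb emb_coord (_ : (l == j :> nat) = false) ?bop0r//.
  by apply: contraNF jn => /eqP <-; exact: ltn_ord.
have XijE i j : X i j = \sum_k star (Y k i) * Y k j.
  by rewrite XE mxE; apply: eq_bigr => k _; rewrite !mxE.
have MX i j : Mh (X i j).
  rewrite XijE; apply: star_subalg_sum => // k; have [_ _ MM Mstar] := SM.
  by apply: MM => //; exact: Mstar.
pose T := bcomp (adj C) C.
have TE (i j : 'I_n) h : T (emb H j h) i = compress Z (X i j) h.
  apply: inner_inj => g; rewrite -inner_emb /T /= -innerA !CE !valK.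
  rewrite inner_suml -innerA XijE bop_sumE inner_sumr.
  by apply: eq_bigr => k _; rewrite inner_emb sum_emb_coord bopME -innerA.
have T0 i j h : (n <= i)%N || (n <= j)%N -> T (emb H j h) i = 0.
  have C0 k v : (n <= k)%N -> C (emb H k v) = 0.
    by move=> nk; rewrite CE insubF// ltnNge nk.
  move=> ij; apply: inner_inj => g; rewrite -inner_emb /T /= -innerA inner0r.
  by case/orP: ij => ij; rewrite (C0 _ _ ij) ?inner0l ?inner0r.
have [W [Wstar WW Wcomm]] := bop_sqrt C.
have ampW A : N A -> amp A * W = W * amp A.
  move=> NA; apply: Wcomm; rewrite -/T; apply: l2_bop_ext => j h; apply: l2_ext => i.
  rewrite !bopME ampE amp_emb.
  have [ni|lin] := leqP n i; first by rewrite !T0 ?bop0r ?ni.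
  have [nj|ljn] := leqP n j; first by rewrite !T0 ?bop0r ?nj ?orbT.
  rewrite (TE (Ordinal lin) (Ordinal ljn)) (TE (Ordinal lin) (Ordinal ljn)).
  have := congr1 (fun S : bop H H => S h) (MhN _ (MX (Ordinal lin) (Ordinal ljn)) _ NA).
  by rewrite !bopME => ->.
pose P : bop (l2 H) (l2 H) := \sum_(k < n) bcomp (emb H k) (adj (emb H k)).
have PE j h : P (emb H j h) = if (j < n)%N then emb H j h else 0.
  rewrite bop_sumE; case: ltnP => [jn|nj].
    rewrite (bigD1 (Ordinal jn))//= big1 ?addr0 => [|k kj].
      by rewrite adj_emb emb_coord eqxx.
    rewrite adj_emb emb_coord (_ : (k == j :> nat) = false) ?bop0r//.
    by apply: contraNF kj => /eqP kj; apply/eqP/val_inj.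
  rewrite big1// => k _ /=; rewrite adj_emb emb_coord.
  by rewrite (ltn_eqF (leq_trans (ltn_ord k) nj)) bop0r.
have TP : T * P = T.
  apply: l2_bop_ext => j h; rewrite bopME PE; case: ltnP => // nj.
  by apply: l2_ext => i; rewrite T0 ?nj ?orbT// bop0r.
have Pstar : star P = P.
  apply/esym/adj_unique => x y; rewrite !bop_sumE inner_suml inner_sumr.
  by apply: eq_bigr => k _ /=; rewrite innerA adjE.
have Tstar : star T = T by rewrite /star /= /T adj_comp adjK.
have PT : P * T = T by have := congr1 star TP; rewrite star_bopM Pstar Tstar.
have PW : P * W = W * P by apply: Wcomm; rewrite -/T PT TP.
exists (\matrix_(i, j) bcomp (adj (emb H i)) (bcomp W (emb H j))).
  move=> i j A NA; rewrite mxE; apply: bopP => h.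
  rewrite !bopME /= !adj_emb.
  have := congr1 (fun S : bop (l2 H) (l2 H) => S (emb H j h) i) (ampW A NA).
  by rewrite !bopME ampE amp_emb.
apply/matrixP => i j; rewrite !mxE; apply: bopP => h.
rewrite -[LHS]/(compress Z (X i j) h) -TE bop_sumE.
have -> : T = W * P * W by rewrite -PW -mulrA WW -/T PT.
rewrite !bopME bop_sumE bop_sum l2_sumE; apply: eq_bigr => k _.
rewrite !mxE bopME /star /= !adj_comp adjK /= !adj_emb.
by rewrite -[adj W]/(star W) Wstar.
Qed.

Lemma compress_ucp H K (Z : bop H K) (N : set (bop H H)) (Mh : set (bop K K)) :
  Defs.isometry Z -> star_subalg Mh ->
  (forall T, Mh T -> commutant N (compress Z T)) ->
  ucp Mh (commutant N) (compress Z).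
Proof.
move=> Zi SM MhN; split=> //.
- by move=> c S T _ _; apply: bopP => x /=; rewrite bopD bopZ.
- by apply: bopP => x; rewrite -[RHS]/((1 : bop H H) x) -(adj_isometry Zi).
- by move=> n X; exact: compress_mx_pos.
Qed.

End Positivity.

(** * Cyclic and separating vectors *)

Section Separating.
Context {R : realType}.
Implicit Types H K : hilbertType R.

Lemma commutant_separating H (S : set (bop H H)) (x : H) :
  (forall y, adherent [set T x | T in commutant S] y) ->
  forall X Y, bicommutant S X -> bicommutant S Y -> X x = Y x -> X = Y.
Proof.
move=> dens X Y MX MY XY; apply: (bop_eq_adherent dens) => _ [T ST <-].
by rewrite -!bopME MX// MY// !bopME XY.
Qed.

Lemma adherent_inner_inj H (D : set H) x y : (forall z, adherent D z) ->
  (forall z, D z -> inner z x = inner z y) -> x = y.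
Proof.
move=> Dz xy; apply/eqP; rewrite -subr_eq0; apply/eqP/(adherent_orth0 (Dz _)).
by move=> z Dz'; rewrite inner_conj innerBr xy// subrr conjc0.
Qed.

Lemma adherent_of_orth H (L : lmodType R[i]) (D : set L) (al : L -> H) :
  D !=set0 -> (forall a x y, D x -> D y -> D (a *: x + y)) ->
  (forall a x y, D x -> D y -> al (a *: x + y) = a *: al x + al y) ->
  (forall z, (forall x, D x -> inner z (al x) = 0) -> z = 0) ->
  forall y, adherent [set al x | x in D] y.
Proof.
move=> D0 DL all orth y; have [P PP] := projection D0 DL all.
have -> : y = P y by apply/eqP; rewrite -subr_eq0; apply/eqP/orth; exact: (PP y).2.
exact: (PP y).1.
Qed.

(** The vector is [(C^* C)^(1/2) Om], since the root commutes with [A]. The case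
    [A = 1] shows that [z] has the norm of [C Om], however large the norm of [C] is. *)
Lemma commutant_vector H K (S : set (bop H H)) (Om : H) (C : bop H K) :
  commutant S (bcomp (adj C) C) ->
  exists z, forall A, bicommutant S A -> rnorm (C (A Om)) = rnorm (A z).
Proof.
move=> SC; have [W [Wstar WW Wcomm]] := bop_sqrt C.
exists (W Om) => A MA; apply: rnorm_eq.
have AW : A * W = W * A by apply: Wcomm; exact: MA.
rewrite -[A (W Om)]/((A * W) Om) AW bopME innerA.
rewrite [RHS]innerA -[adj W]/(star W) Wstar.
by rewrite -[W (W _)]/((W * W) _) WW.
Qed.

End Separating.

(** * Unital completely positive maps of a C*-algebra *)

Section AdjointMap.
Context {R : realType} {A : cstarType R}.

Lemma star_cstar1 : star (1 : A) = 1.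
Proof.
by have := starM (star (1 : A)) 1; rewrite mulr1 starK mulr1.
Qed.

Lemma starD (a b : A) : star (a + b) = star a + star b.
Proof. by have := star_semilinear 1 a b; rewrite rmorph1 !scale1r. Qed.

Lemma starZ c (a : A) : star (c *: a) = conjc c *: star a.
Proof.
have s0 : star (0 : A) = 0.
  by have := star_semilinear (-1) (0 : A) 0; rewrite rmorphN rmorph1 !scaleN1r !addNr.
by have := star_semilinear c a 0; rewrite s0 !addr0.
Qed.

Variable (f : A -> A).
Hypothesis f_ucp : ucp setT setT f.

Lemma ucp_linear c a b : f (c *: a + b) = c *: f a + f b.
Proof. by case: f_ucp => _ fl _ _; exact: fl. Qed.

Lemma ucp_positive a : exists b, f (star a * a) = star b * b.
Proof.
have [_ _ _ fpos] := f_ucp.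
have [|Y _ YE] := fpos 1%N (\matrix_(i, j) (star a * a)).
  exists (\matrix_(i, j) a) => //.
  by apply/matrixP => i j; rewrite !mxE big_ord_recl big_ord0 addr0 !mxE.
exists (Y ord0 ord0); have := congr1 (fun X : 'M[A]_1 => X ord0 ord0) YE.
by rewrite !mxE big_ord_recl big_ord0 addr0 !mxE.
Qed.

(** Polarisation: [a + star a] and ['i (star a - a)] are combinations of positives. *)
Lemma ucp_hermitian a : f (star a) = star (f a).
Proof.
have f0 : f 0 = 0.
  by have := ucp_linear (-1) 0 0; rewrite scaler0 addr0 scaleN1r addNr.
have fD u v : f (u + v) = f u + f v.
  by have := ucp_linear 1 u v; rewrite !scale1r.
have fZ c u : f (c *: u) = c *: f u by have := ucp_linear c u 0; rewrite f0 !addr0.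
have f1 : f 1 = 1 by case: f_ucp.
have sa c : star (f (star (a + c%:A) * (a + c%:A))) = f (star (a + c%:A) * (a + c%:A)).
  by have [b ->] := ucp_positive (a + c%:A); rewrite starM starK.
have expand c : f (star (a + c%:A) * (a + c%:A)) =
    f (star a * a) + c *: f (star a) + conjc c *: f a + (c * conjc c)%:A.
  rewrite starD starZ star_cstar1 mulrDl !mulrDr -!scalerAl -!scalerAr !mul1r mulr1.
  by rewrite scalerA !fD !fZ f1 !addrA [conjc c * c]mulrC.
have := sa 0; rewrite expand conjc0 !scale0r mulr0 scale0r !addr0 => sa0.
have key c : star (c *: f (star a) + conjc c *: f a) = c *: f (star a) + conjc c *: f a.
  have := sa c; rewrite expand -addrA -addrA starD sa0 => /addrI.
  rewrite addrA starD starZ star_cstar1 => h.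
  have cc : conjc (c * conjc c) = c * conjc c by rewrite rmorphM /= conjcK mulrC.
  by move: h; rewrite cc => /addIr.
have := key 1; have := key ('i%C).
rewrite !starD !starZ !rmorph1 !scale1r !conjcK.
have -> : conjc 'i%C = - 'i%C :> R[i] by apply/eqP; rewrite eq_complex /= oppr0 !eqxx.
move=> h1 h2.
have h3 : star (f (star a)) + star (f a) + (star (f a) - star (f (star a))) =
    f (star a) + f a + (f (star a) - f a).
  rewrite h2; congr (_ + _).
  have i0 : 'i%C != 0 :> R[i] by rewrite eq_complex /= oner_eq0 andbF.
  apply: (scalerI i0); rewrite !scalerBr [LHS]addrC.
  by move: h1; rewrite !scaleNr.
have h4 : 2 *: star (f a) = 2 *: f (star a).
  rewrite -[2]/(1 + 1 : R[i]) !scalerDl !scale1r.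
  move: h3; rewrite [star (f (star a)) + _]addrC addrACA subrr addr0 => ->.
  by rewrite addrACA subrr addr0.
by apply/esym/(scalerI _ h4); rewrite pnatr_eq0.
Qed.

End AdjointMap.

(** * The data of the theorem *)

Section Dilation.
Variables (R : realType) (A : cstarType R) (Phi : A -> A) (phi : A -> R[i]).
Variables (H : hilbertType R) (pi : A -> bop H H) (Om : H) (U : bop H H).
Variables (K : hilbertType R) (pi_oo : A -> bop K K) (Om_oo : K) (V : bop K K).
Variables (Z0 : bop H K) (Phib : bop H H -> bop H H) (Phis : A -> A).
Hypothesis cstar_sys : cstar_system Phi phi.
Hypothesis Phi_hom : star_hom setT setT Phi.
Hypothesis pi_gns : gns phi pi Om.
Hypothesis U_contraction : gns_contraction Phi pi Om U.
Hypothesis Om_cyclic' : cyclic_vector (commutant (range pi)) Om.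
Hypothesis Phib_assoc : associated_map (bicommutant (range pi)) Om U Phib.
Hypothesis pi_oo_cgns : cgns Phi phi pi Om U pi_oo Om_oo V Z0.
Hypothesis Phis_adjoint : phi_adjoint Phi phi Phis.

Local Notation M := (bicommutant (range pi)).
Local Notation B := (star_alg (translates pi_oo V)).
Local Notation Mh := (bicommutant B).

Let piM a b : pi (a * b) = pi a * pi b.
Proof. by have [[_ _ _ h _] _ _] := pi_gns; exact: h. Qed.
Let pi1 : pi 1 = 1.
Proof. by have [[_ _ h _ _] _ _] := pi_gns. Qed.
Let pi_star a : pi (star a) = star (pi a).
Proof. by have [[_ _ _ _ h] _ _] := pi_gns; exact: h. Qed.
Let phiE a : phi a = inner Om (pi a Om).
Proof. by have [_ _ h] := pi_gns. Qed.

Let PhiM a b : Phi (a * b) = Phi a * Phi b.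
Proof. by have [_ _ _ h _] := Phi_hom; exact: h. Qed.
Let Phi1 : Phi 1 = 1.
Proof. by have [_ _ h _ _] := Phi_hom. Qed.
Let Phi_star a : Phi (star a) = star (Phi a).
Proof. by have [_ _ _ _ h] := Phi_hom; exact: h. Qed.
Let phi_Phi a : phi (Phi a) = phi a.
Proof. by have [_ _ h] := cstar_sys. Qed.

Let pi_ooM a b : pi_oo (a * b) = pi_oo a * pi_oo b.
Proof. by have [[[_ _ _ h _] _ _] _ _ _ _] := pi_oo_cgns; exact: h. Qed.
Let pi_oo1 : pi_oo 1 = 1.
Proof. by have [[[_ _ h _ _] _ _] _ _ _ _] := pi_oo_cgns. Qed.
Let pi_oo_star a : pi_oo (star a) = star (pi_oo a).
Proof. by have [[[_ _ _ _ h] _ _] _ _ _ _] := pi_oo_cgns; exact: h. Qed.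
Let pi_oo_linear c a b : pi_oo (c *: a + b) = c *: pi_oo a + pi_oo b.
Proof. by have [[[_ h _ _ _] _ _] _ _ _ _] := pi_oo_cgns; exact: h. Qed.
Let V_isometry : Defs.isometry V.
Proof. by have [[_ h _] _ _ _ _] := pi_oo_cgns. Qed.
Let Z0_isometry : Defs.isometry Z0.
Proof. by have [[_ _ h] _ _ _ _] := pi_oo_cgns. Qed.
Let pi_oo_Z0 a x : pi_oo a (Z0 x) = Z0 (pi a x).
Proof.
have [_ [h _ _] _ _ _] := pi_oo_cgns.
by have := congr1 (fun T : bop H K => T x) (h a).
Qed.
Let Om_ooE : Om_oo = Z0 Om.
Proof. by have [_ [_ h _] _ _ _] := pi_oo_cgns. Qed.
Let adjU_pow n x : (star U ^+ n) x = adj Z0 ((V ^+ n) (Z0 x)).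
Proof. by have [_ [_ _ h] _ _ _] := pi_oo_cgns; rewrite h. Qed.
Let V_Om : V Om_oo = Om_oo.
Proof. by have [_ _ h _ _] := pi_oo_cgns. Qed.
Let B_dense y : adherent [set b Om_oo | b in B] y.
Proof. by have [_ _ _ h _] := pi_oo_cgns; exact: cyclic_adherent. Qed.
Let pi_oo_Phi a : pi_oo (Phi a) = star V * pi_oo a * V.
Proof. by have [_ _ _ _ [h _]] := pi_oo_cgns. Qed.

Let pi_dense y : adherent [set T Om | T in range pi] y.
Proof. by have [_ h _] := pi_gns; exact: cyclic_adherent. Qed.
Let commutant_dense y : adherent [set T Om | T in commutant (range pi)] y.
Proof. exact: cyclic_adherent. Qed.

Let range_pi_star x : range pi x -> range pi (star x).
Proof. by move=> [a _ <-]; exists (star a); rewrite ?pi_star. Qed.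

Let M_subalg : star_subalg M.
Proof. exact: bicommutant_star_subalg. Qed.

Let pi_M a : M (pi a).
Proof. by apply: sub_bicommutant; exists a. Qed.

(** * The contraction [U] and the adjoint map *)

Lemma pi_ext (L : hilbertType R) (S T : bop H L) :
  (forall a, S (pi a Om) = T (pi a Om)) -> S = T.
Proof. by move=> ST; apply: (bop_eq_adherent pi_dense) => _ [_ [a _ <-] <-]. Qed.

Lemma M_separating X Y : M X -> M Y -> X Om = Y Om -> X = Y.
Proof. exact: commutant_separating commutant_dense _ _. Qed.

Lemma pi_inner a b : inner (pi a Om) (pi b Om) = phi (star a * b).
Proof. by rewrite innerA -[adj _]/(star (pi a)) -pi_star phiE piM. Qed.

Lemma U_pi a : U (pi a Om) = pi (Phi a) Om.
Proof. by case: U_contraction. Qed.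

Lemma Ustar_U : star U * U = 1.
Proof.
apply: pi_ext => b; apply: (adherent_inner_inj pi_dense) => _ [_ [a _ <-] <-].
rewrite bopME -innerA !U_pi !pi_inner -Phi_star -PhiM phi_Phi.
by [].
Qed.

Lemma U_Om : U Om = Om.
Proof. by have := U_pi 1; rewrite Phi1 pi1. Qed.

Lemma Ustar_Om : star U Om = Om.
Proof. by rewrite -{1}U_Om -bopME Ustar_U. Qed.

Lemma Phis_ucp : ucp setT setT Phis. Proof. by case: Phis_adjoint. Qed.

Lemma Ustar_pi b : star U (pi b Om) = pi (Phis b) Om.
Proof.
apply: (adherent_inner_inj pi_dense) => _ [_ [a _ <-] <-].
rewrite -innerA U_pi !pi_inner -Phi_star.
by have [_ ->] := Phis_adjoint.
Qed.

(** [Phis (Phi c a) = c (Phis a)] in the representation, since [Om] is separating; the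
    right-handed version follows by taking adjoints. *)
Lemma Phis_module a b : pi (Phis (a * Phi b)) = pi (Phis a) * pi b.
Proof.
have left x y : pi (Phis (Phi x * y)) = pi x * pi (Phis y).
  rewrite -piM; apply: M_separating => //; apply: (adherent_inner_inj pi_dense).
  move=> _ [_ [z _ <-] <-]; rewrite !pi_inner mulrA.
  have [_ adjE] := Phis_adjoint.
  by rewrite !adjE mulrA PhiM Phi_star.
rewrite -[Phis _]starK -(ucp_hermitian Phis_ucp) starM pi_star -Phi_star left.
by rewrite star_bopM (ucp_hermitian Phis_ucp) -!pi_star !starK.
Qed.

Lemma compress_U_pi a : star U * pi a * U = pi (Phis a).
Proof.
apply: pi_ext => b.
by rewrite !bopME U_pi -(bopME (pi a)) -piM Ustar_pi Phis_module.
Qed.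

Lemma compress_U_pi_iter n a : star U ^+ n * pi a * U ^+ n = pi (iter n Phis a).
Proof.
elim: n => [|n IH]; first by rewrite !expr0 mul1r mulr1.
by rewrite exprS exprSr -compress_U_pi -IH !mulrA.
Qed.


(** * The algebra generated by the translates *)

Lemma Vstar_V : star V * V = 1.
Proof. exact: adj_isometry. Qed.

Lemma Vstar_V_pow n : star V ^+ n * V ^+ n = 1.
Proof.
elim: n => [|n IH]; first by rewrite !expr0 mul1r.
by rewrite exprSr exprS mulrA -(mulrA _ (star V)) Vstar_V mulr1.
Qed.

Definition range_proj := V * star V.
Local Notation P := range_proj.

Lemma star_range_proj : star P = P.
Proof. by rewrite /P star_bopM star_bopK. Qed.

Lemma range_projM : P * P = P.
Proof. by rewrite /P mulrA -(mulrA V) Vstar_V mulr1. Qed.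

(** Since [Phi] is multiplicative, [V^* x^* x V = V^* x^* P x V] for [x = pi_oo a], so
    [pi_oo a] leaves the range of [V] invariant. *)
Lemma range_proj_pi_oo a : P * pi_oo a = pi_oo a * P.
Proof.
have range b : P * (pi_oo b * V) = pi_oo b * V.
  apply: bopP => x; rewrite bopME; set w := (pi_oo b * V) x.
  apply/esym/eqP; rewrite -subr_eq0; apply/eqP/rnorm_eq0.
  have wP : inner w w = inner w (P w).
    have := congr1 (fun T : bop K K => inner x (T x)) (pi_oo_Phi (star b * b)).
    rewrite PhiM pi_ooM !pi_oo_Phi pi_ooM pi_oo_star => h.
    rewrite {1 3}/w innerA [RHS]innerA -[adj _]/(star (pi_oo b * V)) star_bopM.
    by rewrite /w -!bopME /P !mulrA; move: h; rewrite !mulrA => ->.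
  apply/eqP; rewrite -sqrf_eq0; apply/eqP/complexI; rewrite -inner_xx.
  have PPw : inner (P w) (P w) = inner w (P w).
    by rewrite innerA -[adj P]/(star P) star_range_proj -bopME range_projM.
  have Pww : inner (P w) w = inner w (P w).
    by rewrite innerA -[adj P]/(star P) star_range_proj.
  by rewrite innerBl !innerBr PPw Pww wP !subrr.
have inv b : P * pi_oo b * P = pi_oo b * P.
  have := congr1 (fun T => T * star V) (range b).
  by rewrite -!mulrA => h; exact: h.
have := congr1 star (inv (star a)).
rewrite (star_bopM (P * _)) (star_bopM P) (star_bopM (pi_oo _)) star_range_proj pi_oo_star.
by rewrite star_bopK mulrA inv => ->.
Qed.

Lemma star_alg_sub (G N : set (bop K K)) :
  star_subalg N -> G `<=` N -> star_alg G `<=` N.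
Proof. by move=> SN GN; exact: smallest_sub. Qed.

(** The projection [P] commutes with [B] and fixes its cyclic vector [Om_oo]. *)
Lemma V_Vstar : V * star V = 1.
Proof.
have BP b : B b -> b * P = P * b.
  move=> Bb; suff : commutant [set P] b by exact.
  move: b Bb; apply: star_alg_sub.
    by apply: commutant_star_subalg => _ ->; rewrite star_range_proj.
  move=> _ [[|n] [a ->]] _ ->; first by rewrite expr0 mul1r mulr1 range_proj_pi_oo.
  have PV : P * V = V by rewrite /P -mulrA Vstar_V mulr1.
  have VP : star V * P = star V by rewrite /P mulrA Vstar_V mul1r.
  have h1 : star V ^+ n.+1 * P = star V ^+ n.+1 by rewrite exprSr -mulrA VP.
  have h2 : P * V ^+ n.+1 = V ^+ n.+1 by rewrite exprS mulrA PV.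
  by rewrite -(mulrA _ (star V ^+ n.+1) P) h1 !mulrA h2.
apply: (bop_eq_adherent B_dense) => _ [b Bb <-].
by rewrite -/P -bopME -BP// bopME /P bopME -{1}V_Om -(bopME (star V)) Vstar_V /= V_Om.
Qed.

Definition translate n a := V ^+ n * pi_oo a * star V ^+ n.
Local Notation tr := translate.

(** The algebras [V^n pi_oo(A) V^*^n] increase with [n], so their union is an algebra. *)
Lemma translate_raise n m a : tr n a = tr (n + m) (iter m Phi a).
Proof.
elim: m => [|m IH]; first by rewrite addn0.
have pi_ooE b : pi_oo b = V * pi_oo (Phi b) * star V.
  by rewrite pi_oo_Phi !mulrA V_Vstar mul1r -mulrA V_Vstar mulr1.
by rewrite IH addnS iterS /tr exprSr exprS [in LHS]pi_ooE !mulrA.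
Qed.

Lemma translateM n a b : tr n a * tr n b = tr n (a * b).
Proof.
rewrite /tr -!mulrA (mulrA (star V ^+ n)) Vstar_V_pow mul1r.
by rewrite pi_ooM !mulrA.
Qed.

Lemma translate_star n a : star (tr n a) = tr n (star a).
Proof. by rewrite /tr !star_bopM !star_bopX star_bopK pi_oo_star mulrA. Qed.

Let B_translate b : B b <-> exists n a, b = tr n a.
Proof.
split; last by move=> [n [a ->]]; apply: sub_gen_smallest; exists n, a.
move=> Bb.
apply: (@star_alg_sub (translates pi_oo V) [set b | exists n a, b = tr n a]) Bb => //.
split.
- by exists 0%N, 1; rewrite /tr !expr0 mul1r mulr1 pi_oo1.
- move=> c _ _ [n [a ->]] [m [a' ->]].
  exists (n + m)%N, (c *: iter m Phi a + iter n Phi a').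
  rewrite (translate_raise n m) (translate_raise m n) (addnC m) /tr pi_oo_linear mulrDr mulrDl.
  by rewrite -scalerAr -scalerAl.
- move=> _ _ [n [a ->]] [m [a' ->]].
  exists (n + m)%N, (iter m Phi a * iter n Phi a').
  by rewrite (translate_raise n m) (translate_raise m n) (addnC m) translateM.
- by move=> _ [n [a ->]]; exists n, (star a); rewrite translate_star.
Qed.

Let B_subalg : star_subalg B.
Proof.
have sub G : star_subalg (star_alg G : set (bop K K)).
  split=> [|c x y Gx Gy|x y Gx Gy|x Gx] N NP; have [[N1 NL NM Ns] _] := NP.
  - exact: N1.
  - exact: NL (Gx N NP) (Gy N NP).
  - exact: NM (Gx N NP) (Gy N NP).
  - exact: Ns (Gx N NP).
exact: sub.
Qed.

Let B_star b : B b -> B (star b).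
Proof. by case: B_subalg => _ _ _; exact. Qed.

Let Mh_subalg : star_subalg Mh.
Proof. exact: bicommutant_star_subalg. Qed.

Let B_Mh b : B b -> Mh b.
Proof. exact: sub_bicommutant. Qed.

Let pi_oo_B a : B (pi_oo a).
Proof. by apply/B_translate; exists 0%N, a; rewrite /tr !expr0 mul1r mulr1. Qed.

Lemma Vstar_Z0 x : star V (Z0 x) = Z0 (U x).
Proof.
rewrite -[LHS]/(bcomp (star V) Z0 x) -[RHS]/(bcomp Z0 U x).
congr (bopf _ x); apply: pi_ext => a /=.
by rewrite U_pi -!pi_oo_Z0 -Om_ooE -{1}V_Om -!bopME pi_oo_Phi.
Qed.

Lemma Vstar_pow_Z0 n x : (star V ^+ n) (Z0 x) = Z0 ((U ^+ n) x).
Proof.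
elim: n x => [|n IH] x; first by rewrite !expr0.
by rewrite !exprSr !bopME Vstar_Z0 IH.
Qed.

Lemma Vstar_pow_Om n : (star V ^+ n) Om_oo = Om_oo.
Proof.
elim: n => [|n IH]; first by rewrite expr0.
by rewrite exprS bopME IH -{1}V_Om -bopME Vstar_V.
Qed.

Lemma V_pow_Om n : (V ^+ n) Om_oo = Om_oo.
Proof.
elim: n => [|n IH]; first by rewrite expr0.
by rewrite exprS bopME IH V_Om.
Qed.

Local Notation E := (compress Z0).

Lemma adj_Z0K x : adj Z0 (Z0 x) = x.
Proof. by have := congr1 (fun T : bop H H => T x) (adj_isometry Z0_isometry). Qed.

(** Moving [V^*^n] past [Z0] turns the compression into [U^*^n pi(a) U^n]. *)
Lemma compress_translate n a : E (tr n a) = pi (iter n Phis a).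
Proof.
apply: bopP => x; rewrite -[LHS]/(adj Z0 (tr n a (Z0 x))) /tr !bopME.
by rewrite Vstar_pow_Z0 pi_oo_Z0 -adjU_pow -!bopME compress_U_pi_iter.
Qed.

Lemma inner_compress_l (b : bop K K) x y : inner (b (Z0 x)) (Z0 y) = inner x (E (star b) y).
Proof. by rewrite innerA innerA. Qed.

Lemma pi_adj a x y : inner x (pi a y) = inner (pi (star a) x) y.
Proof. by rewrite pi_star adjE. Qed.

Lemma pi_oo_adj a x y : inner x (pi_oo a y) = inner (pi_oo (star a) x) y.
Proof. by rewrite pi_oo_star adjE. Qed.

Lemma inner_compress (b b' : bop K K) x y :
  inner (b (Z0 x)) (b' (Z0 y)) = inner x (E (star b * b') y).
Proof. by rewrite innerA innerA. Qed.

Lemma Phis_iter_positive n a : exists d, iter n Phis (star a * a) = star d * d.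
Proof.
elim: n => [|n [d dE]]; first by exists a.
have [b bE] := ucp_positive Phis_ucp d; exists b.
by rewrite iterS dE.
Qed.

(** The lift is the closure of [b Om_oo |-> b (Z0 (T Om))]. It is bounded because [Phis]
    is positive: for [b = translate n a] one has [|b (Z0 x)| = |pi d x|], where
    [star d * d = iter n Phis (star a * a)], and [pi d] commutes with [T]. *)
Lemma commutant_lift T : commutant (range pi) T -> exists Th,
  [/\ commutant B Th, bcomp Th Z0 = bcomp Z0 T & bcomp (adj Z0) Th = bcomp T (adj Z0)].
Proof.
have lift S : commutant (range pi) S -> exists Sh : bop K K,
    forall b, B b -> Sh (b Om_oo) = b (Z0 (S Om)).
  move=> SS; have [c c0 Sc] := bop_rbound S.
  have [B1 BL _ _] := B_subalg.
  apply: (@bop_extension _ _ _ _ B (fun b => b Om_oo) (fun b => b (Z0 (S Om))) c) => //.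
  - by exists 1.
  move=> b /B_translate[n [a ->]].
  have [d dE] := Phis_iter_positive n a.
  have nrm x : rnorm (tr n a (Z0 x)) = rnorm (pi d x).
    apply: rnorm_eq; rewrite inner_compress translate_star translateM compress_translate dE.
    by rewrite piM bopME [RHS]innerA pi_star.
  rewrite Om_ooE !nrm -[pi d (S Om)]/((pi d * S) Om) -SS; last by exists d.
  exact: Sc.
move=> ST; have [Th ThE] := lift _ ST.
have STs : commutant (range pi) (star T) by exact: commutant_star.
have [Ts TsE] := lift _ STs.
have [B1 BL BM _] := B_subalg.
have adjTh : adj Th = Ts.
  apply: (bop_eq_adherent B_dense) => _ [b Bb <-].
  apply: (adherent_inner_inj B_dense) => _ [b' Bb' <-].
  rewrite TsE// -innerA ThE// Om_ooE !inner_compress.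
  have /B_translate[n [a ->]] : B (star b' * b) by apply: BM => //; exact: B_star.
  rewrite compress_translate; set d := iter n Phis a.
  have h : star T * pi d = pi d * star T by apply: STs; exists d.
  by rewrite -(bopME (pi d) (star T)) -h bopME -innerA.
have ThZ : bcomp Th Z0 = bcomp Z0 T.
  apply: pi_ext => a /=; rewrite -pi_oo_Z0 -Om_ooE ThE ?pi_oo_B// pi_oo_Z0.
  by rewrite -!bopME ST//; exists a.
have TsZ : bcomp Ts Z0 = bcomp Z0 (star T).
  apply: pi_ext => a /=; rewrite -pi_oo_Z0 -Om_ooE TsE ?pi_oo_B// pi_oo_Z0.
  by rewrite -!bopME STs//; exists a.
exists Th; split => //.
  move=> b Bb; apply: (bop_eq_adherent B_dense) => _ [b' Bb' <-].
  have h : Th (b (b' Om_oo)) = b (b' (Z0 (T Om))) by exact: (ThE (b * b') (BM _ _ Bb Bb')).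
  by rewrite !bopME h ThE.
rewrite -[LHS]adjK adj_comp adjK adjTh TsZ adj_comp.
by rewrite -[adj (star T)]/(star (star T)) star_bopK.
Qed.

(** * The compression to [H] and the separating vector *)

(** [Z0] and its adjoint intertwine [T] with its lift [Th], so [T] commutes with [E X]
    because [Th] commutes with [X]. *)
Lemma compress_bicommutant X : Mh X -> M (E X).
Proof.
move=> MX T MT; have [Th [BTh ThZ ZTh]] := commutant_lift MT.
apply: bopP => x; rewrite !bopME /=.
have h1 y : Th (Z0 y) = Z0 (T y) by exact: (congr1 (fun S : bop H K => S y) ThZ).
have h2 y : adj Z0 (Th y) = T (adj Z0 y).
  exact: (congr1 (fun S : bop K H => S y) ZTh).
by rewrite -h1 -bopME (MX _ BTh) bopME h2.
Qed.

Lemma B_conj_Vstar b : B b -> B (star V * b * V).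
Proof.
move=> /B_translate[n [a ->]]; apply/B_translate; exists n, (Phi a).
rewrite (translate_raise n 1) addn1 /tr exprS exprSr -!mulrA Vstar_V mulr1.
by rewrite (mulrA (star V)) Vstar_V mul1r.
Qed.

Lemma B_conj_V b : B b -> B (V * b * star V).
Proof.
move=> /B_translate[n [a ->]]; apply/B_translate; exists n.+1, a.
by rewrite /tr exprS exprSr !mulrA.
Qed.

Lemma commutant_conj (S : set (bop K K)) (W W' : bop K K) :
  W * W' = 1 -> (forall b, S b -> S (W' * b * W)) ->
  forall X, commutant S X -> commutant S (W * X * W').
Proof.
move=> WW' SW X SX b Sb.
have h1 : W' * b * W * W' = W' * b by rewrite -mulrA WW' mulr1.
have h2 : W * (W' * b * W) = b * W by rewrite !mulrA WW' mul1r.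
have Xc : X * (W' * b * W) = (W' * b * W) * X by apply: SX; exact: SW.
rewrite -(mulrA _ W' b) -h1; move: (W' * b * W) h2 Xc => c h2 Xc.
by rewrite !mulrA -(mulrA W X c) Xc mulrA h2.
Qed.

(** The conjugates by [V^n] of the lifts map [Om_oo] to a dense subset of the range of
    [V^n Z0], and these ranges exhaust [K]. *)
Lemma commutant_translates_dense y : adherent [set S Om_oo | S in commutant B] y.
Proof.
have powc n S : commutant B S -> commutant B (V ^+ n * S * star V ^+ n).
  elim: n => [|n IH] BS; first by rewrite !expr0 mul1r mulr1.
  rewrite exprS exprSr.
  have := commutant_conj V_Vstar B_conj_Vstar (IH BS); rewrite !mulrA; exact.
have step n h : adherent [set S Om_oo | S in commutant B] ((V ^+ n) (Z0 h)).
  apply: adherent_trans (adherent_bop (bcomp (V ^+ n) Z0) (commutant_dense h)).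
  move=> _ [_ [T ST <-] <-]; apply: adherent_self.
  have [Th [BTh ThZ _]] := commutant_lift ST.
  exists (V ^+ n * Th * star V ^+ n); first exact: powc.
  rewrite !bopME Vstar_pow_Om Om_ooE /=; congr ((V ^+ n) _).
  exact: (congr1 (fun S : bop H K => S Om) ThZ).
apply: adherent_trans (B_dense y) => _ [b /B_translate[n [a ->]] <-].
rewrite /tr !bopME Vstar_pow_Om.
have -> : pi_oo a Om_oo = Z0 (pi a Om) by rewrite Om_ooE pi_oo_Z0.
exact: step.
Qed.

Lemma Mh_separating X Y : Mh X -> Mh Y -> X Om_oo = Y Om_oo -> X = Y.
Proof. exact: commutant_separating commutant_translates_dense _ _. Qed.

(** * The embedding *)

Lemma compress_commutant S : commutant B S -> commutant (range pi) (E S).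
Proof.
move=> BS _ [a _ <-]; apply: bopP => x; rewrite !bopME /=.
rewrite -pi_oo_Z0 -bopME BS ?bopME//.
apply: inner_inj => y.
by rewrite -innerA pi_oo_adj pi_adj pi_oo_Z0 innerA.
Qed.

(** The prescription is bounded: [|S (Z0 (T Om))| = |T z|] for a vector [z] of norm
    [|S Om_oo|], by [commutant_vector]. *)
Lemma embedding_ex T : exists I : bop K K,
  M T -> forall S, commutant B S -> I (S Om_oo) = S (Z0 (T Om)).
Proof.
have [MT|nMT] := pselect (M T); last by exists 0.
have [c c0 Tc] := bop_rbound T.
have [||||||I IE] := @bop_extension _ _ _ _ (commutant B)
  (fun S : bop K K => S Om_oo) (fun S : bop K K => S (Z0 (T Om))) c c0.
- by exists 1; exact: commutant1.
- exact: commutant_linear.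
- by [].
- by [].
- move=> S BS.
  have QS : commutant (range pi) (bcomp (adj (bcomp S Z0)) (bcomp S Z0)).
    have -> : bcomp (adj (bcomp S Z0)) (bcomp S Z0) = E (star S * S).
      by rewrite adj_comp; exact: bopP.
    apply: compress_commutant; apply: commutantM => //; exact: commutant_star.
  have [z zP] := commutant_vector Om QS.
  have := zP _ MT; rewrite /= => ->; rewrite Om_ooE.
  have [M1 _ _ _] := M_subalg; have := zP _ M1; rewrite /= => ->.
  exact: Tc.
- exact: commutant_translates_dense.
- by exists I => _.
Qed.

Definition embedding T := sval (cid (embedding_ex T)).
Local Notation i := embedding.

Lemma embeddingE T S : M T -> commutant B S -> i T (S Om_oo) = S (Z0 (T Om)).
Proof. by move=> MT; exact: (svalP (cid (embedding_ex T)) MT). Qed.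

Lemma embedding_Om T : M T -> i T Om_oo = Z0 (T Om).
Proof. by move=> MT; have := @embeddingE T 1 MT (@commutant1 R K B). Qed.

Lemma embedding_Mh T : M T -> Mh (i T).
Proof.
move=> MT S BS; apply: (bop_eq_adherent commutant_translates_dense) => _ [S' BS' <-].
by rewrite !bopME -(bopME S S') !embeddingE//; exact: commutantM.
Qed.

Lemma embedding_Z0 T x : M T -> i T (Z0 x) = Z0 (T x).
Proof.
move=> MT; rewrite -[LHS]/(bcomp (i T) Z0 x) -[RHS]/(bcomp Z0 T x).
congr (bopf _ x); apply: (bop_eq_adherent commutant_dense) => _ [S SS <-] /=.
have [Sh [BSh ShZ _]] := commutant_lift SS.
have h y : Sh (Z0 y) = Z0 (S y) by exact: (congr1 (fun S : bop H K => S y) ShZ).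
by rewrite -h -Om_ooE embeddingE// h -!bopME MT.
Qed.

Lemma embedding_hom : star_hom M Mh i.
Proof.
have [M1 ML MM Ms] := M_subalg; have [N1 NL NM Ns] := Mh_subalg.
split; first exact: embedding_Mh.
- move=> c S T MS MT; apply: Mh_separating; first exact/embedding_Mh/ML.
    by apply: NL; exact: embedding_Mh.
  by rewrite bopDE bopZE !embedding_Om// ?bopDE ?bopZE ?bop_linear//; exact: ML.
- by apply: Mh_separating => //; [exact: embedding_Mh | rewrite embedding_Om// Om_ooE].
- move=> S T MS MT; apply: Mh_separating; first exact/embedding_Mh/MM.
    by apply: NM; exact: embedding_Mh.
  by rewrite bopME !embedding_Om// ?embedding_Z0//; exact: MM.
- move=> T MT; apply: Mh_separating; first exact/embedding_Mh/Ms.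
    exact/Ns/embedding_Mh.
  apply: (adherent_inner_inj commutant_translates_dense) => _ [S BS <-].
  have MsT := Ms _ MT.
  rewrite embedding_Om// -innerA embeddingE// Om_ooE.
  have ES : commutant (range pi) (E (star S)).
    by apply: compress_commutant; exact: commutant_star.
  have h : star T * E (star S) = E (star S) * star T by exact: MsT.
  by rewrite !inner_compress_l -(bopME (E _)) -h bopME -innerA.
Qed.

Lemma embedding_pi a : i (pi a) = pi_oo a.
Proof.
apply: Mh_separating; [exact: embedding_Mh | exact: B_Mh |].
by rewrite embedding_Om// -pi_oo_Z0 -Om_ooE.
Qed.

Lemma Z0_inj x y : Z0 x = Z0 y -> x = y.
Proof. by move=> /(congr1 (adj Z0)); rewrite !adj_Z0K. Qed.

Lemma embedding_inj : set_inj M i.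
Proof.
move=> S T; rewrite !inE => MS MT ST; apply: M_separating => //; apply: Z0_inj.
by rewrite -!embedding_Om// ST.
Qed.

(** * Normality of the embedding *)

(** The intertwiners from [Mh] to its amplification; they play for [l2 K] the role of the
    commutant of [B] for [K]. *)
Definition intertwiners := [set C : bop K (l2 K) | forall X, Mh X -> bcomp C X = bcomp (amp X) C].
Local Notation D := intertwiners.

Lemma intertwinersE C X v : D C -> Mh X -> C (X v) = amp X (C v).
Proof. by move=> DC MX; exact: (congr1 (fun S : bop K (l2 K) => S v) (DC X MX)). Qed.

Lemma intertwiners_linear c C C' : D C -> D C' -> D (c *: C + C').
Proof.
move=> DC DC' X MX; apply: bopP => v; rewrite -[LHS]/((c *: C + C') (X v)).
rewrite bopDE bopZE (intertwinersE _ DC MX) (intertwinersE _ DC' MX).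
by rewrite -[RHS]/(amp X (c *: C v + C' v)) bop_linear.
Qed.

Lemma intertwiners_dense v : adherent [set C Om_oo | C in D] v.
Proof.
apply: adherent_of_orth => //.
- by exists 0 => X _; apply: bopP => x /=; rewrite bop0r.
- exact: intertwiners_linear.
move=> z zD; apply: l2_ext => n; apply: (adherent_orth0 (commutant_translates_dense _)).
move=> _ [S BS <-]; rewrite inner_conj -inner_emb -inner_conj.
apply: (zD (bcomp (emb K n) S)) => X MX; apply: bopP => w /=.
by rewrite amp_emb -!(bopME _ _ w) (MX _ BS).
Qed.

Lemma intertwiners_vector C : D C -> exists z, forall T, M T ->
  rnorm (amp (i T) (C Om_oo)) = rnorm (T z).
Proof.
move=> DC; have QS : commutant (range pi) (bcomp (adj (bcomp C Z0)) (bcomp C Z0)).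
  have -> : bcomp (adj (bcomp C Z0)) (bcomp C Z0) = E (bcomp (adj C) C).
    by rewrite adj_comp; exact: bopP.
  apply: compress_commutant => b Bb; apply: bopP => v; rewrite !bopME /=.
  rewrite (intertwinersE _ DC (B_Mh Bb)); apply: inner_inj => w; rewrite -innerA.
  rewrite -[amp b]adjK -amp_adj -innerA -(intertwinersE _ DC (B_Mh (B_star Bb))).
  by rewrite innerA adjE.
have [z zP] := commutant_vector Om QS; exists z => T MT.
by rewrite -(zP _ MT) -(intertwinersE _ DC (embedding_Mh MT)) embedding_Om.
Qed.

(** Every vector of [l2 K] is a sum of vectors [C Om_oo] with geometrically decreasing
    norms; their representing vectors, rescaled, form a vector of [l2 H]. *)
Lemma amp_embedding_dominated (y : l2 K) : exists z : l2 H, forall T, M T ->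
  rnorm (amp (i T) y) <= 2 * rnorm (amp T z).
Proof.
pose h : R := 2^-1.
have h0 n : 0 < h ^+ n by rewrite exprn_gt0// invr_gt0.
have hS n : h ^+ n = 2 * h ^+ n.+1 by rewrite exprS mulrA divff// mul1r.
have h1 n : h ^+ n <= 1 by rewrite exprn_ile1// ?invr_ge0// invf_le1//; lra.
(* The radius [h^n h^n] leaves room for the rescaling by [h^-n = 2^n]. *)
have /choice[C CP] n : exists C, D C /\ rnorm (C Om_oo - y) < h ^+ n * h ^+ n.
  have [|_ [C DC <-] Cy] := intertwiners_dense y (e := h ^+ n * h ^+ n); first exact: mulr_gt0.
  by exists C.
pose G n := if n is m.+1 then (-1) *: C m + C m.+1 else C 0%N.
have GD n : D (G n).
  by case: n => [|n]; [exact: (CP 0%N).1 | apply: intertwiners_linear; exact: (CP _).1].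
pose c := rnorm y + 8.
have c0 : 0 <= c by have := rnorm_ge0 y; rewrite /c; lra.
have Gc n : rnorm (G n Om_oo) <= c * (h ^+ n * h ^+ n).
  case: n => [|n].
    have := (CP 0%N).2; rewrite /= !expr0 !mulr1 /c => h2.
    by have := rnormD (C 0%N Om_oo - y) y; rewrite subrK; lra.
  rewrite /G bopDE bopZE scaleN1r addrC.
  apply: le_trans (rnormB_tri y _ _) _; rewrite (rnormBC y).
  have := (CP n).2; have := (CP n.+1).2; rewrite (hS n) /c.
  have := rnorm_ge0 y; have := h0 n.+1; move: (h ^+ n.+1) (rnorm y) => u r u0 r0.
  have : 0 < u * u by exact: mulr_gt0.
  have : 0 <= r * (u * u) by rewrite !mulr_ge0// ltW.
  move: (rnorm _) (rnorm _) => p q *; lra.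
have /choice[z zP] n := intertwiners_vector (GD n).
have i1 : i 1 = 1 by case: embedding_hom.
have zc n : rnorm (z n) <= c * (h ^+ n * h ^+ n).
  have [M1 _ _ _] := M_subalg.
  by have := zP n _ M1; rewrite i1 amp1 => <-; exact: Gc.
pose w n : H := ((h ^- n)%:C)%C *: z n.
have hinv n : Normc.normc ((h ^- n)%:C)%C = h ^- n.
  by rewrite normc_real ger0_norm// invr_ge0 ltW.
have w_le n : rnorm (w n) <= c * h ^+ n.
  by rewrite rnormZ hinv mulrC ler_pdivrMr// -mulrA.
have wl2 : w \in @l2_pred R H.
  apply/asboolP/square_summableP; exists (c ^+ 2 * 2) => N.
  apply: (@le_trans _ _ (c ^+ 2 * (2 - 2 * h ^+ N))); last first.
    by rewrite ler_wpM2l ?sqr_ge0// lerBlDr lerDl mulr_ge0// ltW.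
  elim: N => [|N IH]; first by rewrite /sqsum big_nil expr0 mulr1 subrr mulr0.
  rewrite sqsumS; have : rnorm (w N) ^+ 2 <= c ^+ 2 * h ^+ N.
    apply: le_trans (_ : (c * h ^+ N) ^+ 2 <= _).
      by rewrite ler_sqr ?nnegrE ?rnorm_ge0 ?mulr_ge0// ltW.
    rewrite exprMn ler_wpM2l ?sqr_ge0// expr2.
    by have := h1 N; have := h0 N; nra.
  move: IH; rewrite (hS N) !mulrBr; move: (c ^+ 2) (h ^+ N.+1) (sqsum w N) => *; lra.
exists (L2 wl2) => T MT; set t := rnorm (amp T (L2 wl2)).
have t0 : 0 <= t by exact: rnorm_ge0.
have Gt n : rnorm (amp (i T) (G n Om_oo)) <= h ^+ n * t.
  rewrite zP//; have -> : rnorm (T (z n)) = h ^+ n * rnorm (T (w n)).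
    by rewrite bopZ rnormZ hinv mulrA divff ?mul1r// gt_eqF.
  rewrite (ler_wpM2l (ltW (h0 n)))//; have := rnorm_coord (amp T (L2 wl2)) n.
  by rewrite ampE.
have Ct n : rnorm (amp (i T) (C n Om_oo)) <= (2 - h ^+ n) * t.
  elim: n => [|n IH]; first by have := Gt 0%N; rewrite /= expr0; lra.
  have -> : C n.+1 Om_oo = C n Om_oo + G n.+1 Om_oo.
    by rewrite /G bopDE bopZE scaleN1r addrA subrr add0r.
  rewrite bopD; apply: le_trans (rnormD _ _) _.
  have := Gt n.+1; move: IH; rewrite (hS n) !mulrBl -mulrA; lra.
have Cy : hcvg (fun n => C n Om_oo) y.
  move=> e e0; exists (Num.truncn e^-1) => n Nn.
  apply: lt_le_trans (CP n).2 _.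
  apply: (@le_trans _ _ (h ^+ n)); first by have := h1 n; have := h0 n; nra.
  rewrite /h exprVn -[e]invrK lef_pV2 ?posrE ?invr_gt0 ?exprn_gt0//.
  apply: ltW; apply: lt_le_trans (truncnS_gt _) _; rewrite -natrX ler_nat.
  exact: leq_ltn_trans Nn (ltn_expl n _).
apply: hcvg_le (hcvg_bop (amp (i T)) Cy) _ => n /=.
apply: le_trans (Ct n) _; rewrite ler_wpM2r// lerBlDr lerDl; exact/ltW.
Qed.

(** By the domination, [inner x (amp (i T) y)] is a bounded functional of [amp T z];
    Riesz' theorem turns it into a form [sigma_form x' z]. *)
Lemma embedding_normal : normal_map M i.
Proof.
apply: normal_map_functional => x y; have [z zP] := amp_embedding_dominated y.
have [M1 ML _ _] := M_subalg; have [_ il _ _ _] := embedding_hom.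
have [||||x' _ x'P] := @riesz _ _ (bop H H) M (fun T => amp T z)
    (fun T => inner x (amp (i T) y)) (rnorm x * 2) _ ML.
- by exists 1.
- by move=> c S T _ _; rewrite amp_linear.
- by move=> c S T MS MT; rewrite il// amp_linear bopDE bopZE inner_linear.
- move=> T MT; apply: le_trans (inner_le _ _) _; rewrite -mulrA.
  by rewrite ler_wpM2l ?rnorm_ge0// zP.
- exact: sigma_form_normal x'P.
Qed.

(** * The dilation *)

Definition shift X := star V * X * V.
Local Notation Phih := shift.

Lemma shift_Mh X : Mh X -> Mh (Phih X).
Proof.
move=> MX; rewrite /Phih; apply: commutant_conj MX; first exact: Vstar_V.
exact: (commutant_conj V_Vstar B_conj_Vstar).
Qed.

Lemma unshift_Mh X : Mh X -> Mh (V * X * star V).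
Proof.
apply: commutant_conj; first exact: V_Vstar.
exact: (commutant_conj Vstar_V B_conj_V).
Qed.

Lemma iter_shift n X : iter n Phih X = star V ^+ n * X * V ^+ n.
Proof.
elim: n => [|n IH]; first by rewrite !expr0 mul1r mulr1.
by rewrite iterS IH /Phih exprS exprSr !mulrA.
Qed.

Lemma shiftK X : Phih (V * X * star V) = X.
Proof. by rewrite /Phih !mulrA Vstar_V mul1r -mulrA Vstar_V mulr1. Qed.

Lemma shift_hom : star_hom Mh Mh Phih.
Proof.
split; first exact: shift_Mh.
- by move=> c X Y _ _; rewrite /Phih mulrDr mulrDl -scalerAr -scalerAl.
- by rewrite /Phih mulr1 Vstar_V.
- move=> X Y _ _; rewrite /Phih !mulrA; congr (_ * V); congr (_ * Y).
  by rewrite -!mulrA V_Vstar mulr1.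
- by move=> X _; rewrite /Phih !star_bopM star_bopK mulrA.
Qed.

Lemma shift_auto : star_automorphism Mh Phih.
Proof.
split; [exact: shift_hom | split].
- exact: shift_Mh.
- move=> X Y _ _ /(congr1 (fun Z => V * Z * star V)).
  by rewrite /Phih !mulrA V_Vstar !mul1r -!mulrA V_Vstar !mulr1.
- by move=> X MX; exists (V * X * star V); [exact: unshift_Mh | exact: shiftK].
Qed.

Lemma shift_normal : normal_map Mh Phih.
Proof. by apply: (@normal_map_compress _ _ _ _ _ V) => T _; exact: bopP. Qed.

Let Om_norm : inner Om Om = 1.
Proof.
have [_ [_ h _] _] := cstar_sys.
by rewrite -h phiE pi1.
Qed.

Lemma vector_state_facts (L : hilbertType R) (N : set (bop L L)) (w : L) :
  inner w w = 1 -> (forall X, N X -> X w = 0 -> X = 0) ->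
  (forall X, N X -> N (star X * X)) ->
  [/\ state_on N (vector_state w), normal_functional N (vector_state w) &
      faithful_on N (vector_state w)].
Proof.
move=> w1 sep Nss.
have pos X : vector_state w (star X * X) = inner (X w) (X w).
  by rewrite /vector_state bopME [RHS]innerA.
split; last first.
- move=> X NX; rewrite pos inner_xx => /complexI/eqP.
  by rewrite sqrf_eq0 => /eqP/rnorm_eq0; exact: sep.
- exact: vector_state_normal.
split=> [c X Y _ _| |X _].
- by rewrite /vector_state bopDE bopZE inner_linear.
- exact: w1.
- by rewrite pos inner_ge0.
Qed.

Lemma M_system : wstar_system M Phib (vector_state Om).
Proof.
have [Phib_ucp Phib_normal PhibE] := Phib_assoc.
have M0 := star_subalg0 M_subalg; have [_ _ MM Ms] := M_subalg.
split; [exact: bicommutant_von_neumann | by [] | |].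
  apply: vector_state_facts => //.
    by move=> X MX X0; apply: M_separating.
  by move=> X MX; apply: MM => //; exact: Ms.
move=> T MT; rewrite /vector_state PhibE//.
by rewrite -adjE -[adj U Om]/(star U Om) Ustar_Om.
Qed.

Lemma Mh_system : wstar_system Mh Phih (vector_state Om_oo).
Proof.
have [_ _ MM Ms] := Mh_subalg; have M0 := star_subalg0 Mh_subalg.
split; [exact: bicommutant_von_neumann | | |].
- by split; [exact: star_hom_ucp Mh_subalg shift_hom | exact: shift_normal].
- apply: vector_state_facts.
  + by rewrite Om_ooE -[RHS]Om_norm innerA adj_Z0K.
  + by move=> X MX X0; apply: Mh_separating.
  + by move=> X MX; apply: MM => //; exact: Ms.
- by move=> X _; rewrite /vector_state /Phih !bopME V_Om -innerA V_Om.
Qed.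

Lemma Phib_M X : M X -> M (Phib X).
Proof. by case: Phib_assoc => -[h _ _ _] _ _; exact: h. Qed.

Lemma iter_Phib n X : M X -> M (iter n Phib X) /\ iter n Phib X Om = (U ^+ n) (X Om).
Proof.
move=> MX; elim: n => [|n [MI IE]]; first by rewrite expr0.
have [_ _ PhibE] := Phib_assoc.
by rewrite iterS PhibE// IE exprS; split=> //; exact: Phib_M.
Qed.

Lemma iter_shift_Mh n X : Mh X -> Mh (iter n Phih X).
Proof. by move=> MX; elim: n => [//|n IH]; rewrite iterS; exact: shift_Mh. Qed.

Lemma compress_bimodule T X : M T -> E (i T * X) = T * E X.
Proof.
move=> MT; have [_ _ _ _ istar] := embedding_hom; have [_ _ _ Ms] := M_subalg.
apply: bopP => x; apply: inner_inj => y.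
rewrite -[E _ x]/(adj Z0 (i T (X (Z0 x)))) bopME -[E X x]/(adj Z0 (X (Z0 x))).
rewrite -innerA -[i T]star_bopK -innerA -istar// embedding_Z0; last exact: Ms.
by rewrite innerA adjE.
Qed.

Lemma compress_iter n T : M T -> E (iter n Phih (i T)) = iter n Phib T.
Proof.
move=> MT; have [MI IE] := iter_Phib n MT.
apply: M_separating => //; first by apply/compress_bicommutant/iter_shift_Mh/embedding_Mh.
rewrite IE iter_shift -[LHS]/(adj Z0 ((star V ^+ n * i T * V ^+ n) (Z0 Om))).
by rewrite -Om_ooE !bopME V_pow_Om embedding_Om// Vstar_pow_Z0 adj_Z0K.
Qed.

Lemma compress_Z0_ucp : ucp Mh M E.
Proof.
by apply: compress_ucp; [exact: Z0_isometry | exact: Mh_subalg | exact: compress_bicommutant].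
Qed.

Lemma compress_Z0_normal : normal_map Mh E.
Proof. exact: (@normal_map_compress _ _ _ _ _ Z0). Qed.

(** [shift] applied [n] times maps [translate n a] to [pi_oo a], which is in the range of
    [i]; so the orbit contains the generators of [B]. *)
Lemma shift_minimal : minimal_dilation M Mh Phih i.
Proof.
apply/seteqP; split; last first.
  apply: smallest_sub; first exact: bicommutant_von_neumann.
  by move=> X [].
move=> X MX N [[Nstar NN] orbitN].
rewrite -NN; apply: (commutant_sub _ MX); apply: commutant_sub => b /B_translate[n [a ->]].
apply: orbitN; split; first by apply/B_Mh/B_translate; exists n, a.
exists n, (pi_oo a); first by exists (pi a); rewrite ?embedding_pi.
right; rewrite iter_shift /tr !mulrA Vstar_V_pow mul1r.
by rewrite -mulrA Vstar_V_pow mulr1.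
Qed.

Lemma dilation_exists :
  exists (Phih : bop K K -> bop K K) (i : bop H H -> bop K K)
         (E : bop K K -> bop H H),
    [/\ reversible_dilation M Phib (vector_state Om)
          Mh Phih (vector_state Om_oo) i E,
        minimal_dilation M Mh Phih i,
        (forall X, M X -> i X Om_oo = Z0 (X Om)) /\
        (forall i' : bop H H -> bop K K,
           (forall X, M X -> Mh (i' X) /\ i' X Om_oo = Z0 (X Om)) ->
           forall X, M X -> i' X = i X),
        (forall X, Mh X -> Phih X = star V * X * V) &
        (forall a k, E (V ^+ k * pi_oo a * star V ^+ k) =
                     pi (iter k Phis a)) /\
        (forall E' : bop K K -> bop H H,
           ucp Mh M E' -> normal_map Mh E' ->
           (forall a k, E' (V ^+ k * pi_oo a * star V ^+ k) =
                        pi (iter k Phis a)) ->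
           forall X, Mh X -> E' X = E X)].
Proof.
exists Phih, i, E; split.
- split.
  + exact: M_system.
  + exact: Mh_system.
  + exact: shift_auto.
  + by split; [exact: compress_Z0_ucp | exact: compress_Z0_normal].
  + by split; [exact: embedding_hom | exact: embedding_normal | exact: embedding_inj].
  + by move=> T X MT _; exact: compress_bimodule.
  + exact: compress_iter.
  + by move=> X _; rewrite /vector_state Om_ooE innerA.
- exact: shift_minimal.
- split; first exact: embedding_Om.
  move=> i' i'P X MX; have [MhX XE] := i'P X MX.
  by apply: Mh_separating => //; [exact: embedding_Mh | rewrite XE embedding_Om].
- by [].
- split; first by move=> a k; exact: compress_translate.
  move=> E' _ E'_normal E'P X MX.
  apply: (normal_maps_agree B_subalg E'_normal compress_Z0_normal _ MX) => b /B_translate[n [a ->]].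
  by rewrite compress_translate; exact: E'P.
Qed.

End Dilation.

Theorem proposition5 (R : realType)
    (* the C*-dynamical system *)
    (A : cstarType R) (Phi : A -> A) (phi : A -> R[i])
    (* its GNS representation and contraction *)
    (H : hilbertType R) (pi : A -> bop H H) (Om : H) (U : bop H H)
    (* its covariant GNS representation *)
    (K : hilbertType R) (pi_oo : A -> bop K K) (Om_oo : K) (V : bop K K)
    (Z0 : bop H K)
    (* the associated map on the bicommutant, and the adjoint of Phi *)
    (Phib : bop H H -> bop H H) (Phis : A -> A) :
  cstar_system Phi phi ->
  star_hom setT setT Phi ->
  gns phi pi Om ->
  gns_contraction Phi pi Om U ->
  cyclic_vector (commutant (range pi)) Om ->
  associated_map (bicommutant (range pi)) Om U Phib ->
  cgns Phi phi pi Om U pi_oo Om_oo V Z0 ->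
  phi_adjoint Phi phi Phis ->
  let M := bicommutant (range pi) in
  let Mh := bicommutant (star_alg (translates pi_oo V)) in
  exists (Phih : bop K K -> bop K K) (i : bop H H -> bop K K)
         (E : bop K K -> bop H H),
    [/\ reversible_dilation M Phib (vector_state Om)
          Mh Phih (vector_state Om_oo) i E,
        minimal_dilation M Mh Phih i,
        (forall X, M X -> i X Om_oo = Z0 (X Om)) /\
        (forall i' : bop H H -> bop K K,
           (forall X, M X -> Mh (i' X) /\ i' X Om_oo = Z0 (X Om)) ->
           forall X, M X -> i' X = i X),
        (forall X, Mh X -> Phih X = star V * X * V) &
        (forall a k, E (V ^+ k * pi_oo a * star V ^+ k) =
                     pi (iter k Phis a)) /\
        (forall E' : bop K K -> bop H H,
           ucp Mh M E' -> normal_map Mh E' ->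
           (forall a k, E' (V ^+ k * pi_oo a * star V ^+ k) =
                        pi (iter k Phis a)) ->
           forall X, Mh X -> E' X = E X)].
Proof. by move=> *; apply: dilation_exists; eassumption. Qed.
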